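(* Let $P$ be a $d\times d$ correlation matrix. As $\nu\to 0$, the $d$-dimensional $t$ copula $C^t_{\nu,P}$ converges pointwise to the unique extremal mixture copula that shares its concordance signature, i.e. to the unique extremal mixture copula $C^*$ with $\kappa(C^*_I) = \kappa((C^t_{\nu,P})_I)$ for all $I\subseteq\{1,\ldots,d\}$.
   Context: Let $d\ge 2$ and $\mathcal{D}=\{1,\ldots,d\}$. A correlation matrix is a real symmetric positive semi-definite matrix with ones on the diagonal (not necessarily of full rank). For $\nu>0$, $C^t_{\nu,P}$ denotes the copula of the $d$-dimensional multivariate Student $t$ distribution with $\nu$ degrees of freedom, location $\boldsymbol 0$ and dispersion matrix $P$: that is, the distribution function of $(F_\nu(X_1),\ldots,F_\nu(X_d))$, where $F_\nu$ is the distribution function of the univariate $t$ distribution with $\nu$ degrees of freedom and $\boldsymbol{X} = R A\boldsymbol{S}$ with $AA^\top = P$ ($A\in\mathbb{R}^{d\times d}$), $\boldsymbol{S}$ uniform on the unit sphere in $\mathbb{R}^d$, and $R>0$ independent of $\boldsymbol{S}$ with $R^2/d$ having the Fisher–Snedecor $F(d,\nu)$ distribution. Concordance probabilities: for a copula $C$ (distribution function on $[0,1]^d$ with standard uniform margins), let $\boldsymbol{U}\sim C$ and $\boldsymbol{U}^*$ an independent copy. For $I\subseteq\mathcal{D}$, $\boldsymbol{U}_I$ is the subvector with indices in $I$ and $C_I$ its distribution function. For $|I|\ge 2$, $\kappa(C_I) = \mathbb{P}(\{\boldsymbol{U}_I \le \boldsymbol{U}_I^*\}\cup\{\boldsymbol{U}_I^*\le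 \boldsymbol{U}_I\})$ (componentwise inequalities); $\kappa(C_I) = 1$ when $|I|\le 1$. The concordance signature of $C$ is the vector of all $\kappa(C_I)$. The concordance signature of $C^t_{\nu,P}$ depends only on $P$ and not on $\nu$. Extremal copulas: for $k\in\{1,\ldots,2^{d-1}\}$ let $\boldsymbol{s}_k\in\{0,1\}^d$ be the vector of digits of $k-1$ written as a $d$-digit binary number, let $J_k=\{j\in\mathcal{D}: s_{k,j}=0\}$ and $J_k^\complement = \mathcal{D}\setminus J_k$. The $k$th extremal copula is $C^{(k)}(\boldsymbol{u}) = (\min_{j\in J_k}u_j + \min_{j\in J_k^\complement}u_j - 1)^+$, with $\min_{j\in\emptyset}u_j = 1$ and $x^+=\max(x,0)$. An extremal mixture copula is a copula of the form $\sum_{k=1}^{2^{d-1}} w_k C^{(k)}$ with $w_k\ge 0$ and $\sum_k w_k = 1$. *)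

(* Defs.v *)
From mathcomp Require Export all_boot all_order all_algebra.
From mathcomp Require Export all_classical all_reals all_analysis.

Set Implicit Arguments.
Unset Strict Implicit.
Unset Printing Implicit Defensive.

Import Order.TTheory GRing.Theory Num.Theory.
Import numFieldNormedType.Exports.

Local Open Scope classical_set_scope.
Local Open Scope ring_scope.

(* Vectors of R^d are d-tuples, which carry the product sigma-algebra; matrices
   act on them through [mxact]. *)
Definition mxact (R : realType) (d : nat) (A : 'M[R]_d) (x : d.-tuple R) :
    d.-tuple R :=
  [tuple \sum_(j < d) A i j * tnth x j | i < d].

Definition correlation_mx (R : realType) (d : nat) (P : 'M[R]_d) : Prop :=
  [/\ P^T = P,
      (forall x : 'cV[R]_d, 0 <= (x^T *m P *m x) ord0 ord0) &
      (forall i : 'I_d, P i i = 1)].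

Definition cube (R : realType) (d : nat) : set (d.-tuple R) :=
  [set u | forall i : 'I_d, 0 <= tnth u i <= 1].

(* A function on [0,1]^d is represented by a function on R^d whose values
   outside of the cube are irrelevant. *)
Definition same_on_cube (R : realType) (d : nat) (C C' : d.-tuple R -> R) :
    Prop :=
  forall u, cube u -> C u = C' u.

Definition is_law (R : realType) (d : nat) (C : d.-tuple R -> R)
    (mu : probability (d.-tuple R) R) : Prop :=
  mu (@cube R d) = 1%E /\
  forall u, cube u ->
    mu [set x | forall i : 'I_d, tnth x i <= tnth u i] = (C u)%:E.

Definition is_copula (R : realType) (d : nat) (C : d.-tuple R -> R) : Prop :=
  exists2 mu : probability (d.-tuple R) R, is_law C mu &
    forall (i : 'I_d) (t : R), 0 <= t <= 1 ->
      mu [set x | tnth x i <= t] = t%:E.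

(* The law is determined by C (as a pi-system argument shows), so the choice
   made by [get] is immaterial when C is a copula. *)
Definition law (R : realType) (d : nat) (C : d.-tuple R -> R) :
    probability (d.-tuple R) R :=
  get [set mu | is_law C mu].

(* A point z of the product space is the pair (U, U* ). *)
Definition kappa (R : realType) (d : nat) (C : d.-tuple R -> R)
    (I : {set 'I_d}) : \bar R :=
  if (2 <= #|I|)%N then
    (law C \x law C)%E
      ([set z | forall i, i \in I -> tnth z.1 i <= tnth z.2 i] `|`
       [set z | forall i, i \in I -> tnth z.2 i <= tnth z.1 i])
  else 1%E.

(* Binary digit of k at position i of a d-digit expansion, most significant
   digit first.  The index k is the 1-based index of the extremal copula minus
   one. *)
Definition bdigit (d : nat) (k : nat) (i : 'I_d) : bool :=
  odd (k %/ 2 ^ (d - i.+1)).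

Definition extremal_copula (R : realType) (d : nat) (k : 'I_(2 ^ d.-1))
    (u : d.-tuple R) : R :=
  Num.max 0
    (\big[Num.min/1]_(j < d | ~~ bdigit k j) tnth u j +
     \big[Num.min/1]_(j < d | bdigit k j) tnth u j - 1).

Definition extremal_mixture_copula (R : realType) (d : nat)
    (C : d.-tuple R -> R) : Prop :=
  is_copula C /\
  exists w : 'I_(2 ^ d.-1) -> R,
    [/\ (forall k, 0 <= w k), \sum_k w k = 1 &
        same_on_cube C (fun u => \sum_k w k * extremal_copula k u)].

Definition same_signature (R : realType) (d : nat) (C C' : d.-tuple R -> R) :
    Prop :=
  forall I : {set 'I_d}, kappa C I = kappa C' I.

Definition Beta (R : realType) (a b : R) : R :=
  \int[lebesgue_measure]_(x in `]0, 1[) (x `^ (a - 1) * (1 - x) `^ (b - 1)).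

Definition student_pdf (R : realType) (nu x : R) : R :=
  (1 + x ^+ 2 / nu) `^ (- ((nu + 1) / 2)) /
  (Num.sqrt nu * Beta (1 / 2) (nu / 2)).

Definition student_cdf (R : realType) (nu x : R) : R :=
  \int[lebesgue_measure]_(y in `]-oo, x]) student_pdf nu y.

(* Density on ]0, +oo[ of the F(m, n) distribution. *)
Definition fisher_pdf (R : realType) (m n x : R) : R :=
  (m / n) `^ (m / 2) * x `^ (m / 2 - 1) *
  (1 + m / n * x) `^ (- ((m + n) / 2)) / Beta (m / 2) (n / 2).

Definition fisher_law (R : realType) (m n : R) (mu : set R -> \bar R) : Prop :=
  forall B : set R, measurable B ->
    mu B = (\int[lebesgue_measure]_(x in B `&` `]0%R, +oo[)
              (fisher_pdf m n x)%:E)%E.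

(* The uniform distribution on the unit sphere is the rotation-invariant
   probability measure carried by the sphere. *)
Definition sphere_uniform (R : realType) (d : nat)
    (mu : set (d.-tuple R) -> \bar R) : Prop :=
  mu [set s | \sum_(i < d) tnth s i ^+ 2 = 1] = 1%E /\
  forall O : 'M[R]_d, O *m O^T = 1%:M ->
    forall B : set (d.-tuple R), measurable B -> mu (mxact O @^-1` B) = mu B.

Definition independent_RV (d0 d1 d2 : measure_display)
    (T : measurableType d0) (T1 : measurableType d1) (T2 : measurableType d2)
    (R : realType) (Pr : probability T R) (X : {RV Pr >-> T1})
    (Y : {RV Pr >-> T2}) : Prop :=
  forall (B1 : set T1) (B2 : set T2), measurable B1 -> measurable B2 ->
    Pr (X @^-1` B1 `&` Y @^-1` B2) = (Pr (X @^-1` B1) * Pr (Y @^-1` B2))%E.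

(* [is_t_copula nu P C]: on the cube, C is the distribution function of
   (F_nu(X_1), ..., F_nu(X_d)) where X = Rad A S. *)
Definition is_t_copula (R : realType) (d : nat) (nu : R) (P : 'M[R]_d)
    (C : d.-tuple R -> R) : Prop :=
  exists (disp : measure_display) (Omega : measurableType disp)
    (Pr : probability Omega R) (Rad : {RV Pr >-> R})
    (S : {RV Pr >-> d.-tuple R}) (A : 'M[R]_d),
    [/\ A *m A^T = P,
        sphere_uniform (distribution Pr S),
        (forall w, 0 < Rad w) /\
          fisher_law d%:R nu
            (fun B => Pr [set w | B (Rad w ^+ 2 / d%:R)]),
        independent_RV Rad S &
        forall u, cube u ->
          Pr [set w | forall i : 'I_d,
                student_cdf nu (Rad w * tnth (mxact A (S w)) i) <= tnth u i]
          = (C u)%:E].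

(* Main.v *)
Require Import Defs.
From mathcomp Require Import all_boot all_order all_algebra.
From mathcomp Require Import all_classical all_reals all_analysis measurable_realfun ring lra.
Set Implicit Arguments.
Unset Strict Implicit.
Unset Printing Implicit Defensive.
Import Order.TTheory GRing.Theory Num.Theory.
Import numFieldNormedType.Exports.
Local Open Scope classical_set_scope.
Local Open Scope ring_scope.

(** Let sigma be the uniform law on the sphere and write the grades of the Student
vector as U_i = F_nu(R (A S)_i).

_Limit._  On the scale r = sqrt(nu) e^(L/nu) the two tails have the same limit:
both 2 (1 - F_nu(r)) and the probability of R > r tend to e^(-L) as nu tends
to 0 ([student_tail_limit], [fisher_radius_tail_limit]).  Hence 2 F_nu(R) - 1
is asymptotically uniform.  A factor c > 0 in front of R shifts L by nu ln c
only, so 2 F_nu(c R) - 1 has, in the limit, not just the same law but the same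
value V for all c > 0 ([centered_grade_limit]).  Therefore, given S, the grade
U_i tends to (1 + V)/2 when (A S)_i > 0 and to (1 - V)/2 when (A S)_i < 0:
only the sign pattern of A S survives ([joint_limit]).  As S and - S have the
same law, opposite patterns are equally likely, and averaging over a pattern
and its opposite turns the half-range V into a full uniform variable, that is,
into an extremal copula ([clamp_symmetrization]).  By dominated convergence in
S the limit is the extremal mixture whose k-th weight is the probability that
the set of negative coordinates of A S is one of the two blocks of the k-th
splitting ([t_copula_limit]).

_Signature._  Concordance of two independent Student vectors A Y and A Y' on I
only depends on the signs of A (Y - Y') on I, hence on the direction of Y - Y'.
Since Y = R S is rotation invariant and has no atoms, that direction is again
uniform on the sphere ([direction_uniform]), so kappa_I is the probability that
all coordinates of A S in I have the same sign ([kappa_t_copula]), for every nu.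
For an extremal mixture with weights w, kappa_I is the sum of the w_k over the
splittings that do not separate I ([kappa_extremal_mixture]).  The two values
agree for the weights of the limit, and these linear functionals determine w
([monochromatic_weights_inj]), which gives uniqueness.

The representations of the copulas for different nu may use different matrices
A and different probability spaces.  Two facts make them comparable: matrices
with the same A A^T differ by an orthogonal factor ([gram_orthogonal]), and a
rotation-invariant probability on the sphere is unique
([sphere_uniform_unique]); so the law of A S depends only on P
([sphere_uniform_gram]). *)

(** * Laws on R^d are determined by their distribution functions *)

Definition orthant (R : realType) (d : nat) (a : d.-tuple R) : set (d.-tuple R) :=
  [set x | forall i : 'I_d, tnth x i <= tnth a i].

Lemma measurable_forall d0 (T : measurableType d0) (I : finType) (Q : I -> Prop)
    (E : I -> set T) :
  (forall i, Q i -> measurable (E i)) -> measurable [set x | forall i, Q i -> E i x].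
Proof.
move=> mE.
rewrite [X in measurable X](_ : _ = \bigcap_(i in [set i | Q i]) E i); last first.
  by apply/seteqP; split => x /= h i; exact: h.
by apply: fin_bigcap_measurable => [|i Qi]; [exact: finite_finset|exact: mE].
Qed.

Lemma measurable_orthant (R : realType) (d : nat) (a : d.-tuple R) :
  measurable (orthant a).
Proof.
rewrite [X in measurable X](_ : _ = [set x | forall i, True ->
    ((@tnth d R)^~ i @^-1` `]-oo, tnth a i]) x]); last first.
  by apply/seteqP; split => x /= h i; have := h i; rewrite in_itv/=; [move=> hi _|exact].
apply: measurable_forall => i _; rewrite -[X in measurable X]setTI.
exact: measurable_tnth.
Qed.

(** The coordinate half-space x_i > t is the complement of a countable union of
orthants, whose other bounds grow to infinity. *)
Lemma orthant_generate (R : realType) (d : nat) :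
  @measurable _ (d.-tuple R) = <<s range (@orthant R d) >>.
Proof.
set S := <<s _ >>.
have S_sigma : sigma_algebra setT S by exact: smallest_sigma_algebra.
apply/seteqP; split; last first.
  apply: smallest_sub; first exact: sigma_algebra_measurable.
  by move=> _ [a _ <-]; exact: measurable_orthant.
apply: smallest_sub; first exact: S_sigma.
move=> A; rewrite -bigcup_seq => -[i _ [B mB <-]]; rewrite setTI.
pose M := [set B : set R | S ((@tnth d R)^~ i @^-1` B)].
suff : @measurable _ R `<=` M by apply.
have -> : @measurable _ R = (@measurable_realfun.RGenOInfty.G R).-sigma.-measurable.
  exact: measurable_realfun.RGenOInfty.measurableE.
apply: smallest_sub.
  split => [|C|F]; rewrite /M /=.
  - by rewrite preimage_set0; exact: sigma_algebra0.
  - by rewrite setTD preimage_setC; exact: sigma_algebraC.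
  - by rewrite preimage_bigcup; exact: sigma_algebra_bigcup.
move=> _ [t ->]; rewrite /M /=.
rewrite (_ : _ @^-1` _ = ~` \bigcup_n
   orthant [tuple if j == i then t else n%:R | j < d]); last first.
  rewrite -[LHS]setCK; congr (~` _).
  apply/seteqP; split => [x|x [n _ xn]].
    rewrite /= in_itv/= andbT => /negP; rewrite -leNgt => xi.
    exists (\max_(j < d) Num.bound `|tnth x j|)%N => //= j.
    rewrite tnth_mktuple; case: eqP => [->//|_].
    rewrite (le_trans (ler_norm _))// (le_trans (ltW (archi_boundP _)))//.
    by rewrite ler_nat (leq_bigmax j).
  have := xn i; rewrite tnth_mktuple eqxx /= in_itv/= andbT => xt.
  by apply/negP; rewrite -leNgt.
apply: sigma_algebraC; apply: sigma_algebra_bigcup => n.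
by apply: sub_sigma_algebra; eexists.
Qed.

Lemma orthant_cover (R : realType) (d : nat) :
  \bigcup_n orthant [tuple (n%:R : R) | j < d] = setT.
Proof.
apply/seteqP; split => // x _.
exists (\max_(j < d) Num.bound `|tnth x j|)%N => //= j.
rewrite tnth_mktuple (le_trans (ler_norm _))// (le_trans (ltW (archi_boundP _)))//.
by rewrite ler_nat (leq_bigmax j).
Qed.

Lemma orthant_ext (R : realType) (d : nat) (mu nu : probability (d.-tuple R) R) :
  (forall a, mu (orthant a) = nu (orthant a)) ->
  forall B, measurable B -> mu B = nu B.
Proof.
move=> munu B mB.
apply: (measure_unique (range (@orthant R d))
  (fun n => orthant [tuple (n%:R : R) | j < d])) => //.
- exact: orthant_generate.
- move=> _ _ [a _ <-] [b _ <-].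
  exists [tuple Num.min (tnth a j) (tnth b j) | j < d] => //.
  apply/seteqP; split => x.
    by move=> h; split => j; have := h j; rewrite tnth_mktuple le_min => /andP[].
  by move=> [h1 h2] j; rewrite tnth_mktuple le_min h1 h2.
- exact: orthant_cover.
- by move=> _ [a _ <-]; exact: munu.
- by move=> n; rewrite -ge0_fin_numE// fin_num_measure//; exact: measurable_orthant.
Qed.

Lemma measurable_cube (R : realType) (d : nat) : measurable (@cube R d).
Proof.
rewrite [X in measurable X](_ : _ = [set x | forall i, True ->
  ((@tnth d R)^~ i @^-1` `[0, 1]) x]); last first.
  by apply/seteqP; split => x /= h i; have := h i; rewrite in_itv/=; [move=> hi _|exact].
apply: measurable_forall => i _; rewrite -[X in measurable X]setTI.
exact: measurable_tnth.
Qed.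

(** A distribution function prescribed on the cube only determines the law because
the law is carried by the cube: bounds above 1 can be truncated, and orthants
with a negative bound miss the cube. *)
Lemma is_law_ext (R : realType) (d : nat) (C C' : d.-tuple R -> R)
    (mu nu : probability (d.-tuple R) R) :
  is_law C mu -> is_law C' nu -> same_on_cube C C' ->
  forall B, measurable B -> mu B = nu B.
Proof.
have mcube := @measurable_cube R d.
have restr (D : d.-tuple R -> R) (m : probability (d.-tuple R) R) a : is_law D m ->
    m (orthant a) = m (orthant a `&` @cube R d).
  move=> [m1 _]; rewrite [in LHS](_ : orthant a =
      (orthant a `&` @cube R d) `|` (orthant a `&` ~` @cube R d)); last first.
    by rewrite -setIUr setUv setIT.
  rewrite measureU//; [|exact: measurableI (measurable_orthant _) _|
      exact: measurableI (measurable_orthant _) (measurableC _)|]; last first.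
    by rewrite setIACA setICr setI0.
  rewrite [X in (_ + X)%E](_ : _ = 0%E) ?adde0//.
  apply/eqP; rewrite eq_le measure_ge0 andbT.
  rewrite -[X in (_ <= X)%E](_ : m (~` @cube R d) = 0%E); last first.
    by rewrite probability_setC// m1 subee.
  apply: le_measure; rewrite ?inE//; last exact: measurableC.
  exact: measurableI (measurable_orthant _) (measurableC _).
move=> lC lC' CC'; apply: orthant_ext => a.
rewrite (restr _ _ _ lC) (restr _ _ _ lC').
have [a0|/existsNP[i /negP ai]] := pselect (forall i, 0 <= tnth a i); last first.
  rewrite (_ : _ `&` _ = set0) ?measure0// -subset0 => x [xa xc].
  move: ai; rewrite (le_trans _ (xa i))//.
  by have /andP[] := xc i.
pose b := [tuple Num.min (tnth a j) 1 | j < d].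
have cb : cube b.
  by move=> i; rewrite tnth_mktuple le_min a0 ler01 ge_min lexx orbT.
have -> : orthant a `&` @cube R d = orthant b `&` @cube R d.
  apply/seteqP; split => x [xa xc]; split => // i.
    by rewrite tnth_mktuple le_min xa; have /andP[] := xc i.
  by have := xa i; rewrite tnth_mktuple le_min => /andP[].
rewrite -(restr _ _ _ lC) -(restr _ _ _ lC').
case: lC => _ /(_ _ cb); rewrite -/(orthant b) => ->.
case: lC' => _ /(_ _ cb); rewrite -/(orthant b) => ->.
by rewrite CC'.
Qed.

Lemma lawP (R : realType) (d : nat) (C : d.-tuple R -> R)
    (mu : probability (d.-tuple R) R) :
  is_law C mu -> forall B, measurable B -> law C B = mu B.
Proof.
move=> Cmu; have lC : is_law C (law C) by apply: (@getPex _ (is_law C)); exists mu.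
exact: is_law_ext lC Cmu _.
Qed.

(** * Orthogonal matrices and Gram matrices *)

Section householder.
Context {R : realType} {d : nat}.
Implicit Types x y v : 'rV[R]_d.

Definition dotp x y : R := (x *m y^T) 0 0.

Lemma dotpE x y : dotp x y = \sum_j x 0 j * y 0 j.
Proof. by rewrite /dotp mxE; under eq_bigr do rewrite mxE. Qed.

Lemma dotpC x y : dotp x y = dotp y x.
Proof. by rewrite !dotpE; apply: eq_bigr => j _; rewrite mulrC. Qed.

Lemma dotpBl x y v : dotp (x - y) v = dotp x v - dotp y v.
Proof. by rewrite /dotp mulmxBl !mxE. Qed.

Lemma dotpBr x y v : dotp v (x - y) = dotp v x - dotp v y.
Proof. by rewrite dotpC dotpBl !(dotpC v). Qed.

Lemma dotp_eq0 v : (dotp v v == 0) = (v == 0).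
Proof.
apply/eqP/eqP => [|->]; last by rewrite /dotp mul0mx mxE.
rewrite dotpE => /psumr_eq0P h; apply/rowP => j; rewrite !mxE.
by apply/eqP; rewrite -sqrf_eq0 expr2 h// => i _; rewrite -expr2 sqr_ge0.
Qed.

Definition householder v : 'M[R]_d := 1%:M - (2 / dotp v v) *: (v^T *m v).

Lemma mul_householder x v :
  x *m householder v = x - (2 * dotp x v / dotp v v) *: v.
Proof.
rewrite /householder mulmxBr mulmx1 -scalemxAr mulmxA.
rewrite [x *m v^T]mx11_scalar -/(dotp x v) mul_scalar_mx scalerA.
by congr (_ - _ *: _); rewrite mulrAC.
Qed.

Lemma householder_orthogonal v : v != 0 -> householder v *m (householder v)^T = 1%:M.
Proof.
rewrite -dotp_eq0 => v0.
have -> : (householder v)^T = householder v.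
  by rewrite /householder linearB /= linearZ /= trmx_mul trmxK trmx1.
apply/row_matrixP => i; rewrite row_mul row1 rowE !mul_householder.
rewrite dotpBl (_ : dotp (_ *: v) v = 2 * dotp (delta_mx 0 i) v); last first.
  by rewrite /dotp -scalemxAl mxE -/(dotp v v) divfK.
rewrite -addrA -opprD -scalerDl -mulrDl [X in X / _](_ : _ = 0); last by ring.
by rewrite mul0r scale0r subr0.
Qed.

(** The reflection in the mediating hyperplane of two vectors of equal length
exchanges them. *)
Lemma householder_swap x y : dotp x x = dotp y y -> x *m householder (x - y) = y.
Proof.
move=> xy; rewrite mul_householder.
have [->|xy0] := eqVneq x y; first by rewrite subrr scaler0 subr0.
suff -> : 2 * dotp x (x - y) / dotp (x - y) (x - y) = 1.
  by rewrite scale1r opprB addrC subrK.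
rewrite -[RHS](@divff _ (dotp (x - y) (x - y))) ?dotp_eq0 ?subr_eq0//.
by congr (_ / _); rewrite dotpBl !dotpBr xy (dotpC y x); ring.
Qed.

Lemma householder_fix x v : dotp x v = 0 -> x *m householder v = x.
Proof. by move=> xv; rewrite mul_householder xv mulr0 mul0r scale0r subr0. Qed.

End householder.

(** The rows are moved to their targets one after the other.  The reflection that
moves the k-th row fixes the earlier targets, since both the current k-th row
and its target have the same inner products with them. *)
Lemma gram_orthogonal (R : realType) (m d : nat) (A B : 'M[R]_(m, d)) :
  A *m A^T = B *m B^T -> exists2 Q : 'M[R]_d, Q *m Q^T = 1%:M & A *m Q = B.
Proof.
move=> AB.
suff:  exists2 Q : 'M[R]_d, Q *m Q^T = 1%:M &
    forall i : 'I_m, (i < m)%N -> row i A *m Q = row i B.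
  by move=> [Q QQ AQ]; exists Q => //; apply/row_matrixP => i; rewrite row_mul AQ.
have AB_dot i j : dotp (row i A) (row j A) = dotp (row i B) (row j B).
  have := congr1 (fun M : 'M[R]_m => M i j) AB; rewrite !mxE => ABij.
  rewrite !dotpE; transitivity (\sum_k A i k * A^T k j).
    by apply: eq_bigr => k _; rewrite !mxE.
  by rewrite ABij; apply: eq_bigr => k _; rewrite !mxE.
have dotp_orth (Q : 'M[R]_d) x y : Q *m Q^T = 1%:M -> dotp (x *m Q) (y *m Q) = dotp x y.
  by move=> QQ; rewrite /dotp trmx_mul mulmxA -(mulmxA x) QQ mulmx1.
(* Induction on the number of rows already moved to their targets. *)
move: {3}m => k; elim: k => [|k [Q QQ AQ]]; first by exists 1%:M; rewrite ?trmx1 ?mulmx1.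
have [km|mk] := ltnP k m; last first.
  by exists Q => // i ik; apply: AQ; exact: leq_trans (ltn_ord i) _.
pose ik := Ordinal km.
have [eqk|neqk] := eqVneq (row ik A *m Q) (row ik B).
  exists Q => // i; rewrite ltnS leq_eqVlt => /predU1P[ieq|]; last exact: AQ.
  by rewrite (_ : i = ik)//; exact: val_inj.
exists (Q *m householder (row ik A *m Q - row ik B)).
  rewrite trmx_mul mulmxA -(mulmxA Q) householder_orthogonal ?subr_eq0//.
  by rewrite mulmx1.
move=> i; rewrite ltnS mulmxA leq_eqVlt => /predU1P[ieq|ik'].
  rewrite (_ : i = ik); last exact: val_inj.
  by apply: householder_swap; rewrite dotp_orth.
rewrite AQ// householder_fix// dotpBr -[X in dotp X _ - _]AQ//.
by rewrite dotp_orth// AB_dot subrr.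
Qed.

Section mxact_theory.
Context {R : realType} {d : nat}.
Implicit Types (A B Q : 'M[R]_d) (x y : d.-tuple R).

Lemma tnth_mxact A x i : tnth (mxact A x) i = \sum_j A i j * tnth x j.
Proof. by rewrite tnth_mktuple. Qed.

Lemma mxactM A B x : mxact (A *m B) x = mxact A (mxact B x).
Proof.
apply: eq_from_tnth => i; rewrite !tnth_mxact.
under eq_bigr do rewrite mxE mulr_suml.
rewrite exchange_big /=; apply: eq_bigr => j _; rewrite tnth_mxact mulr_sumr.
by apply: eq_bigr => k _; rewrite mulrA.
Qed.

Lemma mxact1 x : mxact 1%:M x = x.
Proof.
apply: eq_from_tnth => i; rewrite tnth_mxact (bigD1 i)//= mxE eqxx mul1r.
by rewrite big1 ?addr0// => j ji; rewrite mxE eq_sym (negbTE ji) mul0r.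
Qed.

Definition sqnorm x : R := \sum_i tnth x i ^+ 2.

Lemma sqnorm_mxact Q x : Q *m Q^T = 1%:M -> sqnorm (mxact Q x) = sqnorm x.
Proof.
move=> /mulmx1C QQ; rewrite /sqnorm.
pose r : 'rV[R]_d := \row_j tnth x j.
have rO i : (r *m Q^T) 0 i = tnth (mxact Q x) i.
  by rewrite tnth_mxact mxE; apply: eq_bigr => j _; rewrite !mxE mulrC.
transitivity (dotp (r *m Q^T) (r *m Q^T)).
  by rewrite dotpE; apply: eq_bigr => i _; rewrite rO expr2.
rewrite /dotp trmx_mul trmxK mulmxA -(mulmxA r) QQ mulmx1 -/(dotp r r) dotpE.
by apply: eq_bigr => i _; rewrite !mxE expr2.
Qed.

(** Equality of norms is equality of the Gram matrices of two single rows. *)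
Lemma orthogonal_transitive x y : sqnorm x = sqnorm y ->
  exists2 Q, Q *m Q^T = 1%:M & mxact Q x = y.
Proof.
move=> xy; pose r (z : d.-tuple R) : 'rV[R]_d := \row_j tnth z j.
have [|Q QQ xO] := @gram_orthogonal R 1 d (r x) (r y).
  rewrite [LHS]mx11_scalar [RHS]mx11_scalar -!/(dotp _ _) !dotpE; congr (_%:M).
  move: xy; rewrite /sqnorm; under eq_bigr do rewrite expr2.
  under [X in _ = X -> _]eq_bigr do rewrite expr2.
  by move=> xy; under eq_bigr do rewrite !mxE; under [RHS]eq_bigr do rewrite !mxE.
exists Q^T; first by rewrite trmxK; exact: mulmx1C.
apply: eq_from_tnth => i; rewrite tnth_mxact.
have := congr1 (fun M : 'rV[R]_d => M 0 i) xO; rewrite !mxE => <-.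
by apply: eq_bigr => j _; rewrite !mxE mulrC.
Qed.

End mxact_theory.

(** * Uniqueness of the uniform law on the sphere *)

Lemma measurable_le_set d0 (T : measurableType d0) (R : realType) (f g : T -> R) :
  measurable_fun setT f -> measurable_fun setT g -> measurable [set x | f x <= g x].
Proof.
move=> mf mg; rewrite (_ : [set x | _] = setT `&` (fun x => f x <= g x) @^-1` [set true]).
  exact: measurable_fun_ler.
by rewrite setTI; apply/seteqP; split => x /=; [move=> ->|move=> /eqP; rewrite eqb_id].
Qed.

Lemma measurable_lt_set d0 (T : measurableType d0) (R : realType) (f g : T -> R) :
  measurable_fun setT f -> measurable_fun setT g -> measurable [set x | f x < g x].
Proof.
move=> mf mg; rewrite (_ : [set x | _] = setT `&` (fun x => f x < g x) @^-1` [set true]).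
  exact: measurable_fun_ltr.
by rewrite setTI; apply/seteqP; split => x /=; [move=> ->|move=> /eqP; rewrite eqb_id].
Qed.

Lemma measurable_eq_set d0 (T : measurableType d0) (R : realType) (f g : T -> R) :
  measurable_fun setT f -> measurable_fun setT g -> measurable [set x | f x = g x].
Proof.
move=> mf mg; rewrite (_ : [set x | _] = [set x | f x <= g x] `&` [set x | g x <= f x]).
  by apply: measurableI; exact: measurable_le_set.
apply/seteqP; split => x /=; first by move=> ->.
by move=> [fg gf]; apply/eqP; rewrite eq_le fg.
Qed.

(** Tonelli's theorem for the indicator of a set; all double integrals below are
of this form. *)
Lemma integral_section_swap d1 d2 (T1 : measurableType d1) (T2 : measurableType d2)
    (R : realType) (mu : probability T1 R) (nu : probability T2 R)
    (A : set (T1 * T2)) : measurable A ->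
  (\int[mu]_x nu [set y | A (x, y)] = \int[nu]_y mu [set x | A (x, y)])%E.
Proof.
move=> mA; have := indic_fubini_tonelli mu nu mA.
rewrite (indic_fubini_tonelli_FE nu mA) (indic_fubini_tonelli_GE mu mA) => h.
transitivity (\int[mu]_x (nu \o xsection A) x)%E.
  by apply: eq_integral => x _ /=; rewrite xsectionE.
by rewrite h; apply: eq_integral => x _ /=; rewrite ysectionE.
Qed.

Lemma measurable_section1 (d1 d2 : measure_display) (T1 : measurableType d1)
    (T2 : measurableType d2) (R : realType) (nu : probability T2 R) (A : set (T1 * T2)) :
  measurable A -> measurable_fun setT (fun x => nu [set y | A (x, y)]).
Proof.
move=> mA; apply: eq_measurable_fun (measurable_fun_xsection nu mA) => x _ /=.
by rewrite xsectionE.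
Qed.

Lemma measurable_section2 (d1 d2 : measure_display) (T1 : measurableType d1)
    (T2 : measurableType d2) (R : realType) (mu : probability T1 R) (A : set (T1 * T2)) :
  measurable A -> measurable_fun setT (fun y => mu [set x | A (x, y)]).
Proof.
move=> mA; apply: eq_measurable_fun (measurable_fun_ysection mu mA) => x _ /=.
by rewrite ysectionE.
Qed.

Section sphere.
Context {R : realType} {d : nat}.
Implicit Types (x y z : d.-tuple R) (r : R).

Definition sqdist x y : R := \sum_i (tnth x i - tnth y i) ^+ 2.

Lemma sqdist_mxact Q x y : Q *m Q^T = 1%:M ->
  sqdist (mxact Q x) (mxact Q y) = sqdist x y.
Proof.
move=> QQ; have e u v : sqdist u v = sqnorm [tuple tnth u i - tnth v i | i < d].
  by apply: eq_bigr => i _; rewrite tnth_mktuple.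
rewrite !e -[RHS](sqnorm_mxact _ QQ); congr sqnorm.
apply: eq_from_tnth => i; rewrite !tnth_mxact !tnth_mktuple -sumrB.
by apply: eq_bigr => j _; rewrite tnth_mktuple mulrBr.
Qed.

Definition sphere : set (d.-tuple R) := [set x | sqnorm x = 1].

Lemma measurable_sqnorm : measurable_fun setT (@sqnorm R d).
Proof.
apply: measurable_sum => i; apply: measurable_funX.
exact: measurable_tnth.
Qed.

Lemma measurable_sphere : measurable sphere.
Proof. exact: measurable_eq_set measurable_sqnorm _. Qed.

Lemma measurable_mxact (Q : 'M[R]_d) : measurable_fun setT (mxact Q).
Proof.
apply/measurable_fun_tnthP => i.
rewrite (_ : _ \o _ = fun x => \sum_j Q i j * tnth x j); last first.
  by apply/funext => x /=; rewrite tnth_mxact.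
apply: measurable_sum => j; apply: measurable_funM => //.
exact: measurable_tnth.
Qed.

Lemma measurable_sqdist : measurable_fun setT
  (fun z : d.-tuple R * d.-tuple R => sqdist z.1 z.2).
Proof.
apply: measurable_sum => i; apply: measurable_funX; apply: measurable_funB.
  by apply: (measurableT_comp (measurable_tnth i)).
by apply: (measurableT_comp (measurable_tnth i)).
Qed.

Definition sball x r : set (d.-tuple R) := [set y | sqdist x y < r ^+ 2].

Lemma measurable_sball x r : measurable (sball x r).
Proof.
apply: measurable_lt_set => //.
apply: measurable_sum => i; apply: measurable_funX; apply: measurable_funB => //.
exact: measurable_tnth.
Qed.

Lemma sqdistC x y : sqdist x y = sqdist y x.
Proof. by apply: eq_bigr => i _; rewrite -sqrrN opprB. Qed.

Lemma sqdist_coord x y i r : 0 < r -> sqdist x y < r ^+ 2 -> `|tnth x i - tnth y i| < r.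
Proof.
move=> r0 h; rewrite -(ltr_pXn2r (ltn0Sn 1)) ?nnegrE ?(ltW r0)//.
rewrite real_normK ?num_real// (le_lt_trans _ h)// /sqdist (bigD1 i)//= lerDl.
by apply: sumr_ge0 => j _; exact: sqr_ge0.
Qed.

Section uniform.
Variable mu : probability (d.-tuple R) R.
Hypothesis muU : sphere_uniform mu.

Lemma sphere_uniform_ae : {ae mu, forall x, sphere x}.
Proof.
exists (~` sphere); split => //; first exact: measurableC measurable_sphere.
have /= -> := probability_setC mu measurable_sphere.
by case: muU => -> _; rewrite subee.
Qed.

Lemma sphere_uniform_sball x y r : sphere x -> sphere y ->
  mu (sball x r) = mu (sball y r).
Proof.
move=> xS yS; have [|Q QQ Qxy] := @orthogonal_transitive R d x y.
  by rewrite xS yS.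
case: muU => _ /(_ _ QQ _ (measurable_sball y r)) <-; congr (mu _).
by apply/seteqP; split => z; rewrite /= /sball /= -{1}Qxy sqdist_mxact.
Qed.

(** Countably many balls of radius r centred on the sphere cover it, and they all
have the same measure; were it 0, the sphere would be null. *)
Lemma sphere_uniform_sball_gt0 x r : sphere x -> 0 < r -> (0 < mu (sball x r))%E.
Proof.
move=> xS r0; rewrite lt_neqAle measure_ge0 andbT; apply/eqP => mux0.
pose e := r / (2 * d.+1%:R).
have e0 : 0 < e by rewrite divr_gt0// mulr_gt0.
(* The sphere is cut by boxes of half-width e around rational points, which are
   enumerable; each nonempty piece has diameter less than r. *)
pose B n : set (d.-tuple R) := if unpickle n is Some q then
  sphere `&` [set z | forall i, `|tnth z i - ratr (tnth (q : d.-tuple rat) i)| < e]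
  else set0.
have B0 n : mu.-negligible (B n).
  rewrite /B; case: unpickle => [q|]; last exact: negligible_set0.
  have [[z [zS zq]]|/set0P/negP/negPn/eqP->] :=
      pselect ((sphere `&` [set z | forall i, `|tnth z i - ratr (tnth q i)| < e]) !=set0);
    last exact: negligible_set0.
  exists (sball z r); split; first exact: measurable_sball.
    by rewrite (sphere_uniform_sball r zS xS).
  move=> y [yS yq]; rewrite /sball /=.
  have h i : (tnth z i - tnth y i) ^+ 2 <= (2 * e) ^+ 2.
    rewrite -real_normK ?num_real// ler_pXn2r ?nnegrE//; last first.
      by rewrite mulr_ge0// ltW.
    have := zq i; have := yq i; rewrite !ltr_norml ler_norml => /andP[? ?] /andP[? ?].
    lra.
  apply: (@le_lt_trans _ _ (d%:R * (2 * e) ^+ 2)).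
    by rewrite -[d in leRHS]card_ord mulr_natl -sumr_const; apply: ler_sum => i _.
  rewrite (_ : 2 * e = r / d.+1%:R); last by rewrite /e invfM mulrCA mulVKf.
  rewrite expr_div_n mulrA ltr_pdivrMr ?exprn_gt0// mulrC.
  rewrite ltr_pM2l ?exprn_gt0// -natrX ltr_nat.
  by rewrite -mulnn mulSn ltnS leq_addr.
have [N [mN N0 BN]] := negligible_bigcup B0.
have : (mu sphere <= mu N)%E.
  apply: le_measure; rewrite ?inE//; first exact: measurable_sphere.
  move=> z zS; apply: BN.
  have /choice[q zq] : forall i : 'I_d, exists q : rat, `|tnth z i - ratr q| < e.
    move=> i; have [|q] := @rat_in_itvoo R (tnth z i - e) (tnth z i + e).
      by rewrite ltrBlDr -addrA ltrDl addr_gt0.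
    rewrite in_itv/= => h; exists q; move: h; rewrite ltr_norml => /andP[? ?].
    by apply/andP; split; lra.
  exists (pickle [tuple q i | i < d]) => //; rewrite /B pickleK; split => // i.
  by rewrite tnth_mktuple.
by case: muU => -> _; rewrite N0 lee_fin ler10.
Qed.

End uniform.

Lemma sphere_nonempty (mu : probability (d.-tuple R) R) :
  sphere_uniform mu -> exists x, sphere x.
Proof.
move=> muU; have [//|/set0P/negP/negPn/eqP s0] := pselect (sphere !=set0).
by case: muU; rewrite -/sphere s0 measure0 => /esym/eqP; rewrite onee_eq0.
Qed.

(** The form in which constancy on the sphere is used: a function that is constant
on the part of the sphere inside A and vanishes off A. *)
Lemma sphere_uniform_integral (mu : probability (d.-tuple R) R)
    (A : set (d.-tuple R)) (f : d.-tuple R -> \bar R) (c : \bar R) :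
  sphere_uniform mu -> measurable A -> measurable_fun setT f -> (0 <= c)%E ->
  (forall x, sphere x -> A x -> f x = c) -> (forall x, ~ A x -> f x = 0%E) ->
  (\int[mu]_x f x = c * mu A)%E.
Proof.
move=> muU mA mf c0 fA fA0.
rewrite -(integral_cst mu mA) (integral_mkcond A).
apply: ae_eq_integral => //.
  by apply/(measurable_restrictT _ mA); exact: measurable_cst.
apply: filterS (sphere_uniform_ae muU) => x xS _.
rewrite /patch; case: ifPn => [/set_mem xA|/negP xA]; first exact: fA.
by apply: fA0 => h; apply: xA; rewrite inE.
Qed.

(** Both sides are the measure of the pairs at distance less than r under the
product of mu and nu, integrated in the two possible orders. *)
Lemma sphere_uniform_sball_eq (mu nu : probability (d.-tuple R) R) x r :
  sphere_uniform mu -> sphere_uniform nu -> sphere x ->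
  mu (sball x r) = nu (sball x r).
Proof.
move=> muU nuU xS.
pose A : set (d.-tuple R * d.-tuple R) := [set z | sqdist z.1 z.2 < r ^+ 2].
have mA : measurable A by exact: measurable_lt_set measurable_sqdist _.
have := integral_section_swap mu nu mA.
rewrite (sphere_uniform_integral (A := setT) (c := nu (sball x r)) muU)//; last 3 first.
  exact: measurable_section1.
  by move=> y yS _; exact: sphere_uniform_sball.
  by move=> y [].
rewrite (sphere_uniform_integral (A := setT) (c := mu (sball x r)) nuU)//; last 3 first.
  exact: measurable_section2.
  move=> y yS _; rewrite (sphere_uniform_sball muU r xS yS); congr (mu _).
  by apply/seteqP; split => z; rewrite /A /sball /= sqdistC.
  by move=> y [].
by have /= -> := probability_setT mu; have /= -> := probability_setT nu; rewrite !mule1.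
Qed.

(** Christensen's argument.  Integrate over pairs (x, y) at distance less than r
with x in the orthant: integrating y first gives the mass h of a ball times
mu (orthant a); integrating x first gives at most h times nu of the orthant
enlarged by r.  Divide by h > 0 and let r tend to 0. *)
Lemma sphere_uniform_orthant_le (mu nu : probability (d.-tuple R) R) (a : d.-tuple R) :
  sphere_uniform mu -> sphere_uniform nu -> (mu (orthant a) <= nu (orthant a))%E.
Proof.
move=> muU nuU; have [x0 xS] := sphere_nonempty muU.
pose b r := [tuple tnth a i + r | i < d].
have step r : 0 < r -> (mu (orthant a) <= nu (orthant (b r)))%E.
  move=> r0; pose h := mu (sball x0 r).
  have h0 : (0 < h)%E by exact: sphere_uniform_sball_gt0.
  have hfin : h \is a fin_num by apply: fin_num_measure; exact: measurable_sball.
  pose A : set (d.-tuple R * d.-tuple R) :=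
    [set z | orthant a z.1 /\ sqdist z.1 z.2 < r ^+ 2].
  have mA : measurable A.
    apply: measurableI; last exact: measurable_lt_set measurable_sqdist _.
    by rewrite -[X in measurable X]setTI; apply: measurable_fst; [exact: measurableT|exact: measurable_orthant].
  have swap := integral_section_swap mu nu mA.
  have lhs : (\int[mu]_x nu [set y | A (x, y)] = h * mu (orthant a))%E.
    apply: sphere_uniform_integral => //.
    - exact: measurable_orthant.
    - exact: measurable_section1.
    - exact: ltW.
    - move=> x xS' xa; rewrite /h (sphere_uniform_sball_eq r muU nuU xS).
      rewrite -(sphere_uniform_sball nuU r xS' xS); congr (nu _).
      by apply/seteqP; split => y; rewrite /A /sball /=; [case|].
    - by move=> x xa; rewrite (_ : [set _ | _] = set0) ?measure0// -subset0 => y [].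
  rewrite -(@lee_pmul2l _ h)// -lhs swap.
  have mind : measurable_fun setT (fun y => h * (\1_(orthant (b r)) y)%:E)%E.
    apply: measurable_funeM; apply/measurable_EFinP.
    exact: measurable_indic (measurable_orthant _).
  rewrite -(@sphere_uniform_integral nu (orthant (b r))
    (fun y => h * (\1_(orthant (b r)) y)%:E)%E)//; last 4 first.
  - exact: measurable_orthant.
  - exact: ltW.
  - by move=> y _ yb; rewrite indicE mem_set// mule1.
  - by move=> y yb; rewrite indicE memNset// mule0.
  apply: ae_ge0_le_integral => //.
  - exact: measurable_section2.
  - by move=> y _; rewrite mule_ge0// ?lee_fin//; exact: ltW.
  - apply: filterS (sphere_uniform_ae nuU) => y yS _.
    rewrite indicE; have [yb|yb] := pselect (orthant (b r) y).
      rewrite mem_set// mule1 /h (sphere_uniform_sball muU r xS yS).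
      apply: le_measure; rewrite ?inE.
      + have := measurable_ysection y mA; rewrite ysectionE; exact.
      + exact: measurable_sball.
      + by move=> z []; rewrite /sball /= sqdistC.
    rewrite memNset// mule0 (_ : [set _ | _] = set0) ?measure0// -subset0 => z [/= za zy].
    apply: yb => i; rewrite tnth_mktuple.
    have := sqdist_coord i r0 zy; rewrite ltr_norml => /andP[].
    by have := za i; lra.
pose F n := orthant (b n.+1%:R^-1).
have Fcap : \bigcap_n F n = orthant a.
  apply/seteqP; split => [x xF i|x xa n _ i].
    apply/ler_addgt0Pr => e e0.
    have [n ne] : exists n : nat, n.+1%:R^-1 <= e.
      exists (Num.bound e^-1); rewrite invf_ple ?posrE//.
      apply: ltW; apply: lt_le_trans (archi_boundP _) _; last by rewrite ler_nat.
      by rewrite invr_ge0 ltW.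
    have := xF n I i; rewrite tnth_mktuple => /le_trans; apply.
    by rewrite lerD2l.
  by rewrite tnth_mktuple (le_trans (xa i))// lerDl invr_ge0.
have Fcvg : nu (F n) @[n --> \oo] --> nu (orthant a).
  rewrite -Fcap; apply: nonincreasing_cvg_mu.
  - by rewrite -ge0_fin_numE// fin_num_measure//; exact: measurable_orthant.
  - by move=> n; exact: measurable_orthant.
  - by rewrite Fcap; exact: measurable_orthant.
  - move=> m n mn; apply/subsetPset => x xF i; have := xF i; rewrite !tnth_mktuple.
    by move=> /le_trans; apply; rewrite lerD2l lef_pV2 ?posrE// ler_nat.
rewrite -(cvg_lim _ Fcvg)//; apply: lime_ge; first by apply/cvg_ex; eexists; exact: Fcvg.
by near=> n; apply: step.
Unshelve. all: by end_near. Qed.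

Lemma sphere_uniform_unique (mu nu : probability (d.-tuple R) R) :
  sphere_uniform mu -> sphere_uniform nu ->
  forall B, measurable B -> mu B = nu B.
Proof.
move=> muU nuU; apply: orthant_ext => a.
by apply/eqP; rewrite eq_le !sphere_uniform_orthant_le.
Qed.

End sphere.

(** * Hyperplanes are null for the uniform law on the sphere *)

Section hyperplane.
Context {R : realType} {d : nat}.
Implicit Types (x y z : d.-tuple R).

Definition inner x y : R := \sum_i tnth x i * tnth y i.

Lemma sqdist_inner x y : sqdist x y = sqnorm x + sqnorm y - 2 * inner x y.
Proof.
rewrite /sqdist /sqnorm /inner mulr_sumr -big_split -sumrB /=.
by apply: eq_bigr => i _; ring.
Qed.

Lemma inner_mxact Q x y : Q *m Q^T = 1%:M -> inner (mxact Q x) (mxact Q y) = inner x y.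
Proof.
move=> QQ; have := sqdist_mxact x y QQ; rewrite !sqdist_inner !sqnorm_mxact//.
by lra.
Qed.

Lemma measurable_inner x : measurable_fun setT (inner x).
Proof.
apply: measurable_sum => i; apply: measurable_funM => //.
exact: measurable_tnth.
Qed.

Definition hyperplane x : set (d.-tuple R) := [set y | inner x y = 0].

Lemma measurable_hyperplane x : measurable (hyperplane x).
Proof. exact: measurable_eq_set (measurable_inner x) _. Qed.

(** Points of the moment curve: any d of them are linearly independent. *)
Definition moment n : d.-tuple R := [tuple n%:R ^+ i | i < d].

(** A point of the sphere is the coefficient vector of a nonzero polynomial of
degree less than d, and it lies on the n-th hyperplane when n is a root. *)
Lemma moment_count N x : (0 < d)%N -> sphere x ->
  \sum_(n < N) \1_(hyperplane (moment n)) x <= d%:R :> R.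
Proof.
move=> d0 xS; pose p : {poly R} := \poly_(i < d) nth 0 (val x) i.
have pE n : p.[n%:R] = inner (moment n) x.
  rewrite horner_poly; apply: eq_bigr => i _.
  by rewrite tnth_mktuple mulrC (tnth_nth 0).
have p0 : p != 0.
  apply/eqP => pz; move: xS; rewrite /sphere /= /sqnorm big1.
    by move=> /esym/eqP; rewrite oner_eq0.
  move=> i _; rewrite (tnth_nth 0).
  have := congr1 (fun q : {poly R} => q`_i) pz.
  by rewrite /= coef_poly ltn_ord coef0 => ->; rewrite expr0n.
pose rs := [seq n%:R : R | n <- iota 0 N & root p n%:R].
have rsd : (size rs < size p)%N.
  apply: max_poly_roots => //.
    by apply/allP => t /mapP[n]; rewrite mem_filter => /andP[? _] ->.
  by rewrite map_inj_uniq ?filter_uniq ?iota_uniq//; exact: mulrIn (oner_neq0 R).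
have {rsd} : (size rs <= d)%N.
  by rewrite (leq_trans (ltnW rsd))// size_poly.
rewrite -(ler_nat R); apply: le_trans.
rewrite size_map size_filter -sum1_count -(big_mkord xpredT (fun n => \1_(hyperplane (moment n)) x)).
rewrite /index_iota subn0 natr_sum [leRHS]big_mkcond /=; apply: ler_sum => n _.
rewrite indicE rootE pE.
by have [/set_mem ->|] := boolP (x \in hyperplane (moment n)); rewrite ?eqxx//; case: ifP.
Qed.

(** All hyperplanes have the same measure by rotation invariance, and arbitrarily
many of them can be chosen so that each point of the sphere lies on at most d
of them; so N times the common measure is at most d for every N. *)
Lemma sphere_uniform_hyperplane (mu : probability (d.-tuple R) R) x :
  sphere_uniform mu -> sphere x -> mu (hyperplane x) = 0%E.
Proof.
move=> muU xS.
have d0 : (0 < d)%N.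
  rewrite lt0n; apply/eqP => d0; move: xS; rewrite /sphere /= /sqnorm.
  rewrite big1 => [/esym/eqP|[i id] _]; first by rewrite oner_eq0.
  by exfalso; move: id; rewrite d0.
have hyp n : mu (hyperplane (moment n)) = mu (hyperplane x).
  pose c := Num.sqrt (sqnorm (moment n)).
  have c0 : 0 < c.
    rewrite sqrtr_gt0 /sqnorm (bigD1 (Ordinal d0))//= tnth_mktuple expr0 expr1n.
    by rewrite ltr_wpDr// sumr_ge0// => i _; exact: sqr_ge0.
  pose u := [tuple tnth (moment n) i / c | i < d].
  have uS : sqnorm u = 1.
    rewrite /sqnorm; under eq_bigr do rewrite tnth_mktuple expr_div_n.
    rewrite -mulr_suml -/(sqnorm _) sqr_sqrtr ?divff//.
      by rewrite gt_eqF// -sqrtr_gt0.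
    by apply: sumr_ge0 => i _; exact: sqr_ge0.
  have -> : hyperplane (moment n) = hyperplane u.
    have e y : inner u y = inner (moment n) y / c.
      by rewrite /inner mulr_suml; apply: eq_bigr => i _; rewrite [tnth u i]tnth_mktuple mulrAC.
    apply/seteqP; split => y; rewrite /hyperplane /= e; first by move=> ->; rewrite mul0r.
    by move/eqP; rewrite mulf_eq0 invr_eq0 (gt_eqF c0) orbF => /eqP.
  have [|Q QQ Qux] := @orthogonal_transitive R d u x; first by rewrite uS xS.
  case: muU => _ /(_ _ QQ _ (measurable_hyperplane x)) <-; congr (mu _).
  by apply/seteqP; split => z; rewrite /= /hyperplane /= -{1}Qux inner_mxact.
(* Integrate the number of hyperplanes that contain a point. *)
have bound N : (N%:R%:E * mu (hyperplane x) <= d%:R%:E)%E.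
  have -> : (N%:R%:E * mu (hyperplane x) =
      \int[mu]_y \sum_(n < N) (\1_(hyperplane (moment n)) y)%:E)%E.
    rewrite ge0_integral_sum//; last first.
      move=> n; apply/measurable_EFinP.
      exact: measurable_indic (measurable_hyperplane _).
    rewrite (eq_bigr (fun=> mu (hyperplane x))) => [|n _].
      by rewrite sumr_const card_ord mule_natl.
    rewrite integral_indic//; last exact: measurable_hyperplane.
    by rewrite setIT -(hyp n).
  apply: (@le_trans _ _ (\int[mu]_y (d%:R)%:E)%E).
    apply: ae_ge0_le_integral => //.
    - by move=> y _; apply: sume_ge0 => n _; rewrite lee_fin.
    - apply: emeasurable_sum => n; apply/measurable_EFinP.
      exact: measurable_indic (measurable_hyperplane _).
    - apply: filterS (sphere_uniform_ae muU) => y yS _.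
      by rewrite sumEFin lee_fin moment_count.
  by rewrite integral_cst//= probability_setT mule1.
have hfin : mu (hyperplane x) \is a fin_num.
  by apply: fin_num_measure; exact: measurable_hyperplane.
apply/eqP; rewrite eq_le measure_ge0 andbT.
rewrite -(fineK hfin) lee_fin leNgt; apply/negP => h0.
have := bound (Num.bound (d%:R / fine (mu (hyperplane x)))).
rewrite -(fineK hfin) -EFinM lee_fin leNgt => /negP; apply.
rewrite -ltr_pdivrMr//; apply: archi_boundP.
by rewrite divr_ge0// ltW.
Qed.

Lemma sphere_uniform_coord0 (mu : probability (d.-tuple R) R) (A : 'M[R]_d) i :
  sphere_uniform mu -> (A *m A^T) i i = 1 ->
  mu [set s | tnth (mxact A s) i = 0] = 0%E.
Proof.
move=> muU Ai; pose x := [tuple A i j | j < d].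
have xS : sphere x.
  rewrite /sphere /= -Ai mxE; apply: eq_bigr => j _.
  by rewrite tnth_mktuple mxE expr2.
rewrite -(sphere_uniform_hyperplane muU xS); congr (mu _).
rewrite /hyperplane; apply/seteqP; split => s /=; rewrite tnth_mxact => Axs.
  by rewrite -[RHS]Axs; apply: eq_bigr => j _; rewrite tnth_mktuple.
by rewrite -[RHS]Axs; apply: eq_bigr => j _; rewrite tnth_mktuple.
Qed.

End hyperplane.

(** * Tails of the Student distribution *)

Section powers.
Context {R : realType}.
Implicit Types (x y p t e : R).

Lemma powR_pos_expR x p : 0 < x -> x `^ p = expR (p * ln x).
Proof. by move=> x0; rewrite /powR gt_eqF. Qed.

Lemma continuous_powR_pos (f : R -> R) p x :
  0 < f x -> {for x, continuous f} -> {for x, continuous (fun y => f y `^ p)}.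
Proof.
move=> fx0 cf; apply: (@continuous_comp _ _ _ f (@powR R ^~ p)) => //.
apply: differentiable_continuous; apply/derivable1_diffP.
by apply: derivable_powR; rewrite in_itv/= fx0.
Qed.

(** At x = e^(L/a) the factor x^(-a) is the e^(-L) of the tail asymptotics. *)
Lemma integral_powR_tail x a : 0 < x -> 0 < a ->
  (\int[lebesgue_measure]_(y in `[x, +oo[) (y `^ (- a - 1))%:E = (x `^ (- a) / a)%:E)%E.
Proof.
move=> x0 a0; pose F y := - (y `^ (- a) / a).
have dF y : 0 < y -> is_derive y 1 F (y `^ (- a - 1)).
  move=> y0; have -> : F = (- a^-1) \*: (@powR R ^~ (- a)).
    by apply/funext => z; rewrite /F mulrC -mulNr.
  have h := is_derive1_powR (- a) y0.
  refine (is_derive_eq (is_deriveZ (- a^-1) h) _).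
  by rewrite -[LHS]/(_ * _) mulrA mulrNN mulVf ?gt_eqF// mul1r.
rewrite (@ge0_continuous_FTC2y _ _ F _ 0)//.
- by rewrite sub0e /F EFinN oppeK.
- by move=> y _; exact: powR_ge0.
- apply: continuous_in_subspaceT => y; rewrite inE/= in_itv/= andbT => xy.
  by apply: continuous_powR_pos; [exact: lt_le_trans xy|exact: cvg_id].
- rewrite /F -[X in _ --> X]oppr0; apply: cvgN; rewrite -[X in _ --> X](mul0r a^-1).
  apply: cvgMr_tmp; apply/cvgrPdist_le => e e0; near=> y.
  have y0 : 0 < y by near: y; exact: nbhs_pinfty_gt.
  rewrite sub0r normrN ger0_norm ?powR_ge0// powRN invf_ple ?posrE ?powR_gt0//.
  rewrite -[leLHS]powRr1 ?invr_ge0 ?(ltW e0)// -(@mulVf _ a) ?gt_eqF// powRrM.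
  apply: ge0_ler_powR; rewrite ?nnegrE ?powR_ge0 ?(ltW a0) ?(ltW y0)//; apply: ltW.
- by move=> y xy; case: (dF y (lt_trans x0 xy)).
- apply: cvg_at_right_filter; apply: differentiable_continuous.
  by apply/derivable1_diffP; case: (dF x x0).
- move=> y; rewrite in_itv/= andbT => xy.
  by rewrite derive1E; case: (dF y (lt_trans x0 xy)).
Unshelve. all: by end_near. Qed.

Lemma powR_neg_upper t e : 0 < t -> 0 <= e -> (1 + t) `^ (- e) <= t `^ (- e).
Proof.
move=> t0 e0; rewrite !powRN lef_pV2 ?posrE ?powR_gt0 ?addr_gt0//.
by apply: ge0_ler_powR => //; rewrite ?nnegrE ?lerDr// ltW ?addr_gt0.
Qed.

(** Comparison of 1 + t with a pure power of t for t >= t0: the loss is a factor that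
tends to 1 as t0 grows. *)
Lemma powR_neg_lower t (t0 : R) e : 0 < t0 -> t0 <= t -> 0 <= e ->
  (1 + t0^-1) `^ (- e) * t `^ (- e) <= (1 + t) `^ (- e).
Proof.
move=> t00 t0t e0; have t_gt0 : 0 < t by exact: lt_le_trans t0t.
have i0 : 0 < 1 + t0^-1 by rewrite addr_gt0 ?invr_gt0.
rewrite -powRM ?(ltW i0) ?(ltW t_gt0)// !powRN lef_pV2 ?posrE ?powR_gt0 ?addr_gt0 ?mulr_gt0//.
apply: ge0_ler_powR => //.
  by rewrite nnegrE ltW ?addr_gt0.
  by rewrite nnegrE ltW ?mulr_gt0.
rewrite mulrDl mul1r addrC lerD2l mulrC ler_pdivlMr//.
by rewrite mul1r.
Qed.

End powers.

Section student.
Context {R : realType}.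
Variable nu : R.
Hypothesis nu0 : 0 < nu.
Let mu := @lebesgue_measure R.
Implicit Types x y : R.

Let g x := (1 + x ^+ 2 / nu) `^ (- ((nu + 1) / 2)).

Let base_gt0 x : 0 < 1 + x ^+ 2 / nu.
Proof. by rewrite ltr_wpDr// divr_ge0 ?sqr_ge0// ltW. Qed.

Let continuous_g : continuous g.
Proof.
move=> x; apply: (@continuous_powR_pos _ (fun y => 1 + y ^+ 2 / nu)) => //.
apply: cvgD; first exact: cvg_cst.
by apply: cvgMr_tmp; apply: continuousM; exact: cvg_id.
Qed.

Let h (s : R) := s `^ (1 / 2 - 1) * (1 - s) `^ (nu / 2 - 1).
Let F x := x ^+ 2 / (nu + x ^+ 2).

Let den_gt0 x : 0 < nu + x ^+ 2.
Proof. by rewrite ltr_wpDr// sqr_ge0. Qed.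

Let dF x : is_derive x 1 F (2 * nu * x / (nu + x ^+ 2) ^+ 2).
Proof.
have -> : F = (fun y => 1 - nu * (nu + y ^+ 2)^-1).
  apply/funext => y; rewrite /F; have := den_gt0 y => d0; field.
  by rewrite gt_eqF.
have d1 : is_derive x 1 (fun y : R => nu + y ^+ 2) (2 * x).
  apply: is_derive_eq; rewrite /= add0r mul1r -[x%:A]/(x * 1) mulr1.
  by ring.
have d2 := @is_deriveV R (fun y : R => nu + y ^+ 2) x _ _ (lt0r_neq0 (den_gt0 x)) d1.
refine (is_derive_eq (is_deriveB (@is_derive_cst _ R R 1 x 1) (is_deriveZ nu d2)) _).
rewrite sub0r -![_ *: _]/(_ * _); have /lt0r_neq0 d0 := den_gt0 x.
by field.
Qed.

Let F_lt x y : 0 <= x -> x < y -> F x < F y.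
Proof.
move=> x0 xy; rewrite /F ltr_pdivrMr// mulrAC ltr_pdivlMr//.
have xy2 : x ^+ 2 < y ^+ 2.
  by rewrite ltr_pXn2r// nnegrE// ltW// (le_lt_trans x0 xy).
rewrite -subr_gt0 [ltRHS](_ : _ = nu * (y ^+ 2 - x ^+ 2)); last by ring.
by rewrite mulr_gt0// subr_gt0.
Qed.

Let dFE : F^`()%classic = (fun x => 2 * nu * x / (nu + x ^+ 2) ^+ 2).
Proof. by apply/funext => x; rewrite derive1E; case: (dF x). Qed.

Let continuous_dF : continuous F^`()%classic.
Proof.
rewrite dFE => x; apply: continuousM.
  by apply: cvgMl_tmp; exact: cvg_id.
apply: continuousV; first by rewrite expf_neq0// lt0r_neq0.
have c : {for x, continuous (fun y => nu + y ^+ 2)}.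
  by apply: cvgD; [exact: cvg_cst|apply: continuousM; exact: cvg_id].
by apply: continuousM.
Qed.

Let continuous_F : continuous F.
Proof.
move=> x; apply: differentiable_continuous; apply/derivable1_diffP.
by case: (dF x).
Qed.

Let F_gt0 x : 0 < x -> 0 < F x.
Proof. by move=> x0; rewrite /F divr_gt0// exprn_gt0. Qed.

Let F_lt1 x : F x < 1.
Proof. by rewrite /F ltr_pdivrMr// mul1r ltrDr. Qed.

Let subst_gh x : 0 < x -> h (F x) * F^`()%classic x = 2 / Num.sqrt nu * g x.
Proof.
move=> x0; rewrite dFE /h /g.
have q0 := base_gt0 x.
set q := 1 + x ^+ 2 / nu in q0 *.
have -> : F x = x ^+ 2 / (nu * q).
  by rewrite /F /q; congr (_ / _); field; rewrite gt_eqF.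
have -> : 1 - x ^+ 2 / (nu * q) = q^-1.
  rewrite /q; field; rewrite (gt_eqF nu0)/=.
  exact: lt0r_neq0.
have -> : nu + x ^+ 2 = nu * q by rewrite /q; field; rewrite gt_eqF.
rewrite -powR12_sqrt ?ltW// !powR_pos_expR ?invr_gt0 ?divr_gt0 ?exprn_gt0 ?mulr_gt0//.
rewrite !lnM ?posrE ?invr_gt0 ?mulr_gt0// lnV ?posrE ?mulr_gt0//.
rewrite lnM ?posrE// lnV ?posrE//.
have -> : 2 * nu * x / (nu * q) ^+ 2 = 2 * expR (ln x - ln nu - ln q - ln q).
  rewrite !expRD !expRN !lnK ?posrE//; field.
  by rewrite !gt_eqF.
rewrite mulrCA -!expRD -mulrA -expRN -expRD; congr (_ * expR _).
by field.
Qed.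

Let measurable_g D : measurable_fun D (fun x => (g x)%:E).
Proof.
by apply/measurable_EFinP; apply: measurable_funTS; exact: continuous_measurable_fun.
Qed.

Let g_gt0 x : 0 < g x. Proof. exact: powR_gt0. Qed.

Let itv_cover :
  \bigcup_n [set` `[n.+1%:R^-1 : R, n.+1%:R]] = [set` `]0%R, +oo[].
Proof.
apply/seteqP; split => [x [n _]|x].
  rewrite /= !in_itv/= andbT => /andP[nx _].
  by apply: lt_le_trans nx; rewrite invr_gt0.
rewrite /= in_itv/= andbT => x0.
exists (maxn (Num.bound x) (Num.bound x^-1)) => //=; rewrite in_itv/=; apply/andP; split.
  rewrite invf_ple ?posrE//; apply: ltW.
  apply: lt_le_trans (archi_boundP _) _; first by rewrite invr_ge0 ltW.
  by rewrite ler_nat ltnW// ltnS leq_maxr.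
apply: ltW; apply: lt_le_trans (archi_boundP _) _; first exact: ltW.
by rewrite ler_nat ltnW// ltnS leq_maxl.
Qed.

Let F_surj s : 0 < s -> s < 1 -> exists2 x, 0 < x & F x = s.
Proof.
move=> s0 s1; have s10 : 0 < 1 - s by rewrite subr_gt0.
exists (Num.sqrt (nu * s / (1 - s))); first by rewrite sqrtr_gt0 divr_gt0// mulr_gt0.
rewrite /F sqr_sqrtr; last by rewrite ltW// divr_gt0// mulr_gt0.
field; rewrite (gt_eqF s10)/= [X in X != 0](_ : _ = nu); last by ring.
by rewrite gt_eqF.
Qed.

Let F_le x y : 0 <= x -> x <= y -> F x <= F y.
Proof. by move=> x0; rewrite le_eqVlt => /predU1P[->//|/(F_lt x0)/ltW]. Qed.

Let F_cover :
  \bigcup_n [set` `[F n.+1%:R^-1, F n.+1%:R]] = [set` `]0%R, 1%R[].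
Proof.
apply/seteqP; split => [s [n _]|s].
  rewrite /= !in_itv/= => /andP[ns sn].
  by rewrite (lt_le_trans _ ns) ?(le_lt_trans sn)// F_gt0// invr_gt0.
rewrite /= in_itv/= => /andP[s0 s1]; have [x x0 <-] := F_surj s0 s1.
have : (\bigcup_n [set` `[n.+1%:R^-1 : R, n.+1%:R]]) x.
  by rewrite itv_cover /= in_itv/= x0.
move=> [n _]; rewrite /= in_itv/= => /andP[nx xn].
exists n => //=; rewrite in_itv/= !F_le// ?invr_ge0//; exact: ltW.
Qed.

(** The substitution s = x^2 / (nu + x^2) identifies the normalizing constant of the
Student density with a Beta integral.  It is carried out on compact intervals
that exhaust the half-line. *)
Let beta_subst : (\int[mu]_(x in `]0%R, 1%R[) (h x)%:E =
   (2 / Num.sqrt nu)%:E * \int[mu]_(x in `]0%R, +oo[) (g x)%:E)%E.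
Proof.
have c_h x : 0 < x < 1 -> {for x, continuous h}.
  move=> /andP[x0 x1]; apply: (@continuousM _ _ (fun s => s `^ _)).
    by apply: (@continuous_powR_pos _ (fun y => y)) => //; exact: cvg_id.
  apply: (@continuous_powR_pos _ (fun y => 1 - y)); first by rewrite subr_gt0.
  by apply: cvgB; [exact: cvg_cst|exact: cvg_id].
have step n : (\int[mu]_(x in `[F (n.+1%:R^-1)%R, F n.+1%:R]) (h x)%:E =
   (2 / Num.sqrt nu)%:E * \int[mu]_(x in `[(n.+1%:R^-1)%R, n.+1%:R%R]) (g x)%:E)%E.
  have n0 : 0 < n.+1%:R^-1 :> R by rewrite invr_gt0.
  rewrite (@integration_by_substitution_increasing _ F h).
  - rewrite -ge0_integralZl//; last 2 first.
    + exact: measurable_g.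
    + by move=> x _; rewrite lee_fin ltW.
    apply: eq_integral => x; rewrite inE /= in_itv/= => /andP[nx _].
    by rewrite -EFinM; congr EFin; apply: subst_gh; exact: lt_le_trans nx.
  - by apply: (@le_trans _ _ 1); rewrite ?invf_le1// ler1n.
  - move=> x y; rewrite !in_itv/= => /andP[nx _] _; apply: F_lt.
    by rewrite (le_trans (ltW n0)).
  - by move=> x _; exact: continuous_dF.
  - by apply/cvg_ex; eexists; apply: cvg_at_right_filter; exact: continuous_dF.
  - by apply/cvg_ex; eexists; apply: cvg_at_left_filter; exact: continuous_dF.
  - split; first by move=> x _; case: (dF x).
      by apply: cvg_at_right_filter; exact: continuous_F.
    by apply: cvg_at_left_filter; exact: continuous_F.
  - apply: continuous_in_subspaceT => x; rewrite inE/= in_itv/= => /andP[nx xn].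
    by apply: c_h; rewrite (lt_le_trans _ nx) ?(le_lt_trans xn)// F_gt0.
have m_h (D : set R) : D `<=` [set` `]0%R, 1%R[] -> measurable D ->
   measurable_fun D (fun x => (h x)%:E).
  move=> D01 mD; apply/measurable_EFinP; apply: (measurable_funS _ D01) => //.
  apply: open_continuous_measurable_fun; first exact: interval_open.
  by move=> x; rewrite inE/= in_itv/=; exact: c_h.
have cvgl : (\int[mu]_(x in `[F (n.+1%:R^-1)%R, F n.+1%:R]) (h x)%:E @[n --> \oo] -->
    \int[mu]_(x in `]0%R, 1%R[) (h x)%:E)%E.
  rewrite -F_cover; apply: ge0_nondecreasing_set_cvg_integral => //.
  - move=> m n mn; apply/subsetPset => x; rewrite /= !in_itv/= => /andP[mx xm].
    by rewrite (le_trans _ mx) ?(le_trans xm)// F_le// ?invr_ge0// ?lef_pV2 ?posrE// ler_nat.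
  - by move=> n; apply: m_h => // x nx; rewrite -F_cover; exists n.
  - by move=> n x _; rewrite lee_fin mulr_ge0// powR_ge0.
have cvgr : ((2 / Num.sqrt nu)%:E * \int[mu]_(x in `[(n.+1%:R^-1)%R, n.+1%:R%R]) (g x)%:E @[n --> \oo] -->
    (2 / Num.sqrt nu)%:E * \int[mu]_(x in `]0%R, +oo[) (g x)%:E)%E.
  apply: cvgeZl => //.
  rewrite -itv_cover; apply: ge0_nondecreasing_set_cvg_integral => //.
  - move=> m n mn; apply/subsetPset => x; rewrite /= !in_itv/= => /andP[mx xm].
    by rewrite (le_trans _ mx) ?(le_trans xm)// ?lef_pV2 ?posrE// ler_nat.
  - by move=> n; exact: measurable_g.
  - by move=> n x _; rewrite lee_fin ltW.
rewrite -(cvg_lim _ cvgl)// -(cvg_lim _ cvgr)//.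
by under eq_fun do rewrite step.
Qed.

Let T x := (\int[mu]_(y in `[x, +oo[) (g y)%:E)%E.

Let T_ge0 x : (0 <= T x)%E.
Proof. by apply: integral_ge0 => y _; rewrite lee_fin ltW. Qed.

Let e0 : 0 <= (nu + 1) / 2.
Proof. by rewrite divr_ge0// addr_ge0// ltW. Qed.

Let e_gt0 L : 0 < Num.sqrt nu * expR (L / nu).
Proof. by rewrite mulr_gt0 ?sqrtr_gt0 ?expR_gt0. Qed.

Let power_tail x : 0 < x ->
  (\int[mu]_(y in `[x, +oo[) ((y ^+ 2 / nu) `^ (- ((nu + 1) / 2)))%:E =
   (nu `^ ((nu + 1) / 2) * (x `^ (- nu) / nu))%:E)%E.
Proof.
move=> x0; rewrite EFinM -integral_powR_tail// -ge0_integralZl//; last 3 first.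
- apply/measurable_EFinP; apply: measurable_funTS; exact: measurable_powR.
- by move=> y _; rewrite lee_fin powR_ge0.
- by rewrite lee_fin powR_ge0.
apply: eq_integral => y; rewrite inE/= in_itv/= andbT => xy.
have y0 : 0 < y by exact: lt_le_trans xy.
rewrite -EFinM; congr EFin; rewrite !powR_pos_expR ?divr_gt0 ?exprn_gt0// -expRD.
congr expR; rewrite ln_div ?posrE ?exprn_gt0// lnM ?posrE//.
by field.
Qed.

Let tail_value L : nu `^ ((nu + 1) / 2) * ((Num.sqrt nu * expR (L / nu)) `^ (- nu) / nu)
  = expR (- L) / Num.sqrt nu.
Proof.
rewrite -powR12_sqrt ?(ltW nu0)// !powR_pos_expR ?mulr_gt0 ?expR_gt0//.
rewrite lnM ?posrE ?expR_gt0// !expRK.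
have -> : nu^-1 = expR (- ln nu) by rewrite expRN lnK.
rewrite -!expRN -!expRD; congr expR; rewrite expRN lnK ?posrE//.
by field; rewrite gt_eqF.
Qed.

Let T_upper L : (T (Num.sqrt nu * expR (L / nu)) <= (expR (- L) / Num.sqrt nu)%:E)%E.
Proof.
rewrite -tail_value -power_tail//; apply: ge0_le_integral => //.
- by move=> y _; rewrite lee_fin ltW.
- exact: measurable_g.
- apply/measurable_EFinP; apply: measurable_funTS; apply: (measurableT_comp (measurable_powR _)).
  by apply: measurable_funM => //; apply: measurable_funX.
- move=> y; rewrite /= in_itv/= andbT => xy; rewrite lee_fin powR_neg_upper//.
  by rewrite divr_gt0// exprn_gt0// (lt_le_trans (e_gt0 _) xy).
Qed.

Let T_lower L : (((1 + expR (- (2 * L / nu))) `^ (- ((nu + 1) / 2)) *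
   (expR (- L) / Num.sqrt nu))%:E <= T (Num.sqrt nu * expR (L / nu)))%E.
Proof.
rewrite EFinM -tail_value -power_tail// -ge0_integralZl//; last 2 first.
- apply/measurable_EFinP; apply: measurable_funTS; apply: (measurableT_comp (measurable_powR _)).
  by apply: measurable_funM => //; apply: measurable_funX.
- by move=> y _; rewrite lee_fin powR_ge0.
apply: ge0_le_integral => //.
- by move=> y _; rewrite -EFinM lee_fin mulr_ge0// powR_ge0.
- apply: measurable_funeM; apply/measurable_EFinP.
  apply: measurable_funTS; apply: (measurableT_comp (measurable_powR _)).
  by apply: measurable_funM => //; apply: measurable_funX.
- exact: measurable_g.
- move=> y; rewrite /= in_itv/= andbT => xy; rewrite -EFinM lee_fin.
  have -> : expR (- (2 * L / nu)) = (expR (2 * L / nu))^-1 by rewrite expRN.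
  apply: powR_neg_lower => //; first exact: expR_gt0.
  have -> : expR (2 * L / nu) = (Num.sqrt nu * expR (L / nu)) ^+ 2 / nu.
    rewrite exprMn sqr_sqrtr ?(ltW nu0)// [RHS]mulrAC divff ?gt_eqF// mul1r.
    by rewrite -expRM_natl; congr expR; field; rewrite gt_eqF.
  rewrite ler_pM2r ?invr_gt0// ler_pXn2r// nnegrE ltW//.
  exact: lt_le_trans xy.
Qed.

Let g_le1 x : g x <= 1.
Proof.
rewrite /g powRN invf_le1 ?powR_gt0//.
rewrite -[leLHS](powRr0 (1 + x ^+ 2 / nu)) ler_powR//.
by rewrite lerDl divr_ge0 ?sqr_ge0// ltW.
Qed.

Let split_tail x y : x <= y ->
  (T x = \int[mu]_(z in `[x, y[) (g z)%:E + T y)%E.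
Proof.
move=> xy; rewrite /T -ge0_integral_setU//.
- by rewrite -itv_bndbnd_setU// ?bnd_simp.
- exact: measurable_g.
- by move=> z _; rewrite lee_fin ltW.
- apply/disj_setPS => z [] /=; rewrite !in_itv/= => /andP[_ zy] /andP[yz _].
  by move: (lt_le_trans zy yz); rewrite ltxx.
Qed.

Let itv_fin x y : x <= y -> (\int[mu]_(z in `[x, y[) (g z)%:E <= (y - x)%:E)%E.
Proof.
move=> xy; apply: (@le_trans _ _ (\int[mu]_(z in `[x, y[) 1%:E)%E).
  apply: ge0_le_integral => //.
  - by move=> z _; rewrite lee_fin ltW.
  - exact: measurable_g.
  - by move=> z _; rewrite lee_fin.
rewrite integral_cst//= mul1e lebesgue_measure_itv/= lte_fin.
by case: ifPn => // _; rewrite lee_fin subr_ge0.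
Qed.

Let T_fin x : T x \is a fin_num.
Proof.
rewrite ge0_fin_numE//.
pose y := Num.max x (Num.sqrt nu * expR (0 / nu)).
rewrite (@split_tail x y) ?le_max ?lexx// lte_add_pinfty//.
  by apply: le_lt_trans (itv_fin _) (ltry _); rewrite le_max lexx.
apply: le_lt_trans (ltry (expR (- 0) / Num.sqrt nu)).
apply: le_trans (T_upper 0).
apply: ge0_subset_integral => //; first exact: measurable_g.
  by move=> z _; rewrite lee_fin ltW.
by apply: subset_itvr; rewrite bnd_simp le_max lexx orbT.
Qed.

Let itv_fin_num x y : x <= y -> (\int[mu]_(z in `[x, y[) (g z)%:E)%E \is a fin_num.
Proof.
move=> xy; rewrite ge0_fin_numE; first by apply: le_lt_trans (itv_fin xy) (ltry _).
by apply: integral_ge0 => z _; rewrite lee_fin ltW.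
Qed.

Let T_strict x y : x < y -> fine (T y) < fine (T x).
Proof.
move=> xy; have [c cxy cmin] := @EVT_min R g x y (ltW xy) (continuous_subspaceT continuous_g).
rewrite (@split_tail x y) ?(ltW xy)// (fineD (itv_fin_num (ltW xy)) (T_fin y)).
rewrite ltrDr; apply: (@lt_le_trans _ _ (g c * (y - x))).
  by rewrite mulr_gt0// subr_gt0.
rewrite -lee_fin fineK; last exact: itv_fin_num (ltW xy).
have -> : ((g c * (y - x))%:E = \int[mu]_(z in `[x, y[) (g c)%:E)%E.
  by rewrite integral_cst//= lebesgue_measure_itv/= lte_fin xy -EFinB EFinM.
apply: ge0_le_integral => //.
- by move=> z _; rewrite lee_fin ltW.
- exact: measurable_g.
- move=> z; rewrite /= in_itv/= => /andP[xz zy]; rewrite lee_fin; apply: cmin.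
  by rewrite in_itv/= xz ltW.
Qed.

Let T_reflect x : (\int[mu]_(y in `]-oo, x]) (g y)%:E = T (- x))%E.
Proof.
rewrite -[x in LHS]opprK ge0_integration_by_substitutionNy.
- apply: eq_integral => y _; congr EFin.
  by rewrite /= /g sqrrN.
- exact: continuous_subspaceT.
- by move=> y _; exact: ltW.
Qed.

Let T_total x : fine (T (- x)) + fine (T x) = 2 * fine (T 0).
Proof.
have tot z : (\int[mu]_y (g y)%:E = T (- z) + T z)%E.
  rewrite -T_reflect -integral_itv_bndo_bndc; last exact: measurable_g.
  rewrite /T -ge0_integral_setU//.
  - by rewrite -itv_bndbnd_setU// ?bnd_simp// set_itvNyy.
  - exact: measurable_g.
  - by move=> y _; rewrite lee_fin ltW.
  - apply/disj_setPS => y [] /=; rewrite !in_itv/= andbT => yz zy.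
    by move: (lt_le_trans yz zy); rewrite ltxx.
rewrite mulr_natl mulr2n -!fineD//; congr fine.
by rewrite -tot (tot 0) oppr0.
Qed.

Let BetaE : Num.sqrt nu * Beta (1 / 2) (nu / 2) = 2 * fine (T 0).
Proof.
rewrite /Beta /Rintegral -/mu; have := beta_subst; rewrite /h => ->.
rewrite integral_itv_obnd_cbnd; last exact: measurable_g.
by rewrite -/mu -/(T 0) (@fineM _ (2 / Num.sqrt nu)%:E (T 0))//= mulrA mulrCA divff ?mulr1// gt_eqF// sqrtr_gt0.
Qed.

Let T0_gt0 : 0 < fine (T 0).
Proof.
apply: le_lt_trans (T_strict ltr01).
by rewrite fine_ge0.
Qed.

Let student_cdfE x : student_cdf nu x = fine (T (- x)) / (2 * fine (T 0)).
Proof.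
rewrite /student_cdf /Rintegral /student_pdf -/mu -T_reflect.
rewrite BetaE.
under eq_integral do rewrite EFinM.
rewrite ge0_integralZr//.
- by rewrite -/mu T_reflect (@fineM _ (T (- x)))//.
- exact: measurable_g.
- by move=> y _; rewrite lee_fin powR_ge0.
- by rewrite lee_fin invr_ge0 mulr_ge0// ltW.
Qed.

Lemma student_cdfN x : student_cdf nu (- x) = 1 - student_cdf nu x.
Proof.
rewrite !student_cdfE opprK; apply/eqP; rewrite eq_sym subr_eq -mulrDl addrC T_total divff//.
by rewrite gt_eqF// mulr_gt0.
Qed.

Lemma student_cdf_lt x y : x < y -> student_cdf nu x < student_cdf nu y.
Proof.
move=> xy; rewrite !student_cdfE ltr_pM2r ?invr_gt0 ?mulr_gt0//.
by apply: T_strict; rewrite ltrN2.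
Qed.

Lemma student_cdf_gt0 x : 0 < student_cdf nu x.
Proof.
rewrite student_cdfE divr_gt0 ?mulr_gt0//.
by apply: (@le_lt_trans _ _ (fine (T (- x + 1)))); rewrite ?fine_ge0// T_strict// ltrDl.
Qed.

Let tail_cdf x : 2 * (1 - student_cdf nu x) =
  2 / (nu * Beta (1 / 2) (nu / 2)) * (fine (T x) * Num.sqrt nu).
Proof.
rewrite -student_cdfN student_cdfE opprK -BetaE.
have B0 : 0 < Beta (1 / 2) (nu / 2).
  have : 0 < Num.sqrt nu * Beta (1 / 2) (nu / 2) by rewrite BetaE mulr_gt0.
  by rewrite pmulr_rgt0// sqrtr_gt0.
have s0 : 0 < Num.sqrt nu by rewrite sqrtr_gt0.
rewrite -[X in 2 / (X * _)](sqr_sqrtr (ltW nu0)).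
by field; rewrite !gt_eqF.
Qed.

Let tail_const_ge0 : 0 <= 2 / (nu * Beta (1 / 2) (nu / 2)).
Proof.
rewrite divr_ge0// mulr_ge0 ?(ltW nu0)//.
have : 0 < Num.sqrt nu * Beta (1 / 2) (nu / 2) by rewrite BetaE mulr_gt0.
by rewrite pmulr_rgt0 ?sqrtr_gt0// => /ltW.
Qed.

Let fineT_le x c : (T x <= c%:E)%E -> fine (T x) <= c.
Proof. by rewrite -lee_fin fineK. Qed.

Let fineT_ge x c : (c%:E <= T x)%E -> c <= fine (T x).
Proof. by rewrite -lee_fin fineK. Qed.

(** Dropping the 1 in 1 + x^2 / nu makes the tail integral explicit; at the argument
sqrt(nu) e^(L/nu) the power nu of the tail turns e^(L/nu) into e^L. *)
Lemma student_tail_upper L : 2 * (1 - student_cdf nu (Num.sqrt nu * expR (L / nu)))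
  <= 2 / (nu * Beta (1 / 2) (nu / 2)) * expR (- L).
Proof.
rewrite tail_cdf ler_wpM2l// -ler_pdivlMr ?sqrtr_gt0//.
exact: fineT_le (T_upper L).
Qed.

Lemma student_tail_lower L :
  2 / (nu * Beta (1 / 2) (nu / 2)) * expR (- L) *
  (1 + expR (- (2 * L / nu))) `^ (- ((1 + nu) / 2))
  <= 2 * (1 - student_cdf nu (Num.sqrt nu * expR (L / nu))).
Proof.
rewrite tail_cdf -mulrA ler_wpM2l// -ler_pdivrMr ?sqrtr_gt0//.
by rewrite mulrAC mulrC addrC [1 + nu]addrC addrC; exact: fineT_ge (T_lower L).
Qed.

(** At L = 0 the tail misses 1 by the mass between 0 and sqrt(nu), which is bounded
by the length of the interval because the unnormalized density is at most 1.
This is what calibrates the constant 2 / (nu Beta) in [tail_limit]. *)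
Lemma student_tail0 : 1 - 2 / (nu * Beta (1 / 2) (nu / 2)) * nu <=
  2 * (1 - student_cdf nu (Num.sqrt nu)).
Proof.
have : 2 / (nu * Beta (1 / 2) (nu / 2)) * (fine (T 0) * Num.sqrt nu) = 1.
  by rewrite -tail_cdf student_cdfE oppr0; field; rewrite gt_eqF.
rewrite tail_cdf; move: tail_const_ge0; set K := 2 / (nu * Beta _ _) => K0 KE.
rewrite -[X in X - _]KE -mulrBr ler_wpM2l// -[X in _ - X](sqr_sqrtr (ltW nu0)) expr2 -mulrBl.
rewrite ler_pM2r ?sqrtr_gt0// lerBlDr.
have s0 : 0 <= Num.sqrt nu by exact: sqrtr_ge0.
rewrite (split_tail s0) (fineD (itv_fin_num s0) (T_fin _)).
rewrite addrC lerD2l -lee_fin fineK; last exact: itv_fin_num.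
by rewrite -{2}(subr0 (Num.sqrt nu)) itv_fin.
Qed.

End student.

(** * Tails of the Fisher-Snedecor distribution and their limit *)

Section fisher.
Context {R : realType}.
Variables (m nu : R) (mu : set R -> \bar R).
Hypotheses (m2 : 2 <= m) (nu0 : 0 < nu).
Hypotheses (muF : fisher_law m nu mu) (muT : mu setT = 1%E).
Let leb := @lebesgue_measure R.
Implicit Types x y z : R.

Let B := Beta (m / 2) (nu / 2).

Let B_ge0 : 0 <= B.
Proof.
apply: fine_ge0; apply: integral_ge0 => x _.
by rewrite lee_fin mulr_ge0// powR_ge0.
Qed.

Let m0 : 0 < m. Proof. by apply: lt_le_trans m2. Qed.

Let e0 : 0 <= (m + nu) / 2.
Proof. by rewrite divr_ge0// addr_ge0// ltW. Qed.

Let f x := fisher_pdf m nu x.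

Let f_ge0 x : 0 <= f x.
Proof. by rewrite /f /fisher_pdf divr_ge0// !mulr_ge0// powR_ge0. Qed.

Let measurable_f D : measurable_fun D (fun x => (f x)%:E).
Proof.
apply/measurable_EFinP; apply: measurable_funTS.
apply: measurable_funM => //; apply: measurable_funM.
  by apply: measurable_funM => //; exact: measurable_powR.
apply: (measurableT_comp (measurable_powR _)).
by apply: measurable_funD => //; apply: measurable_funM.
Qed.

Let fisher_tailE y : 0 < y -> mu `]y, +oo[ = (\int[leb]_(x in `[y, +oo[) (f x)%:E)%E.
Proof.
move=> y0; rewrite muF// (_ : _ `&` _ = `]y, +oo[%classic).
  by rewrite integral_itv_obnd_cbnd.
apply/seteqP; split => x /=; rewrite !in_itv/= !andbT; first by case.
by move=> yx; split=> //; exact: lt_trans yx.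
Qed.

Let quantile L := nu / m * expR (2 * L / nu).

Let quantile_gt0 L : 0 < quantile L.
Proof. by rewrite mulr_gt0 ?divr_gt0 ?expR_gt0. Qed.

Let pw x := (m / nu) `^ (- (nu / 2)) * x `^ (- (nu / 2) - 1).

Let pw_ge0 x : 0 <= pw x.
Proof. by rewrite mulr_ge0// powR_ge0. Qed.

Let measurable_pw D : measurable_fun D (fun x => (pw x)%:E).
Proof.
apply/measurable_EFinP; apply: measurable_funTS; apply: measurable_funM => //.
Qed.

Let fisher_pw x c : 0 < x ->
  (m / nu) `^ (m / 2) * x `^ (m / 2 - 1) * (c * (m / nu * x) `^ (- ((m + nu) / 2))) / B
  = c / B * pw x.
Proof.
move=> x0; rewrite /pw !powR_pos_expR ?mulr_gt0 ?divr_gt0 ?invr_gt0//.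
rewrite [ln (m / nu * x)]lnM ?posrE ?divr_gt0//.
set a := ln (m / nu); set b := ln x.
rewrite mulrCA [RHS]mulrAC -!mulrA; congr (_ * _); rewrite !mulrA; congr (_ / _).
by rewrite -!expRD; congr expR; field.
Qed.

Let pw_tail L : (\int[leb]_(x in `[quantile L, +oo[) (pw x)%:E =
  (2 / nu * expR (- L))%:E)%E.
Proof.
under eq_integral do rewrite EFinM.
rewrite ge0_integralZl//; last 3 first.
- apply/measurable_EFinP; apply: measurable_funTS; exact: measurable_powR.
- by move=> y _; rewrite lee_fin powR_ge0.
- by rewrite lee_fin powR_ge0.
rewrite integral_powR_tail ?divr_gt0// -EFinM; congr EFin.
rewrite !powR_pos_expR ?mulr_gt0 ?divr_gt0 ?invr_gt0 ?expR_gt0//.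
rewrite /quantile [ln (_ * expR _)]lnM ?posrE ?divr_gt0 ?expR_gt0// expRK.
rewrite [ln (nu / m)](_ : _ = - ln (m / nu)); last by rewrite -lnV ?posrE ?divr_gt0// invf_div.
rewrite mulrA -expRD.
have -> : - (nu / 2) * ln (m / nu) + - (nu / 2) * (- ln (m / nu) + 2 * L / nu) = - L.
  by field; rewrite gt_eqF.
by field; rewrite gt_eqF.
Qed.

(** For large x the Fisher-Snedecor density is a power of x with exponent
- nu/2 - 1, whose tail at (nu/m) e^(2L/nu) is proportional to e^(-L); replacing
1 + t by t only increases the density. *)
Lemma fisher_tail_upper L :
  (mu `](nu / m * expR (2 * L / nu))%R, +oo[ <= (2 / (nu * B) * expR (- L))%:E)%E.
Proof.
rewrite -/(quantile L) fisher_tailE//.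
have -> : 2 / (nu * B) * expR (- L) = B^-1 * (2 / nu * expR (- L)) by rewrite invfM; ring.
rewrite EFinM -pw_tail -ge0_integralZl//; last 3 first.
- exact: measurable_pw.
- by move=> y _; rewrite lee_fin.
- by rewrite lee_fin invr_ge0.
apply: ge0_le_integral => //.
- by move=> y _; rewrite lee_fin.
- exact: measurable_f.
- by apply: measurable_funeM; exact: measurable_pw.
- move=> y; rewrite /= in_itv/= andbT => xy; rewrite -EFinM lee_fin.
  have y0 : 0 < y by exact: lt_le_trans xy.
  rewrite -[B^-1]mul1r -fisher_pw// mul1r /f /fisher_pdf ler_wpM2r ?invr_ge0//.
  by rewrite ler_wpM2l ?mulr_ge0 ?powR_ge0// powR_neg_upper// mulr_gt0// divr_gt0.
Qed.

Lemma fisher_tail_lower L :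
  ((2 / (nu * B) * expR (- L) * (1 + expR (- (2 * L / nu))) `^ (- ((m + nu) / 2)))%:E
    <= mu `](nu / m * expR (2 * L / nu))%R, +oo[)%E.
Proof.
rewrite -/(quantile L) fisher_tailE//.
set c := _ `^ _.
have c0 : 0 <= c by exact: powR_ge0.
have -> : 2 / (nu * B) * expR (- L) * c = c / B * (2 / nu * expR (- L)) by rewrite invfM; ring.
rewrite EFinM -pw_tail -ge0_integralZl//; last 3 first.
- exact: measurable_pw.
- by move=> y _; rewrite lee_fin.
- by rewrite lee_fin divr_ge0.
apply: ge0_le_integral => //.
- by move=> y _; rewrite -EFinM lee_fin mulr_ge0// divr_ge0.
- by apply: measurable_funeM; exact: measurable_pw.
- exact: measurable_f.
- move=> y; rewrite /= in_itv/= andbT => xy; rewrite -EFinM lee_fin.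
  have y0 : 0 < y by exact: lt_le_trans xy.
  rewrite -fisher_pw// /f /fisher_pdf ler_wpM2r ?invr_ge0//.
  rewrite ler_wpM2l ?mulr_ge0 ?powR_ge0// /c.
  have -> : expR (- (2 * L / nu)) = (expR (2 * L / nu))^-1 by rewrite expRN.
  apply: powR_neg_lower => //; first exact: expR_gt0.
  by rewrite -(invf_div nu m) ler_pdivlMl ?divr_gt0.
Qed.

(** On the interval from 0 to nu/m the density is at most m / (nu Beta): for m >= 2
it is (m/nu) / Beta times t^(m/2 - 1) (1 + t)^(-(m + nu)/2), and this last
product is at most 1. *)
Lemma fisher_tail0 : ((1 - 2 / (nu * B) * nu)%:E <= mu `](nu / m)%R, +oo[)%E.
Proof.
have y0 : 0 < nu / m by rewrite divr_gt0.
have split : (1 = mu `]0%R, (nu / m)%R] + mu `](nu / m)%R, +oo[)%E.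
  rewrite -muT !muF// -ge0_integral_setU//=; last 5 first.
  - exact: measurableI.
  - exact: measurableI.
  - exact: measurable_f.
  - by move=> x _; rewrite lee_fin f_ge0.
  - apply/disj_setPS => x [] /= [] + _ [] + _; rewrite !in_itv/= => /andP[_ xy].
    by rewrite andbT => yx; move: (lt_le_trans yx xy); rewrite ltxx.
  rewrite -setIUl setTI; congr (integral _ _ _); apply/seteqP; split => x /=.
    rewrite !in_itv/= andbT => x0; split => //.
    by case: (leP x (nu / m)) => xm; [left; rewrite x0|right].
  by case.
rewrite EFinB [X in (X - _)%E]split leeBlDr// addeC leeD2l//.
rewrite muF// (_ : _ `&` _ = `]0%R, (nu / m)%R]%classic); last first.
  apply/seteqP; split => x /=; rewrite !in_itv/= andbT; first by case.
  by move=> /andP[x0 xy]; rewrite x0.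
apply: (@le_trans _ _ (\int[leb]_(x in `]0%R, (nu / m)%R]) (m / nu / B)%:E)%E).
  apply: ge0_le_integral => //.
  - by move=> x _; rewrite lee_fin.
  - exact: measurable_f.
  - move=> x; rewrite /= in_itv/= => /andP[x0 _]; rewrite lee_fin.
    rewrite /f /fisher_pdf ler_wpM2r ?invr_ge0//.
    set t := m / nu * x.
    have t0 : 0 < t by rewrite mulr_gt0// divr_gt0.
    have -> : (m / nu) `^ (m / 2) * x `^ (m / 2 - 1) = m / nu * t `^ (m / 2 - 1).
      rewrite !powR_pos_expR ?divr_gt0// /t [ln (m / nu * x)]lnM ?posrE ?divr_gt0//.
      rewrite -[X in _ = X * _](lnK (x := m / nu)) ?posrE ?divr_gt0// -!expRD.
      by congr expR; ring.
    rewrite -mulrA ler_piMr ?divr_ge0 ?(ltW m0) ?(ltW nu0)// powRN.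
    rewrite ler_pdivrMr ?powR_gt0 ?addr_gt0// mul1r.
    apply: (@le_trans _ _ ((1 + t) `^ (m / 2 - 1))).
      apply: ge0_ler_powR.
      - by rewrite subr_ge0 ler_pdivlMr// mul1r.
      - by rewrite nnegrE ltW.
      - by rewrite nnegrE addr_ge0// ltW.
      - by rewrite lerDr.
    apply: ler_powR; first by rewrite lerDl ltW.
    by rewrite mulrDl lerD2l (@le_trans _ _ 0)// divr_ge0// ltW.
rewrite integral_cst//= lebesgue_measure_itv/= lte_fin y0 -EFinB -EFinM lee_fin.
rewrite subr0 -[m / nu / B * _]mulrA [B^-1 * _]mulrC mulrA.
have -> : m / nu * (nu / m) = 1 by field; rewrite !gt_eqF.
rewrite mul1r.
have -> : 2 / (nu * B) * nu = 2 / B.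
  by rewrite invfM mulrA mulrAC mulfVK ?gt_eqF.
by rewrite ler_peMl ?invr_ge0// ler1n.
Qed.

End fisher.

Section tail_limit.
Context {R : realType}.
Implicit Types (nu L x : R).

Lemma ln_le_pred x : 0 < x -> ln x <= x - 1.
Proof.
by move=> x0; rewrite -{1}(subrK 1 x) addrC le_ln1Dx// ltrBrDl subrr.
Qed.

Lemma expRN_le x : 0 < x -> expR (- x) <= x^-1.
Proof.
move=> x0; rewrite expRN lef_pV2 ?posrE ?expR_gt0//.
by apply: le_trans (expR_ge1Dx _); rewrite lerDr.
Qed.

Lemma powR_expR_lower x p : 0 <= x -> 0 <= p -> expR (- (p * x)) <= (1 + x) `^ (- p).
Proof.
move=> x0 p0; have x10 : 0 < 1 + x by rewrite ltr_wpDr.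
rewrite powR_pos_expR// ler_expR mulNr lerN2 ler_wpM2l//.
by apply: le_trans (ln_le_pred x10) _; rewrite addrC addKr.
Qed.

(** The constant k(nu) is never evaluated.  The value at L = 0 bounds it from below by
1 / (1 + nu); since T is at most 1, the lower bound at
L = sqrt(nu) bounds it from above by a quantity tending to 1.  So k tends to 1,
and the correction factor (1 + e^(-2L/nu))^(-(m + nu)/2) tends to 1 as well. *)
Lemma tail_limit (m : R) (k : R -> R) (T : R -> R -> R) (L : R) :
  0 <= m -> 0 < L ->
  (forall nu l, 0 < nu -> 0 <= l -> T nu l <= k nu * expR (- l)) ->
  (forall nu l, 0 < nu -> 0 <= l ->
     k nu * expR (- l) * (1 + expR (- (2 * l / nu))) `^ (- ((m + nu) / 2)) <= T nu l) ->
  (forall nu, 0 < nu -> 1 - k nu * nu <= T nu 0) ->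
  (forall nu l, 0 < nu -> T nu l <= 1) ->
  T nu L @[nu --> 0^'+] --> expR (- L).
Proof.
move=> m0 L0 upper lower T0 T1.
have k_lower nu : 0 < nu -> (1 + nu)^-1 <= k nu.
  move=> nu0; have := le_trans (T0 _ nu0) (upper _ 0 nu0 (lexx _)).
  rewrite oppr0 expR0 mulr1 lerBlDr => h.
  by rewrite -[leLHS]mul1r ler_pdivrMr ?addr_gt0// mulrDr mulr1.
have lower' nu l : 0 < nu -> 0 < l ->
    k nu * expR (- l) * expR (- ((m + nu) / 2 * (nu / (2 * l)))) <= T nu l.
  move=> nu0 l0; apply: le_trans (lower _ _ nu0 (ltW l0)).
  have k0 : 0 <= k nu by apply: le_trans (k_lower _ nu0); rewrite invr_ge0 addr_ge0// ltW.
  have p0 : 0 <= (m + nu) / 2 by rewrite divr_ge0// addr_ge0// ltW.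
  rewrite ler_wpM2l ?mulr_ge0 ?expR_ge0//.
  apply: le_trans (powR_expR_lower (expR_ge0 _) p0).
  rewrite ler_expR lerN2 ler_wpM2l// (le_trans (expRN_le _)) ?invf_div//.
  by rewrite divr_gt0// mulr_gt0.
(* With l = sqrt nu both e^l and the correction e^((m + nu) nu / (4 l)) tend to 1. *)
have k_upper nu : 0 < nu -> k nu <= expR (Num.sqrt nu + (m + nu) / 2 * (Num.sqrt nu / 2)).
  move=> nu0; have s0 : 0 < Num.sqrt nu by rewrite sqrtr_gt0.
  have := le_trans (lower' _ _ nu0 s0) (T1 _ _ nu0).
  have -> : nu / (2 * Num.sqrt nu) = Num.sqrt nu / 2.
    by rewrite -[X in X / (_ * _)](sqr_sqrtr (ltW nu0)); field; rewrite gt_eqF.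
  rewrite -mulrA -expRD -ler_pdivlMr ?expR_gt0// mul1r -expRN => /le_trans; apply.
  by rewrite ler_expR opprD !opprK.
apply: (@squeeze_cvgr _ _ _ _
  (fun nu => (1 + nu)^-1 * expR (- L) * expR (- ((m + nu) / 2 * (nu / (2 * L)))))
  (fun nu => expR (Num.sqrt nu + (m + nu) / 2 * (Num.sqrt nu / 2)) * expR (- L))).
- near=> nu; have nu0 : 0 < nu by near: nu; exact: nbhs_right_gt.
  rewrite (le_trans _ (lower' _ _ nu0 L0)) ?ler_wpM2r ?expR_ge0 ?k_lower//=.
  by rewrite (le_trans (upper _ _ nu0 (ltW L0)))// ler_wpM2r ?expR_ge0 ?k_upper.
- rewrite [X in _ --> X](_ : _ =
      (1 + 0)^-1 * expR (- L) * expR (- ((m + 0) / 2 * (0 / (2 * L))))); last first.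
    by rewrite addr0 invr1 mul1r mul0r mulr0 oppr0 expR0 mulr1.
  apply: cvg_at_right_filter.
  apply: cvgM; first apply: cvgMr_tmp.
    apply: cvgV; first by rewrite addr0 oner_eq0.
    by apply: cvgD; [exact: cvg_cst|exact: cvg_id].
  apply: continuous_cvg; first exact: continuous_expR.
  apply: cvgN; apply: cvgM; apply: cvgMr_tmp; last exact: cvg_id.
  by apply: cvgD; [exact: cvg_cst|exact: cvg_id].
- rewrite [X in _ --> X](_ : _ =
      expR (Num.sqrt 0 + (m + 0) / 2 * (Num.sqrt 0 / 2)) * expR (- L)); last first.
    by rewrite sqrtr0 mul0r mulr0 addr0 expR0 mul1r.
  apply: cvg_at_right_filter; apply: cvgMr_tmp.
  apply: continuous_cvg; first exact: continuous_expR.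
  apply: cvgD; first exact: sqrt_continuous.
  apply: cvgM; apply: cvgMr_tmp; last exact: sqrt_continuous.
  by apply: cvgD; [exact: cvg_cst|exact: cvg_id].
Unshelve. all: by end_near. Qed.

End tail_limit.

(** * Limit of the Student grades along a fixed direction *)

Section positive_law.
Context {R : realType} (P : probability R R).
Hypothesis P0 : P `]-oo, 0%R]%classic = 0%E.
Implicit Types A B : set R.

Lemma fine_prob_le1 A : measurable A -> fine (P A) <= 1.
Proof.
by move=> mA; rewrite -lee_fin fineK ?fin_num_measure//; exact: probability_le1.
Qed.

Lemma fine_probC A : measurable A -> fine (P (~` A)) = 1 - fine (P A).
Proof.
by move=> mA; rewrite probability_setC// fineB// fin_num_measure.
Qed.

Lemma fine_prob_le_pos A B : measurable A -> measurable B ->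
  (forall r, 0 < r -> A r -> B r) -> fine (P A) <= fine (P B).
Proof.
move=> mA mB AB; apply: fine_le; rewrite ?fin_num_measure//.
have -> : P B = P (B `|` `]-oo, 0%R]%classic).
  apply/eqP; rewrite eq_le; apply/andP; split.
    by apply: le_measure; rewrite ?inE//; exact: measurableU.
  apply: le_trans (measureU2 _ _ _) _ => //.
  by rewrite [X in (_ + X)%E]P0 adde0.
apply: le_measure; rewrite ?inE//; first exact: measurableU.
move=> r Ar; case: (ltP 0 r) => r0; [left; exact: AB|right].
by rewrite /= in_itv.
Qed.

Lemma fine_prob_diff A B : measurable A -> measurable B ->
  fine (P A) - fine (P B) <= fine (P (A `\` B)).
Proof.
move=> mA mB; rewrite lerBlDr -fineD ?fin_num_measure//; last exact: measurableD.
apply: fine_le; rewrite ?fin_num_measure//.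
  by rewrite fin_numD !fin_num_measure//; exact: measurableD.
apply: le_trans (measureU2 _ _ _); rewrite ?inE//; last exact: measurableD.
apply: le_measure; rewrite ?inE//; first by apply: measurableU => //; exact: measurableD.
by move=> x Ax; have [Bx|Bx] := pselect (B x); [right|left].
Qed.

Lemma fine_prob_diff_chain A B : measurable A -> measurable B -> B `<=` A ->
  fine (P (A `\` B)) = fine (P A) - fine (P B).
Proof.
move=> mA mB BA; rewrite measureD// ?setIidr// ?fineB ?fin_num_measure//.
by rewrite -ge0_fin_numE// fin_num_measure.
Qed.

End positive_law.

(** Through the formula (x + |x|) / 2 for the positive part. *)
Lemma cvg_positive_part (R : realType) (T : Type) (G : set_system T) {FG : Filter G}
    (f : T -> R) (l : R) :
  f x @[x --> G] --> l -> Num.max 0 (f x) @[x --> G] --> Num.max 0 l.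
Proof.
have maxE (x : R) : Num.max 0 x = (x + `|x|) / 2.
  case: (leP 0 x) => x0; first by rewrite ger0_norm//; field.
  by rewrite ltr0_norm// subrr mul0r.
move=> fl; rewrite maxE; under eq_fun do rewrite maxE.
by apply: cvgMr_tmp; apply: cvgD => //; exact: cvg_norm.
Qed.

Section clamp_limit.
Context {R : realType}.
Variables (F : R -> R -> R) (rho : R -> probability R R).
Hypothesis F_lt : forall nu x y, 0 < nu -> x < y -> F nu x < F nu y.
Hypothesis F_N : forall nu x, 0 < nu -> F nu (- x) = 1 - F nu x.
Hypothesis F_gt0 : forall nu x, 0 < nu -> 0 < F nu x.
Hypothesis F_tail : forall L, 0 < L ->
  2 * (1 - F nu (Num.sqrt nu * expR (L / nu))) @[nu --> 0^'+] --> expR (- L).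
Hypothesis rho0 : forall nu, 0 < nu -> rho nu `]-oo, 0%R]%classic = 0%E.
Hypothesis rho_tail : forall L, 0 < L ->
  fine (rho nu `]Num.sqrt nu * expR (L / nu), +oo[%classic) @[nu --> 0^'+] --> expR (- L).
Implicit Types (c t nu r : R).

Definition clamp t : R := Num.max 0 (Num.min 1 t).

Let F_le nu x y : 0 < nu -> x <= y -> F nu x <= F nu y.
Proof. by move=> nu0; rewrite le_eqVlt => /predU1P[->//|/(F_lt nu0)/ltW]. Qed.

(** Put t = 1 - e^(-L).  By the tail asymptotics of F, the event is squeezed
between events on R alone whose thresholds are sqrt(nu) e^((L -+ d)/nu) / c, for
small d.  As e^(d/nu) exceeds both c and 1/c for small nu, the factor c is
absorbed at the price of another d, and the tail of R then gives probabilities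
close to 1 - e^(-L). *)
Lemma centered_grade_limit_interior (E : R -> set R) c t : 0 < c -> 0 < t -> t < 1 ->
  (forall nu, 0 < nu -> measurable (E nu)) ->
  (forall nu r, 0 < nu -> 0 < r -> 2 * F nu (c * r) - 1 < t -> E nu r) ->
  (forall nu r, 0 < nu -> 0 < r -> E nu r -> 2 * F nu (c * r) - 1 <= t) ->
  fine (rho nu (E nu)) @[nu --> 0^'+] --> t.
Proof.
move=> c0 t0 t1 mE Elow Eup.
pose L := - ln (1 - t).
have t10 : 0 < 1 - t by rewrite subr_gt0.
have L0 : 0 < L.
  by rewrite oppr_gt0 ln_lt0// t10/= ltrBlDr ltrDl.
have LE : expR (- L) = 1 - t by rewrite opprK lnK.
(* The shift 2 d of the level changes e^(- L) by at most e / 2: one d pays for the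
   tails of F and one for the constant c. *)
apply/cvgrPdist_le => e e0.
have [d [d0 dL de1 de2]] : exists d, [/\ 0 < d, 2 * d < L,
    expR (- (L - 2 * d)) <= 1 - t + e / 2 & 1 - t - e / 2 <= expR (- (L + 2 * d))].
  have c1 : expR (- (L - 2 * d)) @[d --> 0^'+] --> 1 - t.
    rewrite -LE -[X in _ --> expR (- X)](subr0 L) -[X in _ --> expR (- (L - X))](mulr0 2).
    apply: cvg_at_right_filter; apply: continuous_cvg; first exact: continuous_expR.
    apply: cvgN; apply: cvgB; first exact: cvg_cst.
    by apply: cvgMl_tmp; exact: cvg_id.
  have c2 : expR (- (L + 2 * d)) @[d --> 0^'+] --> 1 - t.
    rewrite -LE -[X in _ --> expR (- X)](addr0 L) -[X in _ --> expR (- (L + X))](mulr0 2).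
    apply: cvg_at_right_filter; apply: continuous_cvg; first exact: continuous_expR.
    apply: cvgN; apply: cvgD; first exact: cvg_cst.
    by apply: cvgMl_tmp; exact: cvg_id.
  have e20 : 0 < e / 2 by rewrite divr_gt0.
  near (0:R)^'+ => d; exists d; split.
  - by near: d; exact: nbhs_right_gt.
  - rewrite mulrC -ltr_pdivlMr//; near: d; apply: nbhs_right_lt.
    by rewrite divr_gt0.
  - near: d; apply: (cvgr_le _ c1); first by rewrite ltrDl.
  - near: d; apply: (cvgr_ge _ c2); first by rewrite ltrBlDr ltrDl.
have exp_mono a b : a < b -> expR (- b) < expR (- a) by rewrite ltr_expR ltrN2.
have Ld0 : 0 < L - d by lra.
have Ld20 : 0 < L - 2 * d by lra.
have Ld0' : 0 < L + d by lra.
have Ld20' : 0 < L + 2 * d by lra.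
near=> nu.
have nu0 : 0 < nu by near: nu; exact: nbhs_right_gt.
have Fa : 1 - t < 2 * (1 - F nu (Num.sqrt nu * expR ((L - d) / nu))).
  near: nu; apply: (cvgr_gt _ (F_tail Ld0)).
  by rewrite -LE; apply: exp_mono; lra.
have Fb : 2 * (1 - F nu (Num.sqrt nu * expR ((L + d) / nu))) < 1 - t.
  near: nu; apply: (cvgr_lt _ (F_tail Ld0')).
  by rewrite -LE; apply: exp_mono; lra.
have e20 : 0 < e / 2 by rewrite divr_gt0.
have ra : fine (rho nu `]Num.sqrt nu * expR ((L - 2 * d) / nu), +oo[%classic) <= 1 - t + e.
  near: nu; apply: (cvgr_le _ (rho_tail Ld20)).
  by lra.
have rb : 1 - t - e <= fine (rho nu `]Num.sqrt nu * expR ((L + 2 * d) / nu), +oo[%classic).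
  near: nu; apply: (cvgr_ge _ (rho_tail Ld20')).
  by lra.
(* The sum dominates both c and 1 / c, one being used for each inclusion. *)
have big : c + c^-1 <= expR (d / nu).
  apply: (@le_trans _ _ (d / nu)); last first.
    by apply: le_trans (expR_ge1Dx _); rewrite lerDr.
  rewrite ler_pdivlMr// mulrC -ler_pdivlMr ?addr_gt0 ?invr_gt0//.
  by near: nu; apply: nbhs_right_le; rewrite divr_gt0// addr_gt0// invr_gt0.
have c10 : 0 < c^-1 by rewrite invr_gt0.
have s0 : 0 < Num.sqrt nu by rewrite sqrtr_gt0.
have lo : 1 - fine (rho nu `]Num.sqrt nu * expR ((L - 2 * d) / nu), +oo[%classic) <= fine (rho nu (E nu)).
  rewrite -fine_probC//; apply: fine_prob_le_pos => //; rewrite ?rho0//.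
  - exact: measurableC.
  - exact: mE.
  move=> r r0; rewrite /= in_itv/= andbT => /negP; rewrite -leNgt => rle.
  apply: Elow => //.
  have : F nu (c * r) <= F nu (Num.sqrt nu * expR ((L - d) / nu)).
    apply: F_le => //; rewrite (_ : (L - d) / nu = d / nu + (L - 2 * d) / nu); last by ring.
    rewrite expRD mulrCA ler_pM ?(ltW c0) ?(ltW r0)//.
    by apply: le_trans big; rewrite lerDl ltW.
  by move=> h; clear -Fa h; lra.
have up : fine (rho nu (E nu)) <= 1 - fine (rho nu `]Num.sqrt nu * expR ((L + 2 * d) / nu), +oo[%classic).
  rewrite -fine_probC//; apply: fine_prob_le_pos => //; rewrite ?rho0//.
  - exact: mE.
  - exact: measurableC.
  move=> r r0 Er; rewrite /= in_itv/= andbT; apply/negP; rewrite -leNgt.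
  have Fc := Eup _ _ nu0 r0 Er.
  have cr : c * r <= Num.sqrt nu * expR ((L + d) / nu).
    by rewrite leNgt; apply/negP => /(F_lt nu0) h; clear -Fb Fc h; lra.
  rewrite (_ : (L + 2 * d) / nu = d / nu + (L + d) / nu); last by ring.
  rewrite expRD mulrCA -[leLHS](mulKf (lt0r_neq0 c0)).
  rewrite ler_pM ?(ltW c10) ?mulr_ge0 ?(ltW c0) ?(ltW r0)//.
  by apply: le_trans big; rewrite lerDr ltW.
by rewrite ler_distl; clear -lo up ra rb; apply/andP; split; lra.
Unshelve. all: by end_near. Qed.

(** The event is given by a lower and an upper inclusion, so that it may be defined
by a strict or by a weak inequality; for t outside of ]0, 1[ it is trivial for
every nu because 2 F - 1 takes positive arguments to ]0, 1[. *)
Lemma centered_grade_limit (E : R -> set R) c t : 0 < c ->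
  (forall nu, 0 < nu -> measurable (E nu)) ->
  (forall nu r, 0 < nu -> 0 < r -> 2 * F nu (c * r) - 1 < t -> E nu r) ->
  (forall nu r, 0 < nu -> 0 < r -> E nu r -> 2 * F nu (c * r) - 1 <= t) ->
  fine (rho nu (E nu)) @[nu --> 0^'+] --> clamp t.
Proof.
move=> c0 mE Elow Eup.
have F0 nu : 0 < nu -> F nu 0 = 1 / 2.
  by move=> nu0; have := F_N 0 nu0; rewrite oppr0 => h; lra.
have [t0|t0] := leP t 0.
  have -> : clamp t = 0.
    rewrite /clamp min_r ?(le_trans t0)//.
    by apply/max_idPl.
  apply: cvg_near_cst; near=> nu.
  have nu0 : 0 < nu by near: nu; exact: nbhs_right_gt.
  apply/eqP; rewrite eq_le fine_ge0// andbT.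
  rewrite -[leRHS](_ : fine (rho nu set0) = 0); last by rewrite measure0.
  apply: fine_prob_le_pos => //; rewrite ?rho0//; first exact: mE.
  move=> r r0 /(Eup _ _ nu0 r0) h; exfalso.
  have := F_lt nu0 (mulr_gt0 c0 r0); rewrite F0// => h'.
  by clear -h h' t0; lra.
have [t1|t1] := leP 1 t; last first.
  have -> : clamp t = t.
    by rewrite /clamp min_r ?(ltW t1)//; apply/max_idPr; exact: ltW.
  exact: centered_grade_limit_interior Elow Eup.
have -> : clamp t = 1.
  by rewrite /clamp min_l//; apply/max_idPr.
apply: cvg_near_cst; near=> nu.
have nu0 : 0 < nu by near: nu; exact: nbhs_right_gt.
apply/eqP; rewrite eq_le fine_prob_le1 /=; last exact: mE.
rewrite -[leLHS](_ : fine (rho nu setT) = 1); last by rewrite probability_setT.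
apply: fine_prob_le_pos => //; rewrite ?rho0//; first exact: mE.
move=> r r0 _; apply: Elow => //.
have := F_N (c * r) nu0; have := F_gt0 (- (c * r)) nu0 => h h'.
by clear -h h' t1; lra.
Unshelve. all: by end_near. Qed.

Lemma measurable_F_le nu c t : 0 < nu -> measurable [set r | F nu (r * c) <= t].
Proof.
move=> nu0; apply: measurable_le_set => //.
apply: (measurableT_comp (f := F nu)); last exact: measurable_funM.
apply: nondecreasing_measurable => // x y.
exact: F_le.
Qed.

Lemma measurable_F_lt nu c t : 0 < nu -> measurable [set r | F nu (r * c) < t].
Proof.
move=> nu0; apply: measurable_lt_set => //.
apply: (measurableT_comp (f := F nu)); last exact: measurable_funM.
apply: nondecreasing_measurable => // x y.
exact: F_le.
Qed.

Section joint.
Variables (d : nat) (c u : 'I_d -> R).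
Hypothesis c_neq0 : forall i, c i != 0.

Let mp := \big[Num.min/1]_(i < d | 0 < c i) u i.
Let mn := \big[Num.min/1]_(i < d | ~~ (0 < c i)) u i.
Let cmin := \big[Num.min/1]_(i < d) `|c i|.
Let cmax := \big[Num.max/1]_(i < d) `|c i|.

Let cmin_gt0 : 0 < cmin.
Proof. by apply/bigmin_gtP; split => // i _; rewrite normr_gt0. Qed.

Let cmax_gt0 : 0 < cmax.
Proof. by apply: lt_le_trans ltr01 _; exact: bigmax_ge_id. Qed.

Let cmin_le i : cmin <= `|c i|. Proof. exact: bigmin_le_cond. Qed.
Let cmax_ge i : `|c i| <= cmax. Proof. exact: le_bigmax_cond. Qed.

Definition joint_event nu : set R := [set r | forall i, F nu (r * c i) <= u i].

Lemma measurable_joint_event nu : 0 < nu -> measurable (joint_event nu).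
Proof.
move=> nu0; rewrite (_ : joint_event nu =
  [set r | forall i, True -> [set r | F nu (r * c i) <= u i] r]); last first.
  by apply/seteqP; split => r /= h i; [move=> _; exact: h|exact: h].
by apply: measurable_forall => i _; exact: measurable_F_le.
Qed.

Let le_set k t nu : set R := [set r | F nu (r * k) <= (t + 1) / 2].
Let lt_set k t nu : set R := [set r | F nu (r * k) < (t + 1) / 2].

Let joint_lower nu r : 0 < nu -> 0 < r ->
  (le_set cmax (2 * mp - 1) nu `\` lt_set cmin (1 - 2 * mn) nu) r -> joint_event nu r.
Proof.
move=> nu0 r0 [/= hmax /negP]; rewrite -leNgt => hmin i; rewrite /le_set /= in hmax.
have [ci|ci] := boolP (0 < c i).
  apply: (@le_trans _ _ mp); last exact: bigmin_le_cond.
  have : F nu (r * c i) <= F nu (r * cmax).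
    by apply: F_le => //; rewrite ler_pM2l// (le_trans _ (cmax_ge i))// ler_norm.
  by move/le_trans; apply; apply: le_trans hmax _; rewrite subrK mulrC mulKf.
have ciN : `|c i| = - c i by rewrite ler0_norm// leNgt.
have mi : mn <= u i by exact: bigmin_le_cond.
have : F nu (r * cmin) <= F nu (r * - c i).
  by apply: F_le => //; rewrite ler_pM2l// -ciN.
by rewrite mulrN F_N// => h; lra.
Qed.

Let joint_upper nu r : 0 < nu -> 0 < r -> joint_event nu r ->
  (le_set cmin (2 * mp - 1) nu `\` lt_set cmax (1 - 2 * mn) nu) r.
Proof.
have F_lt1 x : 0 < nu -> F nu x <= 1.
  by move=> nu0; have := F_gt0 (- x) nu0; rewrite F_N// subr_gt0 => /ltW.
move=> nu0 r0 h; split.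
  rewrite /le_set /= [leRHS](_ : _ = mp); last by field.
  apply/bigmin_geP; split => [|i ci]; first exact: F_lt1.
  apply: le_trans (h i); apply: F_le => //; rewrite ler_pM2l//.
  by rewrite (le_trans (cmin_le i))// gtr0_norm.
rewrite /lt_set /=; apply/negP; rewrite -leNgt [leLHS](_ : _ = 1 - mn); last by field.
rewrite lerBlDr -lerBlDl -F_N//.
apply/bigmin_geP; split => [|i ci]; first exact: F_lt1.
apply: le_trans (h i); apply: F_le => //; rewrite -mulrN ler_pM2l//.
by rewrite lerNl (le_trans _ (cmax_ge i))// ler0_norm// leNgt.
Qed.

Let le_set_cvg k t : 0 < k ->
  fine (rho nu (le_set k t nu)) @[nu --> 0^'+] --> clamp t.
Proof.
move=> k0; apply: (@centered_grade_limit _ k) => //.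
- by move=> nu; exact: measurable_F_le.
- by move=> nu r _ _; rewrite /le_set /= [k * r]mulrC => h; lra.
- by move=> nu r _ _; rewrite /le_set /= [k * r]mulrC => h; lra.
Qed.

Let lt_set_cvg k t : 0 < k ->
  fine (rho nu (lt_set k t nu)) @[nu --> 0^'+] --> clamp t.
Proof.
move=> k0; apply: (@centered_grade_limit _ k) => //.
- by move=> nu; exact: measurable_F_lt.
- by move=> nu r _ _; rewrite /lt_set /= [k * r]mulrC => h; lra.
- by move=> nu r _ _; rewrite /lt_set /= [k * r]mulrC => h; lra.
Qed.

(** Coordinates with c_i > 0 bound 2 F(c_i r) - 1 from above by 2 mp - 1; those with
c_i < 0 bound 2 F(|c_i| r) - 1 from below by 1 - 2 mn.  Replacing every |c_i| by
the largest or the smallest of them sandwiches the joint event between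
differences of two events of [centered_grade_limit], whose limits depend
neither on the constants nor on the strictness of the inequalities. *)
Lemma joint_limit : fine (rho nu (joint_event nu)) @[nu --> 0^'+] -->
  Num.max 0 (clamp (2 * mp - 1) - clamp (1 - 2 * mn)).
Proof.
have mle k t nu : 0 < nu -> measurable (le_set k t nu) by exact: measurable_F_le.
have mlt k t nu : 0 < nu -> measurable (lt_set k t nu) by exact: measurable_F_lt.
apply: (@squeeze_cvgr _ _ _ _
  (fun nu => Num.max 0 (fine (rho nu (le_set cmax (2 * mp - 1) nu)) -
                        fine (rho nu (lt_set cmin (1 - 2 * mn) nu))))
  (fun nu => Num.max 0 (fine (rho nu (le_set cmin (2 * mp - 1) nu)) -
                        fine (rho nu (lt_set cmax (1 - 2 * mn) nu))))).
- near=> nu; have nu0 : 0 < nu by near: nu; exact: nbhs_right_gt.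
  have mD k l t s : measurable (le_set k t nu `\` lt_set l s nu).
    by apply: measurableD; [exact: mle|exact: mlt].
  apply/andP; split.
    rewrite ge_max fine_ge0//=.
    apply: le_trans (fine_prob_diff _ (mle _ _ _ nu0) (mlt _ _ _ nu0)) _.
    apply: fine_prob_le_pos => //; rewrite ?rho0//; first exact: measurable_joint_event.
    by move=> r r0; exact: joint_lower.
  apply: (@le_trans _ _ (fine (rho nu
      (le_set cmin (2 * mp - 1) nu `\` lt_set cmax (1 - 2 * mn) nu)))).
    apply: fine_prob_le_pos => //; rewrite ?rho0//; first exact: measurable_joint_event.
    by move=> r r0; exact: joint_upper.
  rewrite le_max; apply/orP.
  (* Both sets are initial segments of the half-line, so they are nested: either the
   difference is a difference of probabilities, or it is empty there. *)
have [sub|/existsNP[r0 /not_implyP[Br0 Ar0]]] := pselect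
      (lt_set cmax (1 - 2 * mn) nu `<=` le_set cmin (2 * mp - 1) nu).
    by right; rewrite fine_prob_diff_chain//; [exact: mle|exact: mlt].
  left; rewrite -[leRHS](_ : fine (rho nu set0) = 0); last by rewrite measure0.
  apply: fine_prob_le_pos => //; rewrite ?rho0// => r r_gt0 [/= rA rB].
  apply: rB; apply: le_lt_trans Br0; apply: F_le => //.
  rewrite ler_pM2r// leNgt; apply/negP => r0r.
  apply: Ar0; apply: le_trans rA; apply: F_le => //.
  by rewrite ler_pM2r// ltW.
- by apply: cvg_positive_part; apply: cvgB; [exact: le_set_cvg|exact: lt_set_cvg].
- by apply: cvg_positive_part; apply: cvgB; [exact: le_set_cvg|exact: lt_set_cvg].
Unshelve. all: by end_near. Qed.

End joint.

End clamp_limit.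

(** The grades (1 + V)/2 on one block and (1 - V)/2 on the other, averaged with the
opposite choice, form the extremal copula of the two blocks. *)
Lemma clamp_symmetrization (R : realType) (p n : R) : 0 <= p <= 1 -> 0 <= n <= 1 ->
  Num.max 0 (clamp (2 * p - 1) - clamp (1 - 2 * n)) +
  Num.max 0 (clamp (2 * n - 1) - clamp (1 - 2 * p)) = 2 * Num.max 0 (p + n - 1).
Proof.
move=> /andP[p0 p1] /andP[n0 n1].
have clampE x : x <= 1 -> clamp x = Num.max 0 x by move=> x1; rewrite /clamp min_r.
rewrite !clampE; try lra.
have maxE (x : R) : Num.max 0 x = if 0 <= x then x else 0.
  by case: ifPn => [/max_idPr|]; last rewrite -ltNge => /ltW/max_idPl.
rewrite !maxE; do ! case: ifP => /=; lra.
Qed.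

(** * Binary digits and two-block splittings of the coordinates *)

Lemma binary_digits_inj n k l : (k < 2 ^ n)%N -> (l < 2 ^ n)%N ->
  (forall i, (i < n)%N -> odd (k %/ 2 ^ i) = odd (l %/ 2 ^ i)) -> k = l.
Proof.
elim: n k l => [|n IHn] k l; first by rewrite expn0 !ltnS !leqn0 => /eqP-> /eqP->.
move=> kn ln h.
have half_lt m : (m < 2 ^ n.+1)%N -> (m./2 < 2 ^ n)%N.
  by rewrite -divn2 ltn_divLR// -expnSr.
rewrite -(odd_double_half k) -(odd_double_half l).
have := h 0 isT; rewrite expn0 !divn1 => ->; congr (_ + _.*2)%N.
apply: IHn; rewrite ?half_lt// => i iltn.
by have := h i.+1 iltn; rewrite expnS !divnMA !divn2.
Qed.

Section digit_sets.
Local Open Scope set_scope.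
Variable d : nat.
Hypothesis d0 : (0 < d)%N.
Let i0 := Ordinal d0.

(** The coordinates on which the k-th extremal copula is antithetic to the others. *)
Definition digit_set (k : nat) : {set 'I_d} := [set j | bdigit k j].

Lemma digit_set_inj : injective (fun k : 'I_(2 ^ d.-1) => digit_set k).
Proof.
move=> k l kl; apply: val_inj => /=.
have dE : d.-1.+1 = d by rewrite prednK.
apply: (@binary_digits_inj d.-1) => // i id.
have jd : (d.-1 - i < d)%N by rewrite -[X in (_ < X)%N]dE ltnS leq_subr.
have jE : (d - (d.-1 - i).+1 = i)%N.
  by rewrite -[X in (X - _)%N]dE subSS subKn// ltnW.
have := congr1 (fun J : {set 'I_d} => Ordinal jd \in J) kl.
by rewrite !inE /bdigit /= jE.
Qed.

(** An index below 2^(d-1) has leading digit 0, which singles out one block of each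
splitting. *)
Lemma digit_set0 (k : 'I_(2 ^ d.-1)) : i0 \notin digit_set k.
Proof.
by rewrite inE /bdigit /= subn1 divn_small.
Qed.

Lemma digit_set_surj (J : {set 'I_d}) : i0 \notin J ->
  exists k : 'I_(2 ^ d.-1), digit_set k = J.
Proof.
move=> J0; have : J \in [set digit_set k | k : 'I_(2 ^ d.-1)].
  have -> : [set digit_set k | k : 'I_(2 ^ d.-1)] = powerset (~: [set i0]).
    apply/eqP; rewrite eqEcard; apply/andP; split.
      apply/fintype.subsetP => _ /imsetP[k _ ->]; rewrite powersetE; apply/fintype.subsetP => i ik.
      by rewrite !inE; apply: contraTneq ik => ->; exact: digit_set0.
    rewrite card_powerset cardsC1 card_ord card_imset; last exact: digit_set_inj.
    by rewrite card_ord.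
  by rewrite powersetE; apply/fintype.subsetP => i iJ; rewrite !inE; apply: contraNneq J0 => <-.
by move=> /imsetP[k _ ->]; exists k.
Qed.

(** Each subset of the coordinates, or else its complement, avoids the first
coordinate, and the subsets that do are the digit sets. *)
Lemma sum_digit_sets (V : nmodType) (f : {set 'I_d} -> V) :
  \sum_J f J = \sum_(k < 2 ^ d.-1) (f (digit_set k) + f (~: digit_set k)).
Proof.
have half (g : {set 'I_d} -> V) :
    \sum_(J : {set 'I_d} | i0 \notin J) g J = \sum_(k < 2 ^ d.-1) g (digit_set k).
  rewrite (reindex (fun k : 'I_(2 ^ d.-1) => digit_set k)); last first.
    have [k0 k0E] : exists k : 'I_(2 ^ d.-1), digit_set k = finset.set0.
      by apply: digit_set_surj; rewrite inE.
    exists (fun J => odflt k0 [pick k : 'I_(2 ^ d.-1) | digit_set k == J]).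
      move=> k _; case: pickP => [l /eqP/digit_set_inj//|/(_ k)].
      by rewrite eqxx.
    move=> J; rewrite inE => /digit_set_surj[k kJ]; case: pickP => [l /eqP//|/(_ k)].
    by rewrite kJ eqxx.
  by apply: eq_bigl => k; rewrite digit_set0.
rewrite (bigID (fun J : {set 'I_d} => i0 \notin J)) /= half big_split /=; congr (_ + _).
rewrite -(half (fun J => f (~: J))) [LHS](reindex_inj (@finset.setC_inj _)) /=.
by apply: eq_bigl => J; rewrite negbK inE.
Qed.

Definition monochromatic (J I : {set 'I_d}) := (I \subset J) || (I \subset ~: J).

(** Downward induction on the size of I, the triangular step of Moebius inversion. *)
Lemma superset_sum_inj (R : zmodType) (p q : {set 'I_d} -> R) :
  (forall I : {set 'I_d}, \sum_(J : {set 'I_d} | I \subset J) p J = \sum_(J : {set 'I_d} | I \subset J) q J) -> p =1 q.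
Proof.
move=> pq I; move: {2}(d - #|I|)%N (leqnn (d - #|I|)) => n.
elim: n I => [|n IHn] I dI; have := pq I; rewrite (bigD1 I)//= [X in _ = X](bigD1 I)//=.
  rewrite !big1 ?addr0// => J /andP[IJ].
    move: dI; rewrite leqn0 subn_eq0 => dI; rewrite eq_sym eqEcard IJ/=.
    by rewrite (leq_trans _ dI)// -[X in (_ <= X)%N]card_ord max_card.
  move: dI; rewrite leqn0 subn_eq0 => dI; rewrite eq_sym eqEcard IJ/=.
  by rewrite (leq_trans _ dI)// -[X in (_ <= X)%N]card_ord max_card.
suff -> : \sum_(J : {set 'I_d} | (I \subset J) && (J != I)) p J =
          \sum_(J : {set 'I_d} | (I \subset J) && (J != I)) q J by exact: addIr.
apply: eq_bigr => J /andP[IJ JI]; apply: IHn.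
have IJc : (#|I| < #|J|)%N by rewrite proper_card// finset.properEneq eq_sym JI.
by rewrite -ltnS (leq_trans _ dI)// ltn_sub2l// (leq_trans IJc)// -[X in (_ <= X)%N]card_ord max_card.
Qed.

(** Spread each weight over the two blocks of its splitting.  For nonempty I the
conditions are the superset sums of the resulting function of subsets, because
I lies in at most one of two complementary blocks; the total weight accounts
for |I| < 2.  Superset sums are injective. *)
Lemma monochromatic_weights_inj (R : realFieldType) (w v : 'I_(2 ^ d.-1) -> R) :
  \sum_k w k = \sum_k v k ->
  (forall I : {set 'I_d}, (2 <= #|I|)%N ->
    \sum_k w k * (monochromatic (digit_set k) I)%:R =
    \sum_k v k * (monochromatic (digit_set k) I)%:R) ->
  w =1 v.
Proof.
move=> wv1 wv.
pose p (u : 'I_(2 ^ d.-1) -> R) (J : {set 'I_d}) : R :=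
  \sum_k u k * ((digit_set k == J)%:R + (~: digit_set k == J)%:R).
have pD u (k : 'I_(2 ^ d.-1)) : p u (digit_set k) = u k.
  rewrite /p (bigD1 k)//= eqxx big1 => [|l lk].
    rewrite (_ : ~: _ == _ = false) ?addr0 ?mulr1//.
    apply/eqP => /setP/(_ i0); rewrite inE (negbTE (digit_set0 _)).
    by [].
  rewrite (_ : digit_set l == _ = false); last first.
    by apply: contra_neqF lk => /eqP/digit_set_inj.
  rewrite (_ : ~: _ == _ = false) ?addr0 ?mulr0//.
  by apply/eqP => /setP/(_ i0); rewrite inE (negbTE (digit_set0 l)) (negbTE (digit_set0 k)).
have pS u (I : {set 'I_d}) : \sum_(J : {set 'I_d} | I \subset J) p u J =
    \sum_k u k * ((I \subset digit_set k)%:R + (I \subset ~: digit_set k)%:R).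
  rewrite exchange_big /=; apply: eq_bigr => k _; rewrite -mulr_sumr; congr (_ * _).
  have pick1 (K : {set 'I_d}) : \sum_(J : {set 'I_d} | I \subset J) (K == J)%:R = (I \subset K)%:R :> R.
    have [IK|IK] := boolP (I \subset K).
      rewrite (bigD1 K)//= eqxx big1 ?addr0// => J /andP[_ JK].
      by rewrite eq_sym (negbTE JK).
    by rewrite big1// => J IJ; case: eqP => // KJ; move: IK; rewrite KJ IJ.
  by rewrite big_split /= !pick1.
suff pwv : p w =1 p v by move=> k; rewrite -(pD w) pwv pD.
apply: superset_sum_inj => I; rewrite !pS.
have [->|/set0Pn[i iI]] := eqVneq I finset.set0.
  under eq_bigr do rewrite !finset.sub0set; under [RHS]eq_bigr do rewrite !finset.sub0set.
  by rewrite -!mulr_suml wv1.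
have disj (k : 'I_(2 ^ d.-1)) : ((I \subset digit_set k)%:R + (I \subset ~: digit_set k)%:R) =
    (monochromatic (digit_set k) I)%:R :> R.
  rewrite /monochromatic; have [Ik|Ik] := boolP (I \subset digit_set k); last by rewrite add0r.
  rewrite (_ : I \subset _ = false) ?addr0//.
  apply/negP => /fintype.subsetP/(_ i iI); rewrite inE.
  by rewrite (fintype.subsetP Ik).
under eq_bigr do rewrite disj; under [RHS]eq_bigr do rewrite disj.
have [I2|I1] := leqP 2 #|I|; first exact: wv.
have mono1 (k : 'I_(2 ^ d.-1)) : monochromatic (digit_set k) I.
  have /cards1P[j ->] : #|I| == 1%N.
    by rewrite eqn_leq -ltnS I1 card_gt0; apply/set0Pn; exists i.
  by rewrite /monochromatic !finset.sub1set finset.in_setC orbN.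
under eq_bigr do rewrite mono1 mulr1; under [RHS]eq_bigr do rewrite mono1 mulr1.
exact: wv1.
Qed.

End digit_sets.

(** * Extremal mixtures: their laws and concordance probabilities *)

Lemma pushforward_probability d1 d2 (T1 : measurableType d1) (T2 : measurableType d2)
    (R : realType) (P : probability T1 R) (f : T1 -> T2) :
  measurable_fun setT f -> exists Q : probability T2 R, forall B, Q B = P (f @^-1` B).
Proof.
move=> mf; pose X : {RV P >-> T2} := mfun_Sub (mem_set mf).
by exists (distribution P X) => B.
Qed.

(** Change of variables for a probability Q that is known to be the image of P on
measurable sets only. *)
Lemma integral_pushforward_probability d1 d2 (T1 : measurableType d1)
    (T2 : measurableType d2) (R : realType) (P : probability T1 R)
    (Q : probability T2 R) (f : T1 -> T2) (g : T2 -> \bar R) :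
  measurable_fun setT f -> (forall B, measurable B -> Q B = P (f @^-1` B)) ->
  measurable_fun setT g -> (forall y, 0 <= g y)%E ->
  (\int[Q]_y g y = \int[P]_x g (f x))%E.
Proof.
move=> mf QP mg g0; have [Q' Q'P] := pushforward_probability P mf.
transitivity (\int[pushforward P f]_y g y)%E; last first.
  by rewrite ge0_integral_pushforward.
by apply: eq_measure_integral => B mB _; first [exact: QP|exact/esym/QP].
Qed.

(** The weighted sum has total mass 1, so normalizing it leaves it unchanged and
packages it as a probability. *)
Lemma mixture_probability d1 (T : measurableType d1) (R : realType) n
    (P : 'I_n -> probability T R) (w : 'I_n -> R) :
  (forall k, 0 <= w k) -> \sum_k w k = 1 ->
  exists Q : probability T R,
    (forall B, Q B = \sum_k (w k)%:E * P k B)%E /\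
    (forall f, measurable_fun setT f -> (forall x, 0 <= f x)%E ->
       \int[Q]_x f x = \sum_k (w k)%:E * \int[P k]_x f x)%E.
Proof.
case: n P w => [|n] P w w0 w1.
  by move: w1; rewrite big_ord0 => /esym/eqP; rewrite oner_eq0.
pose m i : {measure set T -> \bar R} := mscale (NngNum (w0 (inord i))) (P (inord i)).
have mE B : (msum m n.+1 B = \sum_k (w k)%:E * P k B)%E.
  by apply: eq_bigr => i _; rewrite /m /mscale/= inord_val.
have mT : msum m n.+1 setT = 1%E.
  rewrite mE; under eq_bigr do rewrite probability_setT mule1.
  by rewrite sumEFin w1.
have QE B : mnormalize (msum m n.+1) (P ord0) B = (\sum_k (w k)%:E * P k B)%E.
  rewrite /mnormalize ifF.
    by rewrite [X in fine X]mT invr1 mule1; exact: mE.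
  by rewrite [X in X == _]mT [X in _ || (X == _)]mT onee_eq0.
exists (mnormalize (msum m n.+1) (P ord0)); split=> [B|f mf f0]; first exact: QE.
transitivity (\int[msum m n.+1]_x f x)%E.
  by apply: eq_measure_integral => B mB _; rewrite [LHS]QE; apply/esym; exact: mE.
rewrite ge0_integral_measure_sum//; apply: eq_bigr => i _.
by rewrite /m ge0_integral_mscale//= inord_val.
Qed.

Lemma uniform_law_exists (R : realType) : exists U : probability R R,
  forall B, U B = lebesgue_measure (B `&` `[0%R, 1%R]%classic).
Proof.
have m01 : measurable (`[0%R, 1%R]%classic : set R) by [].
have mT : mrestr (@lebesgue_measure R) m01 setT = 1%E.
  by rewrite /mrestr setTI lebesgue_measure_itv/= lte01 oppr0 adde0.
have [U UE] := @pushforward_probability _ _ _ R R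
  (mnormalize (mrestr (@lebesgue_measure R) m01) point) id (@measurable_id _ _ _).
exists U => B; rewrite UE /= /mnormalize ifF.
  by rewrite [X in fine X]mT invr1 mule1.
by rewrite [X in X == _]mT [X in _ || (X == _)]mT onee_eq0.
Qed.

Section mixture_law.
Context {R : realType} {d : nat}.
Implicit Types (J I : {set 'I_d}) (u v : d.-tuple R) (x y : R).

Definition uniform_law : probability R R := projT1 (cid (uniform_law_exists R)).

Lemma uniform_lawE B : uniform_law B = lebesgue_measure (B `&` `[0, 1]%classic).
Proof. by rewrite /uniform_law; case: cid. Qed.

Lemma uniform_law_itv (a b : R) : 0 <= a -> b <= 1 ->
  uniform_law `[a, b]%classic = (Num.max 0 (b - a))%:E.
Proof.
move=> a0 b1; rewrite uniform_lawE (_ : _ `&` _ = `[a, b]%classic).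
  rewrite lebesgue_measure_itv/= lte_fin; case: ltP => ab.
    by rewrite -EFinB max_r// subr_ge0 ltW.
  by rewrite max_l// subr_le0.
apply/seteqP; split => x /=; rewrite !in_itv/=; first by case.
by move=> /andP[ax xb]; rewrite ax xb (le_trans a0 ax) (le_trans xb b1).
Qed.

(** Applied to a uniform variable x, this yields a vector distributed according to the
extremal copula whose blocks are J and its complement. *)
Definition extremal_map J x : d.-tuple R := [tuple if i \in J then 1 - x else x | i < d].

Lemma measurable_extremal_map J : measurable_fun setT (extremal_map J).
Proof.
apply/measurable_fun_tnthP => i.
rewrite (_ : _ \o _ = if i \in J then fun x => 1 - x else fun x => x).
  by case: ifP => _; [exact: measurable_funB|].
by apply/funext => x; rewrite /= tnth_mktuple; case: ifP.
Qed.

Lemma uniform_law_extremal J u : cube u ->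
  uniform_law (extremal_map J @^-1` orthant u) =
  (Num.max 0 (\big[Num.min/1]_(j < d | j \notin J) tnth u j +
              \big[Num.min/1]_(j < d | j \in J) tnth u j - 1))%:E.
Proof.
move=> cu; set p := \big[Num.min/1]_(j < d | _) _; set q := \big[Num.min/1]_(j < d | _) _.
have p1 : p <= 1 by exact: bigmin_le_id.
have q1 : q <= 1 by exact: bigmin_le_id.
rewrite [X in Num.max 0 X](_ : _ = p - (1 - q)); last by ring.
rewrite -uniform_law_itv ?subr_ge0// !uniform_lawE; congr (lebesgue_measure _).
apply/seteqP; split => x [/= xo]; rewrite !in_itv/= => /andP[x0 x1]; split => //.
- apply/andP; split.
    rewrite lerBlDr -lerBlDl; apply/bigmin_geP; split => [|j jJ].
      by rewrite lerBlDr lerDl.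
    by have := xo j; rewrite tnth_mktuple jJ.
  apply/bigmin_geP; split => // j jJ.
  by have := xo j; rewrite tnth_mktuple (negbTE jJ).
- by rewrite x0.
- move: xo; rewrite in_itv/= => /andP[qx xp] j; rewrite tnth_mktuple; case: ifPn => jJ.
    have : q <= tnth u j by exact: bigmin_le_cond.
    by lra.
  by rewrite (le_trans xp)//; exact: bigmin_le_cond.
- by rewrite x0.
Qed.

Definition concordant I u v : Prop :=
  (forall i, i \in I -> tnth u i <= tnth v i) \/
  (forall i, i \in I -> tnth v i <= tnth u i).

Lemma measurable_concordant I :
  measurable [set z : d.-tuple R * d.-tuple R | concordant I z.1 z.2].
Proof.
have m1 i : measurable_fun setT (fun z : d.-tuple R * d.-tuple R => tnth z.1 i).
  by apply: (measurableT_comp (measurable_tnth i)).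
have m2 i : measurable_fun setT (fun z : d.-tuple R * d.-tuple R => tnth z.2 i).
  by apply: (measurableT_comp (measurable_tnth i)).
by apply: measurableU; apply: (@measurable_forall _ _ _ _
  (fun i => [set z : d.-tuple R * d.-tuple R | _ <= _])) => i _; exact: measurable_le_set.
Qed.

(** Concordance is conditioned on the first vector; any probability with the given
distribution function may be used. *)
Lemma kappa_section (C : d.-tuple R -> R) (Q : probability (d.-tuple R) R) I :
  is_law C Q -> (2 <= #|I|)%N ->
  kappa C I = (\int[Q]_u Q [set v | concordant I u v])%E.
Proof.
move=> CQ I2; rewrite /kappa I2 /product_measure1.
have lawQ := lawP CQ.
transitivity (\int[Q]_u (law C \o xsection [set z | concordant I z.1 z.2]) u)%E.
  by apply: eq_measure_integral => B mB _; first [exact: lawQ|exact/esym/lawQ].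
apply: eq_integral => u _; rewrite /= lawQ.
  by rewrite xsectionE.
by apply: measurable_xsection; exact: measurable_concordant.
Qed.

Lemma uniform_law_eq A B : (forall x, 0 <= x <= 1 -> A x <-> B x) ->
  uniform_law A = uniform_law B.
Proof.
move=> AB; rewrite !uniform_lawE; congr lebesgue_measure.
by apply/seteqP; split => x [Ax]; rewrite /= in_itv/= => x01; split => //; exact/AB.
Qed.

Lemma uniform_law_center z : 0 <= z -> 2 * z <= 1 ->
  uniform_law [set y | `|y - 1 / 2| <= z] = (2 * z)%:E.
Proof.
move=> z0 z1; rewrite (@uniform_law_eq _ (`[1 / 2 - z, 1 / 2 + z]%classic)).
  rewrite uniform_law_itv; [|lra|lra].
  by congr EFin; rewrite max_r; lra.
move=> x _; rewrite /= in_itv/= ler_norml.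
by split => /andP[h1 h2]; apply/andP; split; lra.
Qed.

Lemma uniform_law_border z : 0 <= z -> 2 * z <= 1 ->
  uniform_law [set y | z <= `|y - 1 / 2|] = (1 - 2 * z)%:E.
Proof.
move=> z0 z1; rewrite (@uniform_law_eq _ (~` `]1 / 2 - z, 1 / 2 + z[%classic)).
  rewrite probability_setC// EFinB; congr (_ - _)%E.
  rewrite uniform_lawE (_ : _ `&` _ = `]1 / 2 - z, 1 / 2 + z[%classic).
    rewrite lebesgue_measure_itv/= lte_fin; case: ltP => h.
      by rewrite -EFinB; congr EFin; lra.
    by congr EFin; lra.
  apply/seteqP; split => x /=; rewrite !in_itv/=; first by case.
  by move=> /andP[h1 h2]; split; apply/andP; split; lra.
move=> x _; rewrite /= in_itv/=; split.
  move=> h /andP[h1 h2]; move: h; apply/negP; rewrite -ltNge ltr_norml.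
  by apply/andP; split; lra.
move/negP; rewrite negb_and -!leNgt => /orP[h|h].
  by rewrite ler_normr; apply/orP; right; lra.
by rewrite ler_normr; apply/orP; left; lra.
Qed.

Lemma uniform_law_edge z : 0 <= z -> 2 * z <= 1 ->
  uniform_law [set y | `|y - 1 / 2| = z] = 0%E.
Proof.
move=> z0 z1; apply/eqP; rewrite eq_le measure_ge0 andbT.
have mz : measurable ([set 1 / 2 - z] `|` [set 1 / 2 + z] : set R) by exact: measurableU.
apply: (@le_trans _ _ (uniform_law ([set 1 / 2 - z] `|` [set 1 / 2 + z]))).
  apply: le_measure; rewrite ?inE//.
    apply: measurable_eq_set => //; apply: measurableT_comp => //.
    exact: measurable_funB.
  move=> y /= yz; have [h|h] := leP 0 (y - 1 / 2).
    by right; move: yz; rewrite ger0_norm//= => yz; lra.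
  by left; move: yz; rewrite ltr0_norm//= => yz; lra.
have e a : 0 <= a <= 1 -> uniform_law [set a] = 0%E.
  move=> /andP[a0 a1]; rewrite -set_itv1 uniform_law_itv//.
  by rewrite subrr maxxx.
apply: (le_trans (measureU2 _ _ _)) => //.
have e1 : 0 <= 1 / 2 - z <= 1 by apply/andP; split; lra.
have e2 : 0 <= 1 / 2 + z <= 1 by apply/andP; split; lra.
by rewrite [X in (X + _)%E](e _ e1) [X in (_ + X)%E](e _ e2) adde0.
Qed.

Let uniform_law01 A : (forall x, 0 <= x <= 1 -> A x) -> uniform_law A = 1%E.
Proof.
by move=> h; rewrite (@uniform_law_eq A setT) ?probability_setT// => x /h.
Qed.

Let mono_const J I x : monochromatic J I ->
  exists2 a, (forall i, i \in I -> tnth (extremal_map J x) i = a) & `|a - 1 / 2| = `|x - 1 / 2|.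
Proof.
move=> /orP[IJ|IJ].
  exists (1 - x) => [i iI|]; first by rewrite tnth_mktuple (fintype.subsetP IJ).
  by rewrite -normrN; congr `|_|; lra.
exists x => // i iI; rewrite tnth_mktuple.
by have := fintype.subsetP IJ i iI; rewrite finset.in_setC => /negbTE ->.
Qed.

Let mixed_attains J I x : ~~ monochromatic J I ->
  (exists2 i, i \in I & tnth (extremal_map J x) i = x) /\
  (exists2 i, i \in I & tnth (extremal_map J x) i = 1 - x).
Proof.
rewrite negb_or => /andP[/fintype.subsetPn[i iI iJ] /fintype.subsetPn[j jI jJ]]; split.
  by exists i => //; rewrite tnth_mktuple (negbTE iJ).
by exists j => //; rewrite tnth_mktuple; move: jJ; rewrite finset.in_setC negbK => ->.
Qed.

(** A vector taking both values x and 1 - x on I is concordant with the constant a on I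
when a is at least as far from 1/2 as x, on either side. *)
Let mixed_const J I x a : ~~ monochromatic J I ->
  (concordant I (extremal_map J x) [tuple a | i < d] <-> `|x - 1 / 2| <= `|a - 1 / 2|).
Proof.
move=> /(mixed_attains x) [[i iI ix] [j jI jx]]; split.
  case=> h; have := h i iI; have := h j jI; rewrite ix jx !tnth_mktuple => h1 h2.
    have a2 : 0 <= a - 1 / 2 by lra.
    by rewrite (ger0_norm a2) ler_norml; apply/andP; split; lra.
  have a2 : a - 1 / 2 <= 0 by lra.
  by rewrite (ler0_norm a2) ler_norml; apply/andP; split; lra.
have vals k : tnth (extremal_map J x) k = x \/ tnth (extremal_map J x) k = 1 - x.
  by rewrite tnth_mktuple; case: ifP; [right|left].
have [a2|a2] := leP 0 (a - 1 / 2); rewrite ler_norml => /andP[h1 h2].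
  move: h1 h2; rewrite (ger0_norm a2) => h1 h2.
  by left => k kI; rewrite [X in _ <= X]tnth_mktuple; case: (vals k) => ->; lra.
move: h1 h2; rewrite (ltr0_norm a2) => h1 h2.
by right => k kI; rewrite [X in X <= _]tnth_mktuple; case: (vals k) => ->; lra.
Qed.

(** If both splittings leave I in one block, the vectors are constant on I and always
concordant.  If only one does, [mixed_const] compares the distances to 1/2.  If
neither does, concordance forces x and y to be equally far from 1/2, which has
probability 0. *)
Lemma uniform_law_concordant J K I x : I != finset.set0 -> 0 <= x <= 1 ->
  uniform_law [set y | concordant I (extremal_map J x) (extremal_map K y)] =
  (2 * `|x - 1 / 2| * (monochromatic J I)%:R +
   (1 - 2 * `|x - 1 / 2|) * (monochromatic K I)%:R)%:E.
Proof.
move=> I0 /andP[x0 x1].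
have z0 : 0 <= `|x - 1 / 2| by [].
have z1 : 2 * `|x - 1 / 2| <= 1.
  by rewrite mulrC -ler_pdivlMr// ler_norml; apply/andP; split; lra.
have concC u v : concordant I u v <-> concordant I v u.
  by split => -[h|h]; [right|left|right|left].
have conc_const u v v' : (forall i, i \in I -> tnth v i = tnth v' i) ->
    concordant I u v <-> concordant I u v'.
  by move=> vv'; split => -[h|h]; [left|right|left|right] => i iI; have := h i iI; rewrite vv'.
have cst (u : d.-tuple R) a : (forall i, i \in I -> tnth u i = a) ->
    forall i, i \in I -> tnth u i = tnth [tuple a | j < d] i.
  by move=> ua i iI; rewrite ua// tnth_mktuple.
have [JI|JI] := boolP (monochromatic J I); have [KI|KI] := boolP (monochromatic K I).
- rewrite !mulr1 addrC subrK; apply: uniform_law01 => y _.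
  have [a aE _] := mono_const x JI; have [b bE _] := mono_const y KI.
  by case: (leP a b) => ab; [left|right] => i iI; rewrite aE// bE// ltW.
- rewrite mulr1 mulr0 addr0 -uniform_law_center//; congr (uniform_law _).
  have [a /cst aE <-] := mono_const x JI.
  apply/seteqP; split => y /=; first by move=> /concC/(conc_const _ _ _ aE)/(mixed_const _ _ KI).
  by move=> /(mixed_const _ _ KI)/(conc_const _ _ _ aE)/concC.
- rewrite mulr0 add0r mulr1 -uniform_law_border//; congr (uniform_law _).
  apply/seteqP; split => y /=; have [b /cst bE bz] := mono_const y KI.
    by move=> /(conc_const _ _ _ bE)/(mixed_const _ _ JI); rewrite bz.
  by rewrite -bz => /(mixed_const _ _ JI)/(conc_const _ _ _ bE).
- rewrite !mulr0 addr0.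
  apply/eqP; rewrite eq_le measure_ge0 andbT.
  apply: (@le_trans _ _ (uniform_law [set y | `|y - 1 / 2| = `|x - 1 / 2|]));
    last by rewrite uniform_law_edge.
  apply: le_measure; rewrite ?inE//.
  + have := measurable_concordant I => /(measurable_xsection (extremal_map J x)).
    rewrite xsectionE => m; rewrite -[X in measurable X]setTI.
    exact: (measurable_extremal_map K).
  + apply: measurable_eq_set => //; apply: measurableT_comp => //.
    exact: measurable_funB.
  + move=> y /= h; have [[i iI ix] [j jI jx]] := mixed_attains x JI.
    have [[k kI ky] [l lI ly]] := mixed_attains y KI.
    have range L (t : R) m : 1 / 2 - `|t - 1 / 2| <= tnth (extremal_map L t) m <= 1 / 2 + `|t - 1 / 2|.
      have := ler_norm (t - 1 / 2); have := ler_norm (- (t - 1 / 2)); rewrite normrN.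
      by rewrite tnth_mktuple; case: ifP => _ h1 h2; apply/andP; split; lra.
    have close (a b : R) : 1 / 2 - b <= a -> a <= 1 / 2 + b -> `|a - 1 / 2| <= b.
      by move=> h1 h2; rewrite ler_norml; apply/andP; split; lra.
    apply/eqP; rewrite eq_le; case: h => h; apply/andP; split; apply: close.
    * by have := h k kI; have /andP[+ _] := range J x k; rewrite ky; exact: le_trans.
    * by have := h l lI; have /andP[+ _] := range J x l; rewrite ly => h1 /(le_trans h1); lra.
    * by have := h j jI; have /andP[_ +] := range K y j; rewrite jx => h1 /le_trans/(_ h1); lra.
    * by have := h i iI; have /andP[_ +] := range K y i; rewrite ix => h1 /le_trans/(_ h1).
    * by have := h l lI; have /andP[_ +] := range J x l; rewrite ly => h1 /le_trans/(_ h1); lra.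
    * by have := h k kI; have /andP[_ +] := range J x k; rewrite ky => h1 /le_trans/(_ h1).
    * by have := h i iI; have /andP[+ _] := range K y i; rewrite ix; exact: le_trans.
    * by have := h j jI; have /andP[+ _] := range K y j; rewrite jx => h1 /(le_trans h1); lra.
Qed.

Section weights.
Variable w : 'I_(2 ^ d.-1) -> R.
Hypotheses (w0 : forall k, 0 <= w k) (w1 : \sum_k w k = 1).

Definition extremal_mixture u : R := \sum_k w k * extremal_copula k u.

Definition extremal_mixture_law (Q : probability (d.-tuple R) R) : Prop :=
  (forall B, measurable B ->
    Q B = \sum_k (w k)%:E * uniform_law (extremal_map (digit_set d k) @^-1` B))%E /\
  (forall f : d.-tuple R -> \bar R, measurable_fun setT f -> (forall u, 0 <= f u)%E ->
    \int[Q]_u f u =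
    \sum_k (w k)%:E * \int[uniform_law]_x f (extremal_map (digit_set d k) x))%E.

Lemma extremal_mixture_law_exists : exists Q, extremal_mixture_law Q.
Proof.
have /choice[P PE] : forall k : 'I_(2 ^ d.-1), exists P : probability (d.-tuple R) R,
    forall B, P B = uniform_law (extremal_map (digit_set d k) @^-1` B).
  by move=> k; apply: pushforward_probability; exact: measurable_extremal_map.
have [Q [QB Qf]] := mixture_probability P w0 w1.
exists Q; split=> [B mB|f mf f0].
  by rewrite QB; apply: eq_bigr => k _; rewrite PE.
rewrite Qf//; apply: eq_bigr => k _; congr (_ * _)%E.
by apply: integral_pushforward_probability => //; exact: measurable_extremal_map.
Qed.

Lemma extremal_mixture_is_law Q : extremal_mixture_law Q -> is_law extremal_mixture Q.
Proof.
move=> [QB _]; split=> [|u cu].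
  rewrite QB; last exact: measurable_cube.
  rewrite (eq_bigr (fun k => (w k)%:E)) ?sumEFin ?w1// => k _.
  rewrite uniform_law01 ?mule1// => x /andP[x0 x1] i.
  by rewrite tnth_mktuple; case: ifP => _; apply/andP; split; lra.
rewrite -/(orthant u) QB; last exact: measurable_orthant.
rewrite -sumEFin; apply: eq_bigr => k _; rewrite EFinM; congr (_ * _)%E.
rewrite uniform_law_extremal//; congr (Num.max 0 (_ + _ - 1))%:E.
  by apply: eq_bigl => j; rewrite inE.
by apply: eq_bigl => j; rewrite inE.
Qed.

Lemma extremal_mixture_margin Q i t : extremal_mixture_law Q -> 0 <= t <= 1 ->
  Q [set u | tnth u i <= t] = t%:E.
Proof.
move=> [QB _] /andP[t0 t1]; rewrite QB; last first.
  by apply: measurable_le_set => //; exact: measurable_tnth.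
rewrite (eq_bigr (fun k => (w k * t)%:E)) => [|k _].
  by rewrite sumEFin -mulr_suml w1 mul1r.
rewrite EFinM; congr (_ * _)%E.
have [ik|ik] := boolP (i \in digit_set d k).
  rewrite (@uniform_law_eq _ (`[1 - t, 1]%classic)).
    by rewrite uniform_law_itv ?subr_ge0// opprB addrC subrK max_r.
  move=> x /andP[x0 x1]; rewrite /= tnth_mktuple ik in_itv/= x1 andbT.
  by split; lra.
rewrite (@uniform_law_eq _ (`[0, t]%classic)).
  by rewrite uniform_law_itv// subr0 max_r.
by move=> x /andP[x0 x1]; rewrite /= tnth_mktuple (negbTE ik) in_itv/= x0.
Qed.

Lemma extremal_mixture_copula_exists : extremal_mixture_copula extremal_mixture.
Proof.
have [Q QE] := extremal_mixture_law_exists; split; last by exists w; split.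
exists Q; first exact: extremal_mixture_is_law.
by move=> i t t01; exact: extremal_mixture_margin.
Qed.

(** Given the first variable x, put z = 2 |x - 1/2|.  By [uniform_law_concordant] the
conditional probability is z times the indicator for the first splitting plus
1 - z times the one for the second.  The two splittings are independent with
the same weights, so both terms average to the same sum and the mean of z
cancels. *)
Lemma kappa_extremal_mixture (C : d.-tuple R -> R) I :
  same_on_cube C extremal_mixture -> (2 <= #|I|)%N ->
  kappa C I = (\sum_k w k * (monochromatic (digit_set d k) I)%:R)%:E.
Proof.
move=> CE I2; have [Q QE] := extremal_mixture_law_exists.
have CQ : is_law C Q.
  have [Q1 Q2] := extremal_mixture_is_law QE; split=> // u cu.
  by rewrite CE//; exact: Q2.
have I0 : I != finset.set0 by rewrite -card_gt0 (leq_trans _ I2).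
rewrite (kappa_section CQ I2).
case: QE => QB Qf.
have mE := measurable_concordant I.
rewrite Qf//; last exact: (measurable_section1 Q mE).
set m := \sum_k _ * _.
(* The truncation at 1 only acts outside of [0, 1] and keeps z and 1 - z nonnegative. *)
pose z x : R := Num.min 1 (2 * `|x - 1 / 2|).
have z0 x : 0 <= z x by rewrite le_min ler01 mulr_ge0.
have z1 x : z x <= 1 by rewrite ge_min lexx.
have mz : measurable_fun setT z.
  apply: measurable_minr => //; apply: measurable_funM => //.
  by apply: measurableT_comp => //; exact: measurable_funB.
have m0 : 0 <= m by apply: sumr_ge0 => k _; rewrite mulr_ge0.
pose c := (\int[uniform_law]_x (z x)%:E)%E.
pose c' := (\int[uniform_law]_x (1 - z x)%:E)%E.
have cc' : (c + c' = 1)%E.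
  rewrite -ge0_integralD//; last 4 first.
  - by move=> x _; rewrite lee_fin.
  - exact/measurable_EFinP.
  - by move=> x _; rewrite lee_fin subr_ge0.
  - by apply/measurable_EFinP; exact: measurable_funB.
  rewrite (eq_integral (cst 1%E)) => [|x _]; first by rewrite integral_cst//= probability_setT mule1.
  by rewrite -EFinD addrC subrK.
have c0 : (0 <= c)%E by apply: integral_ge0 => x _; rewrite lee_fin.
have c'0 : (0 <= c')%E by apply: integral_ge0 => x _; rewrite lee_fin subr_ge0.
have inner (k : 'I_(2 ^ d.-1)) :
    (\int[uniform_law]_x Q [set v | concordant I (extremal_map (digit_set d k) x) v] =
     (monochromatic (digit_set d k) I)%:R%:E * c + m%:E * c')%E.
  rewrite -ge0_integralZl//; last 2 first.
  - exact/measurable_EFinP.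
  - by move=> x _; rewrite lee_fin.
  rewrite -ge0_integralZl//; last 2 first.
  - by apply/measurable_EFinP; exact: measurable_funB.
  - by move=> x _; rewrite lee_fin subr_ge0.
  rewrite -ge0_integralD//; last 4 first.
  - by move=> x _; rewrite -EFinM lee_fin mulr_ge0.
  - by apply: measurable_funeM; exact/measurable_EFinP.
  - by move=> x _; rewrite -EFinM lee_fin mulr_ge0// subr_ge0.
  - by apply: measurable_funeM; apply/measurable_EFinP; exact: measurable_funB.
  apply: ae_eq_integral => //.
  - apply: (measurableT_comp (measurable_section1 Q mE)).
    exact: measurable_extremal_map.
  - by apply: emeasurable_funD; apply: measurable_funeM; apply/measurable_EFinP => //; exact: measurable_funB.
  have U0 : uniform_law (~` `[0, 1]%classic) = 0%E.
    rewrite (@uniform_law_eq _ set0) ?measure0// => x x01; split => //.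
  exists (~` `[0, 1]%classic); split; [exact: measurableC|exact: U0|].
  move=> x /=; apply: contra_not => x01; move: x01; rewrite /= in_itv/= => x01 _.
  rewrite QB; last first.
    by have := measurable_xsection (extremal_map (digit_set d k) x) mE; rewrite xsectionE.
  have zE : z x = 2 * `|x - 1 / 2|.
    rewrite /z min_r// mulrC -ler_pdivlMr// ler_norml.
    by move/andP: x01 => [? ?]; apply/andP; split; lra.
  under eq_bigr do rewrite uniform_law_concordant// -zE -EFinM.
  rewrite sumEFin -!EFinM -EFinD; congr EFin.
  under eq_bigr do rewrite mulrDr mulrCA [X in _ + X]mulrCA.
  rewrite big_split /= -mulr_sumr -/m [m * _]mulrC; congr (_ + _).
    by rewrite -mulr_suml w1 mul1r mulrC.
  by rewrite -mulr_sumr.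
have cf : c \is a fin_num.
  rewrite ge0_fin_numE//; apply: le_lt_trans (ltry 1); rewrite -cc'.
  by rewrite leeDl.
have c'f : c' \is a fin_num.
  rewrite ge0_fin_numE//; apply: le_lt_trans (ltry 1); rewrite -cc'.
  by rewrite leeDr.
have g1 : fine c + fine c' = 1 by rewrite -fineD// cc'.
rewrite (eq_bigr (fun k => (w k * ((monochromatic (digit_set d k) I)%:R * fine c + m * fine c'))%:E)).
  rewrite sumEFin; congr EFin; under eq_bigr do rewrite mulrDr !mulrA.
  by rewrite big_split /= -!mulr_suml w1 mul1r -/m -mulrDr g1 mulr1.
by move=> k _; rewrite inner EFinM EFinD !EFinM !fineK.
Qed.

End weights.

End mixture_law.

(** * The Student copula in terms of a direction and a radius *)

Section student_grades.
Context {R : realType} {d : nat}.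
Implicit Types (A : 'M[R]_d) (s u v : d.-tuple R) (nu r : R).

Definition t_vector A (z : d.-tuple R * R) : d.-tuple R :=
  [tuple z.2 * tnth (mxact A z.1) i | i < d].

Lemma measurable_t_vector A : measurable_fun setT (t_vector A).
Proof.
apply/measurable_fun_tnthP => i.
rewrite (_ : _ \o _ = (fun z : d.-tuple R * R => z.2 * tnth (mxact A z.1) i)); last first.
  by apply/funext => z /=; rewrite tnth_mktuple.
apply: measurable_funM; first exact: measurable_snd.
apply: (measurableT_comp (f := fun s => tnth (mxact A s) i)); last exact: measurable_fst.
by have /measurable_fun_tnthP/(_ i) := measurable_mxact A.
Qed.

Lemma measurable_student_cdf nu : 0 < nu -> measurable_fun setT (student_cdf nu).
Proof.
move=> nu0; apply: nondecreasing_measurable => // x y.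
by rewrite le_eqVlt => /predU1P[->//|/(student_cdf_lt nu0)/ltW].
Qed.

Definition t_grade nu A (z : d.-tuple R * R) : d.-tuple R :=
  [tuple student_cdf nu (tnth (t_vector A z) i) | i < d].

Lemma measurable_t_grade nu A : 0 < nu -> measurable_fun setT (t_grade nu A).
Proof.
move=> nu0; apply/measurable_fun_tnthP => i.
rewrite (_ : _ \o _ = student_cdf nu \o (fun z => tnth (t_vector A z) i)); last first.
  by apply/funext => z /=; rewrite tnth_mktuple.
apply: measurableT_comp; first exact: measurable_student_cdf.
by have /measurable_fun_tnthP/(_ i) := measurable_t_vector A.
Qed.

(** Forgets the underlying probability space: independence makes the joint law of
direction and radius a product measure. *)
Lemma t_copula_data nu (P : 'M[R]_d) (C : d.-tuple R -> R) :
  0 < nu -> is_t_copula nu P C ->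
  exists A (sigma : probability (d.-tuple R) R) (rho : probability R R),
    [/\ A *m A^T = P, sphere_uniform sigma, rho `]-oo, 0%R]%classic = 0%E,
      fisher_law d%:R nu (fun B => rho [set r | B (r ^+ 2 / d%:R)]) &
      forall u, cube u ->
        ((sigma \x rho) [set z | orthant u (t_grade nu A z)] = (C u)%:E)%E].
Proof.
move=> nu0 [disp [W [Pr [Rad [S [A [AP SU [Rad0 RadF] RS Cu]]]]]]].
exists A, (distribution Pr S), (distribution Pr Rad); split => //.
  change (Pr (Rad @^-1` `]-oo, 0%R]%classic) = 0%E).
  rewrite (_ : _ @^-1` _ = set0) ?measure0//.
  by rewrite -subset0 => w /=; rewrite in_itv/= leNgt Rad0.
move=> u cu; rewrite -Cu//.
have mSR : measurable_fun setT (fun w => (S w, Rad w)).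
  by apply: measurable_fun_pair.
have [Q QE] := pushforward_probability Pr mSR.
rewrite (product_measure_unique (m' := Q)).
- apply: etrans (QE _) _; congr (Pr _); apply/seteqP; split => w /= h i; have := h i;
  by rewrite !tnth_mktuple.
- move=> B1 B2 mB1 mB2; apply: etrans (QE _) _.
  change (Pr ((fun w => (S w, Rad w)) @^-1` (B1 `*` B2)) =
    Pr (S @^-1` B1) * Pr (Rad @^-1` B2))%E; rewrite muleC.
  by rewrite -RS//; congr (Pr _); apply/seteqP; split => w /= [].
- rewrite -[X in measurable X]setTI; apply: (measurable_t_grade A nu0) => //.
  exact: measurable_orthant.
Qed.

End student_grades.

(** * Directions of differences of independent vectors *)

Lemma product_section d1 d2 (T1 : measurableType d1) (T2 : measurableType d2)
    (R : realType) (mu : probability T1 R) (nu : probability T2 R) (A : set (T1 * T2)) :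
  ((mu \x nu) A = \int[mu]_x nu [set y | A (x, y)])%E.
Proof. by apply: eq_integral => x _; rewrite /= xsectionE. Qed.

Section direction.
Context {R : realType} {d : nat}.
Implicit Types (A : 'M[R]_d) (x y s u v : d.-tuple R) (B : set (d.-tuple R)).

Definition scale (r : R) x : d.-tuple R := [tuple r * tnth x i | i < d].

Lemma tnth_scale r x i : tnth (scale r x) i = r * tnth x i.
Proof. exact: tnth_mktuple. Qed.

Definition diff x y : d.-tuple R := [tuple tnth x i - tnth y i | i < d].

Lemma tnth_diff x y i : tnth (diff x y) i = tnth x i - tnth y i.
Proof. exact: tnth_mktuple. Qed.

Lemma mxact_scale A r x : mxact A (scale r x) = scale r (mxact A x).
Proof.
apply: eq_from_tnth => i; rewrite tnth_scale !tnth_mxact mulr_sumr.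
by apply: eq_bigr => j _; rewrite tnth_scale mulrCA.
Qed.

Lemma mxact_diff A x y : mxact A (diff x y) = diff (mxact A x) (mxact A y).
Proof.
apply: eq_from_tnth => i; rewrite tnth_diff !tnth_mxact -sumrB.
by apply: eq_bigr => j _; rewrite tnth_diff mulrBr.
Qed.

Lemma sqnorm_scale r x : sqnorm (scale r x) = r ^+ 2 * sqnorm x.
Proof.
rewrite /sqnorm mulr_sumr; apply: eq_bigr => i _.
by rewrite tnth_scale exprMn.
Qed.

Lemma sqnorm_diff x y : sqnorm (diff x y) = sqdist x y.
Proof. by apply: eq_bigr => i _; rewrite tnth_diff. Qed.

Lemma sqdist_ge0 x y : 0 <= sqdist x y.
Proof. by apply: sumr_ge0 => i _; exact: sqr_ge0. Qed.

Lemma sqdist_eq0 x y : (sqdist x y == 0) = (x == y).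
Proof.
apply/eqP/eqP => [/psumr_eq0P h|->]; last by apply: big1 => i _; rewrite subrr expr0n.
apply: eq_from_tnth => i; apply/eqP; rewrite -subr_eq0 -sqrf_eq0 h// => j _.
exact: sqr_ge0.
Qed.

(** The power vanishes at 0, so the direction from x to x is the zero vector, which
belongs to all cones considered below. *)
Definition direction x y : d.-tuple R := scale (sqdist x y `^ (- (1 / 2))) (diff y x).

Lemma sphere_direction x y : x != y -> sphere (direction x y).
Proof.
rewrite -sqdist_eq0 => xy; have xy0 : 0 < sqdist x y by rewrite lt_def xy sqdist_ge0.
rewrite /sphere/= sqnorm_scale sqnorm_diff -powR_mulrn ?powR_ge0// -powRrM.
rewrite (_ : - (1 / 2) * 2%:R = -1); last by field.
by rewrite (sqdistC y) powR_inv1 ?sqdist_ge0// mulVf.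
Qed.

Lemma direction_mxact Q x y : Q *m Q^T = 1%:M ->
  direction (mxact Q x) (mxact Q y) = mxact Q (direction x y).
Proof. by move=> QQ; rewrite /direction sqdist_mxact// mxact_scale mxact_diff. Qed.

Lemma measurable_direction : measurable_fun setT
  (fun z : d.-tuple R * d.-tuple R => direction z.1 z.2).
Proof.
apply/measurable_fun_tnthP => i.
rewrite (_ : _ \o _ = fun z => sqdist z.1 z.2 `^ (- (1 / 2)) * (tnth z.2 i - tnth z.1 i));
  last by apply/funext => z /=; rewrite tnth_scale tnth_diff.
apply: measurable_funM.
  by apply: (measurableT_comp (measurable_powR _)); exact: measurable_sqdist.
by apply: measurable_funB; apply: (measurableT_comp (measurable_tnth i)).
Qed.

Definition half_space_cone A (I : {set 'I_d}) : set (d.-tuple R) :=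
  [set v | (forall i, i \in I -> tnth (mxact A v) i <= 0) \/
           (forall i, i \in I -> 0 <= tnth (mxact A v) i)].

Lemma measurable_half_space_cone A I : measurable (half_space_cone A I).
Proof.
have mA i : measurable_fun setT (fun v => tnth (mxact A v) i).
  by have /measurable_fun_tnthP/(_ i) := measurable_mxact A.
rewrite [X in measurable X](_ : _ =
  [set v | forall i, i \in I -> [set v | tnth (mxact A v) i <= 0] v] `|`
  [set v | forall i, i \in I -> [set v | 0 <= tnth (mxact A v) i] v]) //.
by apply: measurableU; apply: measurable_forall => i _; exact: measurable_le_set.
Qed.

(** Concordance only concerns the signs of A (y - x), which are unaffected by
normalization. *)
Lemma concordant_direction A I x y :
  concordant I (mxact A x) (mxact A y) <-> half_space_cone A I (direction x y).
Proof.
rewrite /half_space_cone /= /direction mxact_scale mxact_diff.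
have [->|xy] := eqVneq x y.
  split => _; left => i _ //.
  by rewrite tnth_scale tnth_diff subrr mulr0.
have c0 : 0 < sqdist x y `^ (- (1 / 2)).
  by rewrite powR_gt0// lt_def sqdist_ge0 sqdist_eq0 xy.
split => -[] h; [right|left|right|left] => i /h; rewrite tnth_scale tnth_diff.
- by rewrite pmulr_rge0// subr_ge0.
- by rewrite pmulr_rle0// subr_le0.
- by rewrite pmulr_rle0// subr_le0.
- by rewrite pmulr_rge0// subr_ge0.
Qed.

Section rotation_invariant.
Variable chi : probability (d.-tuple R) R.
Hypothesis chi_rot : forall Q : 'M[R]_d, Q *m Q^T = 1%:M ->
  forall B, measurable B -> chi (mxact Q @^-1` B) = chi B.
Hypothesis chi_point : forall x, chi [set x] = 0%E.

(** Two independent copies almost never coincide, as there are no atoms, so the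
direction is on the sphere; rotating both copies rotates the direction. *)
Lemma direction_uniform (omega : probability (d.-tuple R) R) :
  (forall B, omega B = (chi \x chi)%E ((fun z => direction z.1 z.2) @^-1` B)) ->
  sphere_uniform omega.
Proof.
move=> omegaE; split=> [|Q QQ B mB].
  rewrite -/sphere omegaE.
  have m1 : measurable ((fun z => direction z.1 z.2) @^-1` sphere).
    by rewrite -[X in measurable X]setTI; apply: measurable_direction => //; exact: measurable_sphere.
  apply/eqP; rewrite eq_le probability_le1//= -(probability_setT (chi \x chi)%E).
  have mD : measurable [set z : d.-tuple R * d.-tuple R | sqdist z.1 z.2 = 0].
    by apply: measurable_eq_set => //; exact: measurable_sqdist.
  have D0 : (chi \x chi)%E [set z : d.-tuple R * d.-tuple R | sqdist z.1 z.2 = 0] = 0%E.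
    rewrite product_section integral0_eq// => x _ /=.
    rewrite (_ : [set y | _] = [set x]) ?chi_point//.
    apply/seteqP; split => y /= => [/eqP|->]; first by rewrite sqdist_eq0 => /eqP.
    by apply/eqP; rewrite sqdist_eq0.
  rewrite -[leRHS]adde0 -D0; apply: le_trans (measureU2 _ m1 mD).
  apply: le_measure; rewrite ?inE//; first exact: measurableU.
  move=> [x y] _ /=; have [->|xy] := eqVneq x y; [right|left].
    by apply/eqP; rewrite sqdist_eq0.
  exact: sphere_direction.
rewrite !omegaE !product_section.
pose g x := chi [set y | B (direction x y)].
have mE : measurable [set z : d.-tuple R * d.-tuple R | B (direction z.1 z.2)].
  by rewrite -[X in measurable X]setTI; exact: measurable_direction.
have mg : measurable_fun setT g by exact: (measurable_section1 chi mE).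
transitivity (\int[chi]_x g (mxact Q x))%E.
  apply: eq_integral => x _ /=; apply: etrans (chi_rot QQ _).
    by congr (chi _); apply/seteqP; split => y /=; rewrite direction_mxact.
  by have := measurable_xsection (mxact Q x) mE; rewrite xsectionE.
apply/esym; apply: integral_pushforward_probability => //.
  exact: measurable_mxact.
by move=> B' mB'; rewrite chi_rot.
Qed.

End rotation_invariant.

End direction.

(** * Concordance probabilities of the Student copula *)

Section t_kappa.
Context {R : realType} {d : nat}.
Variables (nu : R) (A : 'M[R]_d) (sigma : probability (d.-tuple R) R)
  (rho : probability R R).
Hypothesis nu0 : 0 < nu.
Hypothesis sigmaU : sphere_uniform sigma.
Implicit Types (x y s u v : d.-tuple R) (B : set (d.-tuple R)).

(** The squared radius has a density. *)
Lemma fisher_law_point : (0 < d)%N ->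
  fisher_law d%:R nu (fun B : set R => rho [set r | B (r ^+ 2 / d%:R)]) ->
  forall a, rho [set a] = 0%E.
Proof.
move=> d0 rhoF a; apply/eqP; rewrite eq_le measure_ge0 andbT.
have m1 : measurable [set r : R | r ^+ 2 / d%:R = a ^+ 2 / d%:R].
  by apply: measurable_eq_set => //; apply: measurable_funM => //; exact: measurable_funX.
apply: (@le_trans _ _ (rho [set r : R | r ^+ 2 / d%:R = a ^+ 2 / d%:R])).
  by apply: le_measure; rewrite ?inE// => r /= ->.
have /= -> := rhoF [set a ^+ 2 / d%:R] (measurable_set1 _).
have [p0|p0] := ltP 0 (a ^+ 2 / d%:R).
  rewrite (_ : _ `&` _ = [set a ^+ 2 / d%:R]) ?integral_set1//.
  by apply/seteqP; split => [x []//|x /= ->]; split => //; rewrite /= in_itv/= p0.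
rewrite (_ : _ `&` _ = set0) ?integral_set0//.
by rewrite -subset0 => x [/= ->]; rewrite in_itv/= ltNge p0.
Qed.

Lemma measurable_scale : measurable_fun setT (fun z : d.-tuple R * R => scale z.2 z.1).
Proof.
apply/measurable_fun_tnthP => i.
rewrite (_ : _ \o _ = fun z => z.2 * tnth z.1 i);
  last by apply/funext => z /=; rewrite tnth_scale.
apply: measurable_funM => //.
by apply: (measurableT_comp (measurable_tnth i)).
Qed.

Lemma spherical_law_exists : exists chi : probability (d.-tuple R) R,
  forall B, chi B = (sigma \x rho)%E [set z | B (scale z.2 z.1)].
Proof. exact: (pushforward_probability (sigma \x rho)%E measurable_scale). Qed.

Lemma spherical_law_rot (chi : probability (d.-tuple R) R) :
  (forall B, chi B = (sigma \x rho)%E [set z | B (scale z.2 z.1)]) ->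
  forall Q : 'M[R]_d, Q *m Q^T = 1%:M ->
  forall B, measurable B -> chi (mxact Q @^-1` B) = chi B.
Proof.
move=> chiE Q QQ B mB; rewrite !chiE !product_section.
have mE : measurable [set z : d.-tuple R * R | B (scale z.2 z.1)].
  by rewrite -[X in measurable X]setTI; exact: measurable_scale.
have mg := measurable_section1 rho mE.
apply/esym; rewrite (integral_pushforward_probability (P := sigma) (f := mxact Q))//=.
- apply: eq_integral => s _; congr (rho _).
  by apply/seteqP; split => r /=; rewrite mxact_scale.
- exact: measurable_mxact.
- by move=> B' mB'; case: sigmaU => _ ->.
Qed.

(** On the sphere, r s = x forces r to be the inner product of x and s, so each
section is contained in a point. *)
Lemma spherical_law_point (chi : probability (d.-tuple R) R) :
  (forall a, rho [set a] = 0%E) ->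
  (forall B, chi B = (sigma \x rho)%E [set z | B (scale z.2 z.1)]) ->
  forall x, chi [set x] = 0%E.
Proof.
move=> rho0 chiE x; rewrite chiE product_section.
rewrite (ae_eq_integral (cst 0%E)) ?integral_cst ?mul0e//.
- have mE : measurable [set z : d.-tuple R * R | sqdist (scale z.2 z.1) x = 0].
    apply: measurable_eq_set => //.
    apply: (measurableT_comp (f := fun y => sqdist y x)) measurable_scale.
    apply: measurable_sum => i; apply: measurable_funX; apply: measurable_funB => //.
    exact: measurable_tnth.
  apply: eq_measurable_fun (measurable_section1 rho mE) => s _ /=.
  congr (rho _); apply/seteqP; split => r /= => [/eqP|->].
    by rewrite sqdist_eq0 => /eqP.
  by apply/eqP; rewrite sqdist_eq0.
- apply: filterS (sphere_uniform_ae sigmaU) => s sS _ /=.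
  have mrs : measurable [set r | scale r s = x].
    have -> : [set r | scale r s = x] = [set r | sqdist (scale r s) x = 0].
      apply/seteqP; split => r /= => [->|/eqP]; last by rewrite sqdist_eq0 => /eqP.
      by apply/eqP; rewrite sqdist_eq0.
    apply: measurable_eq_set => //; apply: measurable_sum => i.
    apply: measurable_funX; apply: measurable_funB => //.
    rewrite (_ : (fun _ => _) = fun r : R => r * tnth s i); first exact: measurable_funM.
    by apply/funext => r; rewrite tnth_scale.
  apply/eqP; rewrite eq_le measure_ge0 andbT -(rho0 (inner x s)).
  apply: le_measure; rewrite ?inE// => r /= <-.
  rewrite /inner -[LHS]mulr1 -sS /sqnorm mulr_sumr.
  by apply: eq_bigr => i _; rewrite tnth_scale; ring.
Qed.

Lemma student_cdf_itv (x : R) : 0 < student_cdf nu x < 1.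
Proof.
rewrite student_cdf_gt0//=; have := student_cdf_gt0 nu0 (- x).
by rewrite student_cdfN// subr_gt0.
Qed.

Lemma student_cdf_le (x y : R) : (student_cdf nu x <= student_cdf nu y) = (x <= y).
Proof.
have [xy|yx] := leP x y; last by rewrite leNgt student_cdf_lt.
by move: xy; rewrite le_eqVlt => /predU1P[->|/(student_cdf_lt nu0)/ltW//]; rewrite lexx.
Qed.

Lemma t_grade_is_law C :
  (forall u, cube u ->
    ((sigma \x rho) [set z | orthant u (t_grade nu A z)] = (C u)%:E)%E) ->
  exists2 Q : probability (d.-tuple R) R, is_law C Q &
    forall B, Q B = ((sigma \x rho) (t_grade nu A @^-1` B))%E.
Proof.
move=> CE; have [Q QE] := pushforward_probability (sigma \x rho)%E (measurable_t_grade A nu0).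
exists Q => //; split=> [|u cu]; rewrite QE; last exact: CE.
rewrite (_ : _ @^-1` _ = setT) ?probability_setT//.
apply/seteqP; split => // z _ i; rewrite tnth_mktuple.
by case/andP: (student_cdf_itv (tnth (t_vector A z) i)) => /ltW -> /ltW ->.
Qed.

(** F_nu is strictly increasing, so the grades are concordant when the Student vectors
are; then the direction of the difference of two independent copies is uniform. *)
Lemma kappa_t_copula C (I : {set 'I_d}) : (forall a, rho [set a] = 0%E) ->
  (forall u, cube u ->
    ((sigma \x rho) [set z | orthant u (t_grade nu A z)] = (C u)%:E)%E) ->
  (2 <= #|I|)%N -> kappa C I = sigma (half_space_cone A I).
Proof.
move=> rho0 CE I2; have [Q CQ QE] := t_grade_is_law CE.
have gradeE z i : tnth (t_grade nu A z) i =
    student_cdf nu (tnth (mxact A (scale z.2 z.1)) i).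
  by rewrite mxact_scale tnth_scale [LHS]tnth_mktuple [X in student_cdf _ X]tnth_mktuple.
have [chi chiE] := spherical_law_exists.
have chi_rot := spherical_law_rot chiE.
have chi_point := spherical_law_point rho0 chiE.
have [omega omegaE] := pushforward_probability (chi \x chi)%E measurable_direction.
have omegaU := direction_uniform chi_rot chi_point omegaE.
rewrite (sphere_uniform_unique sigmaU omegaU); last exact: measurable_half_space_cone.
rewrite (kappa_section CQ I2).
have -> : omega (half_space_cone A I) =
    (\int[chi]_x chi [set y | half_space_cone A I (direction x y)])%E.
  exact: etrans (omegaE _) (product_section _ _ _).
rewrite (integral_pushforward_probability (measurable_t_grade A nu0) (fun B _ => QE B)) //; last first.
  exact: (measurable_section1 Q (measurable_concordant I)).
rewrite [RHS](integral_pushforward_probability (measurable_scale) (fun B _ => chiE B)) //; last first.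
  apply: (measurable_section1 chi (A := [set z | half_space_cone A I (direction z.1 z.2)])).
  rewrite -[X in measurable X]setTI; apply: measurable_direction => //.
  exact: measurable_half_space_cone.
apply: eq_integral => z _; rewrite QE [RHS]chiE.
congr ((sigma \x rho)%E _); apply/seteqP; split => z' /=;
  rewrite -concordant_direction => -[] h; [left|right|left|right] => i /h;
  by rewrite !gradeE student_cdf_le.
Qed.

End t_kappa.

(** * Sign patterns of the direction vector *)

Lemma ae_eq_measure d1 (T : measurableType d1) (R : realType) (mu : probability T R)
    (E F : set T) :
  measurable E -> measurable F -> {ae mu, forall x, E x <-> F x} -> mu E = mu F.
Proof.
move=> mE mF EF; rewrite -(setIT E) -(setIT F) -!integral_indic//.
apply: ae_eq_integral => //; try by apply/measurable_EFinP; exact: measurable_indic.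
apply: filterS EF => x EFx _; rewrite !indicE; congr ((nat_of_bool _)%:R)%:E.
by apply/idP/idP; rewrite !inE => /EFx.
Qed.

Lemma measurable_mxact_preimage (R : realType) (d : nat) (A : 'M[R]_d)
    (B : set (d.-tuple R)) : measurable B -> measurable (mxact A @^-1` B).
Proof. by move=> mB; rewrite -[X in measurable X]setTI; exact: measurable_mxact. Qed.

(** The law of A S depends on A only through A A^T, and not on the choice of the uniform
law. *)
Lemma sphere_uniform_gram (R : realType) (d : nat) (A A' : 'M[R]_d)
    (sigma sigma' : probability (d.-tuple R) R) :
  A *m A^T = A' *m A'^T -> sphere_uniform sigma -> sphere_uniform sigma' ->
  forall B, measurable B -> sigma (mxact A @^-1` B) = sigma' (mxact A' @^-1` B).
Proof.
move=> /gram_orthogonal[Q QQ <-] sU sU' B mB.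
have mAB := measurable_mxact_preimage A mB.
rewrite (sphere_uniform_unique sU sU' mAB); case: sU' => _ /(_ _ QQ _ mAB) <-.
by congr (sigma' _); apply/seteqP; split => s /=; rewrite mxactM.
Qed.

(** The same for integrals, which is how the radial laws of different nu are averaged
over one fixed direction. *)
Lemma sphere_uniform_gram_integral (R : realType) (d : nat) (A A' : 'M[R]_d)
    (sigma sigma' : probability (d.-tuple R) R) (g : d.-tuple R -> \bar R) :
  A *m A^T = A' *m A'^T -> sphere_uniform sigma -> sphere_uniform sigma' ->
  measurable_fun setT g -> (forall c, 0 <= g c)%E ->
  (\int[sigma]_s g (mxact A s) = \int[sigma']_s g (mxact A' s))%E.
Proof.
move=> AA sU sU' mg g0.
have [L LE] := pushforward_probability sigma (measurable_mxact A).
rewrite -(integral_pushforward_probability (measurable_mxact A) (fun B _ => LE B))//.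
apply: integral_pushforward_probability => //; first exact: measurable_mxact.
by move=> B mB; rewrite LE (sphere_uniform_gram AA sU sU' mB).
Qed.

Section sign_pattern.
Context {R : realType} {d : nat}.
Variables (A : 'M[R]_d) (sigma : probability (d.-tuple R) R).
Hypothesis d0 : (0 < d)%N.
Hypothesis A1 : forall i, (A *m A^T) i i = 1.
Hypothesis sigmaU : sphere_uniform sigma.
Implicit Types (c s u : d.-tuple R) (I J : {set 'I_d}).

Definition nonpositive_set c : {set 'I_d} := finset (fun i => ~~ (0 < tnth c i)).

Lemma in_nonpositive_set c i : (i \in nonpositive_set c) = ~~ (0 < tnth c i).
Proof. by rewrite inE. Qed.

Lemma measurable_nonpositive_set J : measurable [set c | nonpositive_set c = J].
Proof.
rewrite [X in measurable X](_ : _ = [set c | forall i, True ->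
  (if i \in J then [set c | tnth c i <= 0] else [set c | 0 < tnth c i]) c]).
  apply: measurable_forall => i _; have mi : measurable_fun setT (fun c : d.-tuple R => tnth c i).
    exact: measurable_tnth.
  by case: ifP => _; [exact: measurable_le_set|exact: measurable_lt_set].
apply/seteqP; split => c /= h.
  by move=> i _; rewrite -h in_nonpositive_set -leNgt; case: leP.
apply/finset.setP => i; have := h i Logic.I; rewrite in_nonpositive_set -leNgt.
by case: ifP => _ /=; case: leP.
Qed.

Lemma ae_coord_neq0 : {ae sigma, forall s, forall i, tnth (mxact A s) i != 0}.
Proof.
apply: filter_forall => i; exists [set s | tnth (mxact A s) i = 0]; split.
- apply: measurable_eq_set => //.
  by have /measurable_fun_tnthP/(_ i) := measurable_mxact A.
- exact: sphere_uniform_coord0.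
- by move=> s /= /negP; rewrite negbK => /eqP.
Qed.

Definition sign_weight J : R := fine (sigma [set s | nonpositive_set (mxact A s) = J]).

Lemma sign_weight_ge0 J : 0 <= sign_weight J.
Proof. exact: fine_ge0. Qed.

Let mE J : measurable [set s | nonpositive_set (mxact A s) = J].
Proof. exact: measurable_mxact_preimage (measurable_nonpositive_set J). Qed.

Let sign_patternE (g : {set 'I_d} -> R) s :
  ((g (nonpositive_set (mxact A s)))%:E = \sum_J
    (g J)%:E * (\1_[set s | nonpositive_set (mxact A s) = J] s)%:E)%E.
Proof.
rewrite (bigD1 (nonpositive_set (mxact A s)))//= big1 ?adde0; last first.
  by move=> J /eqP sJ; rewrite indicE memNset ?mule0//= => /esym.
by rewrite indicE mem_set// mule1.
Qed.

Let measurable_pattern_term (g : {set 'I_d} -> R) J : measurable_fun setT (fun s =>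
  (g J)%:E * (\1_[set s | nonpositive_set (mxact A s) = J] s)%:E)%E.
Proof. by apply: measurable_funeM; apply/measurable_EFinP; exact: measurable_indic. Qed.

Lemma measurable_sign_pattern (g : {set 'I_d} -> R) :
  measurable_fun setT (fun s => (g (nonpositive_set (mxact A s)))%:E).
Proof. by rewrite (funext (sign_patternE g)); exact: emeasurable_sum. Qed.

Lemma integral_sign_pattern (g : {set 'I_d} -> R) : (forall J, 0 <= g J) ->
  (\int[sigma]_s (g (nonpositive_set (mxact A s)))%:E =
   (\sum_J sign_weight J * g J)%:E)%E.
Proof.
move=> g0; under eq_integral do rewrite sign_patternE.
rewrite ge0_integral_sum//; last by move=> J s _; rewrite mule_ge0 ?lee_fin.
rewrite -sumEFin; apply: eq_bigr => J _.
rewrite ge0_integralZl_EFin//; last by apply/measurable_EFinP; exact: measurable_indic.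
by rewrite integral_indic// setIT EFinM muleC fineK ?fin_num_measure.
Qed.

Lemma sum_sign_weight : \sum_J sign_weight J = 1.
Proof.
apply: EFin_inj; under eq_bigr do rewrite -[sign_weight _]mulr1.
rewrite -(@integral_sign_pattern (fun=> 1))// integral_cst// mul1e.
exact: probability_setT.
Qed.

(** The reflection s -> - s preserves the uniform law and exchanges the signs; the
zero coordinates, which break the symmetry, are null. *)
Lemma sign_weightC J : sign_weight (~: J)%SET = sign_weight J.
Proof.
rewrite /sign_weight; congr fine.
(* The orthogonal matrix - 1 acts as s -> - s. *)
have QQ : (- 1%:M : 'M[R]_d) *m (- 1%:M)^T = 1%:M.
  by rewrite linearN/= trmx1 mulNmx mulmxN opprK mulmx1.
case: sigmaU => _ /(_ _ QQ _ (mE J)) <-.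
apply: ae_eq_measure => //; first exact: measurable_mxact_preimage.
apply: filterS ae_coord_neq0 => s s0 /=.
have -> : nonpositive_set (mxact A (mxact (- 1%:M) s)) = (~: nonpositive_set (mxact A s))%SET.
  apply/finset.setP => i; rewrite finset.in_setC !in_nonpositive_set negbK.
  rewrite -mxactM mulmxN mulmx1 (_ : tnth _ i = - tnth (mxact A s) i).
    by rewrite oppr_gt0 -leNgt le_eqVlt eq_sym (negPf (s0 i)).
  rewrite !tnth_mxact -sumrN; apply: eq_bigr => j _.
  by rewrite mxE mulNr.
by split => [->|<-]; rewrite finset.setCK.
Qed.

(** The probability that the nonpositive coordinates of A s form one of the two blocks
of the k-th splitting; both blocks are equally likely, whence the factor 2. *)
Definition extremal_weight (k : 'I_(2 ^ d.-1)) : R := 2 * sign_weight (digit_set d k).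

Lemma extremal_weight_ge0 k : 0 <= extremal_weight k.
Proof. by rewrite mulr_ge0// sign_weight_ge0. Qed.

Lemma sum_sign_weightM (g : {set 'I_d} -> R) :
  \sum_J sign_weight J * g J =
  \sum_k extremal_weight k * ((g (digit_set d k) + g (~: digit_set d k)%SET) / 2).
Proof.
rewrite (sum_digit_sets d0); apply: eq_bigr => k _.
by rewrite sign_weightC /extremal_weight; field.
Qed.

Lemma sum_extremal_weight : \sum_k extremal_weight k = 1.
Proof.
rewrite -sum_sign_weight; under [RHS]eq_bigr do rewrite -[sign_weight _]mulr1.
by rewrite (sum_sign_weightM (fun=> 1)); apply: eq_bigr => k _; field.
Qed.

(** Off the null set where a coordinate vanishes, lying in the cone means that I is
contained in the set of nonpositive coordinates or in its complement. *)
Lemma half_space_cone_weight I :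
  (sigma (half_space_cone A I) =
   (\sum_k extremal_weight k * (monochromatic (digit_set d k) I)%:R)%:E)%E.
Proof.
transitivity (\sum_J sign_weight J * (monochromatic J I)%:R)%:E; last first.
  rewrite sum_sign_weightM; congr EFin; apply: eq_bigr => k _; congr (_ * _).
  by rewrite /monochromatic finset.setCK orbC; field.
rewrite -(@integral_sign_pattern (fun J => (monochromatic J I)%:R))//.
rewrite -(setIT (half_space_cone A I)) -integral_indic//; last exact: measurable_half_space_cone.
apply: ae_eq_integral => //.
- by apply/measurable_EFinP; apply: measurable_indic; exact: measurable_half_space_cone.
- exact: (measurable_sign_pattern (fun J => (monochromatic J I)%:R)).
apply: filterS ae_coord_neq0 => s s0 _; rewrite indicE; congr ((nat_of_bool _)%:R)%:E.
apply/idP/idP; rewrite inE /half_space_cone /monochromatic /=.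
  move=> [] h; apply/orP; [left|right]; apply/fintype.subsetP => i /h.
    by rewrite in_nonpositive_set -leNgt.
  by rewrite finset.in_setC in_nonpositive_set negbK lt_def (s0 i).
move=> /orP[] /fintype.subsetP h; [left|right] => i /h.
  by rewrite in_nonpositive_set -leNgt.
by rewrite finset.in_setC in_nonpositive_set negbK => /ltW.
Qed.

End sign_pattern.

(** * Convergence of the Student copula *)

Section tails.
Context {R : realType}.
Implicit Types (nu L : R).

Lemma student_cdf0 nu : 0 < nu -> student_cdf nu 0 = 1 / 2.
Proof. by move=> nu0; have := student_cdfN nu0 0; rewrite oppr0; lra. Qed.

(** [tail_limit] with m = 1. *)
Lemma student_tail_limit L : 0 < L ->
  2 * (1 - student_cdf nu (Num.sqrt nu * expR (L / nu))) @[nu --> 0^'+] --> expR (- L).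
Proof.
move=> L0.
apply: (@tail_limit R 1 (fun nu => 2 / (nu * Beta (1 / 2) (nu / 2)))
  (fun nu l => 2 * (1 - student_cdf nu (Num.sqrt nu * expR (l / nu))))) => //.
- by move=> nu l nu0 _; exact: student_tail_upper.
- by move=> nu l nu0 _; exact: student_tail_lower.
- by move=> nu nu0; rewrite mul0r expR0 mulr1; exact: student_tail0.
- move=> nu l nu0; have := student_cdf0 nu0.
  have : student_cdf nu 0 < student_cdf nu (Num.sqrt nu * expR (l / nu)).
    by apply: student_cdf_lt => //; rewrite mulr_gt0 ?expR_gt0// sqrtr_gt0.
  by lra.
Qed.

(** The radius is almost surely positive, so its tail is that of its square. *)
Lemma fisher_radius_tail (rho : probability R R) (m b : R) :
  0 < m -> rho `]-oo, 0%R]%classic = 0%E -> 0 < b ->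
  rho [set r | (`](b ^+ 2 / m)%R, +oo[%classic : set R) (r ^+ 2 / m)] =
  rho `]b, +oo[%classic.
Proof.
move=> m0 rho0 b0.
have mS : measurable [set r : R | (`](b ^+ 2 / m)%R, +oo[%classic : set R) (r ^+ 2 / m)].
  rewrite [X in measurable X](_ : _ = [set r | b ^+ 2 / m < r ^+ 2 / m]).
    by apply: measurable_lt_set => //; apply: measurable_funM => //; exact: measurable_funX.
  by apply/seteqP; split => r /=; rewrite in_itv/= andbT.
apply/eqP; rewrite eq_le; apply/andP; split; last first.
  apply: le_measure; rewrite ?inE// => r /=; rewrite !in_itv/= !andbT => br.
  by rewrite ltr_pM2r ?invr_gt0// ltrXn2r ?(ltW b0)// (ltW (lt_trans b0 br)).
rewrite -[leRHS]adde0 -rho0.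
apply: le_trans (measureU2 _ _ _) => //.
apply: le_measure; rewrite ?inE//; first exact: measurableU.
move=> r /=; rewrite !in_itv/= !andbT ltr_pM2r ?invr_gt0// => br.
have [r0|r0] := leP r 0; [by right|left].
by rewrite -(ltr_pXn2r (ltn0Sn 1)) ?nnegrE ?ltW.
Qed.

(** [tail_limit] with m = d; the quantile (nu/d) e^(2L/nu) of R^2/d is the quantile
sqrt(nu) e^(L/nu) of R, which is why R and F_nu share the scale. *)
Lemma fisher_radius_tail_limit (rho : R -> probability R R) (d : nat) L : (2 <= d)%N ->
  (forall nu, 0 < nu -> rho nu `]-oo, 0%R]%classic = 0%E) ->
  (forall nu, 0 < nu ->
    fisher_law d%:R nu (fun B : set R => rho nu [set r | B (r ^+ 2 / d%:R)])) ->
  0 < L ->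
  fine (rho nu `]Num.sqrt nu * expR (L / nu), +oo[%classic) @[nu --> 0^'+] --> expR (- L).
Proof.
move=> d2 rho0 rhoF L0; have d2R : 2 <= d%:R :> R by rewrite ler_nat.
have d0 : 0 < d%:R :> R by rewrite (lt_le_trans _ d2R).
have finrho nu b : rho nu `]b, +oo[%classic \is a fin_num by exact: fin_num_measure.
have tailE nu l : 0 < nu ->
    rho nu [set r | (`](nu / d%:R * expR (2 * l / nu))%R, +oo[%classic : set R) (r ^+ 2 / d%:R)] =
    rho nu `]Num.sqrt nu * expR (l / nu), +oo[%classic.
  move=> nu0; rewrite -(@fisher_radius_tail _ d%:R)//; last 2 first.
    exact: rho0.
    by rewrite mulr_gt0 ?expR_gt0// sqrtr_gt0.
  rewrite exprMn sqr_sqrtr ?ltW// -expRM_natl.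
  by rewrite (_ : nu / d%:R * _ = nu * expR (2%:R * (l / nu)) / d%:R)// mulrA; ring.
apply: (@tail_limit R d%:R (fun nu => 2 / (nu * Beta (d%:R / 2) (nu / 2)))
  (fun nu l => fine (rho nu `]Num.sqrt nu * expR (l / nu), +oo[%classic))) => //.
- move=> nu l nu0 _; have := fisher_tail_upper d2R nu0 (rhoF _ nu0) l.
  by rewrite tailE// -lee_fin fineK.
- move=> nu l nu0 _; have := fisher_tail_lower d2R nu0 (rhoF _ nu0) l.
  by rewrite tailE// -lee_fin fineK.
- move=> nu nu0; have := fisher_tail0 d2R nu0 (rhoF _ nu0) (probability_setT _).
  have := tailE nu 0 nu0; rewrite mulr0 mul0r expR0 mulr1 => -> .
  by rewrite -lee_fin fineK.
- move=> nu l nu0; rewrite -lee_fin fineK//; exact: probability_le1.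
Qed.

End tails.

Section limit.
Context {R : realType} {d : nat}.
Implicit Types (A P : 'M[R]_d) (sigma : probability (d.-tuple R) R)
  (s u : d.-tuple R) (nu r : R) (J : {set 'I_d}).

Definition min_out J u : R := \big[Num.min/1]_(i < d | i \notin J) tnth u i.
Definition min_in J u : R := \big[Num.min/1]_(i < d | i \in J) tnth u i.

Lemma bigmin_cube (Q : pred 'I_d) u : cube u ->
  0 <= \big[Num.min/1]_(i < d | Q i) tnth u i <= 1.
Proof.
move=> cu; apply: (big_ind (fun x : R => 0 <= x <= 1)); first by rewrite ler01 lexx.
  by move=> x y /andP[x0 x1] /andP[y0 y1]; rewrite le_min x0 y0 ge_min x1.
by move=> i _; exact: cu.
Qed.

(** Limit of the conditional distribution function of the grades, given that J is the set
of negative coordinates of A S. *)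
Definition pattern_limit u J : R :=
  Num.max 0 (clamp (2 * min_out J u - 1) - clamp (1 - 2 * min_in J u)).

Lemma pattern_limit_extremal u (k : 'I_(2 ^ d.-1)) : cube u ->
  (pattern_limit u (digit_set d k) + pattern_limit u (~: digit_set d k)%SET) / 2 =
  extremal_copula k u.
Proof.
move=> cu; set D := digit_set d k.
have oE : min_out (~: D)%SET u = min_in D u.
  by apply: eq_bigl => i; rewrite finset.in_setC negbK.
have iE : min_in (~: D)%SET u = min_out D u by apply: eq_bigl => i; rewrite finset.in_setC.
rewrite /pattern_limit oE iE clamp_symmetrization ?bigmin_cube// mulrC mulKf//.
rewrite /extremal_copula /min_out /min_in; congr (Num.max 0 (_ + _ - 1)).
  by apply: eq_bigl => i; rewrite inE.
by apply: eq_bigl => i; rewrite inE.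
Qed.

Lemma t_grade_joint nu A s u :
  [set r | orthant u (t_grade nu A (s, r))] =
  joint_event (@student_cdf R) (tnth (mxact A s)) (tnth u) nu.
Proof.
apply/seteqP; split => r /= h i; have := h i;
  by rewrite [tnth (t_grade _ _ _) _]tnth_mktuple [tnth (t_vector _ _) _]tnth_mktuple.
Qed.

(** The grades depend on A and s through A s alone. *)
Lemma t_grade_mxact nu A s r : t_grade nu A (s, r) = t_grade nu 1%:M (mxact A s, r).
Proof.
apply: eq_from_tnth => i; rewrite !tnth_mktuple /=.
by rewrite -!tnth_mxact mxact1.
Qed.

Lemma measurable_grade_event nu A s u : 0 < nu ->
  measurable [set r | orthant u (t_grade nu A (s, r))].
Proof.
move=> nu0; rewrite t_grade_joint.
by apply: measurable_joint_event => // *; exact: student_cdf_lt.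
Qed.

Lemma measurable_grade_section nu A (rho : probability R R) u : 0 < nu ->
  measurable_fun setT (fun s => rho [set r | orthant u (t_grade nu A (s, r))]).
Proof.
move=> nu0.
apply: (measurable_section1 rho (A := [set z | orthant u (t_grade nu A z)])).
rewrite -[X in measurable X]setTI; apply: (measurable_t_grade A nu0) => //.
exact: measurable_orthant.
Qed.

(** Dominated convergence in s: the integrand is a probability, and for almost every s,
that is, when A s has no zero coordinate, it converges by [joint_limit].  The
limit only depends on the sign pattern, so its integral is a finite sum, in
which opposite patterns are paired. *)
Lemma t_copula_limit A sigma (rho : R -> probability R R) (C : R -> R) u :
  (2 <= d)%N -> (forall i, (A *m A^T) i i = 1) -> sphere_uniform sigma ->
  (forall nu, 0 < nu -> rho nu `]-oo, 0%R]%classic = 0%E) ->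
  (forall nu, 0 < nu ->
    fisher_law d%:R nu (fun B : set R => rho nu [set r | B (r ^+ 2 / d%:R)])) ->
  cube u ->
  (forall nu, 0 < nu ->
    (\int[sigma]_s rho nu [set r | orthant u (t_grade nu A (s, r))] = (C nu)%:E)%E) ->
  C nu @[nu --> 0^'+] --> extremal_mixture (extremal_weight A sigma) u.
Proof.
move=> d2 A1 sU rho0 rhoF cu CE; apply/cvg_at_rightP => v [v0 v_cvg].
have d0 : (0 < d)%N by exact: ltnW.
pose f n s := rho (v n) [set r | orthant u (t_grade (v n) A (s, r))].
have finf n s : f n s \is a fin_num by apply: fin_num_measure; exact: measurable_grade_event.
have [|||||_ _] := @dominated_convergence _ _ R sigma setT measurableT f
  (fun s => (pattern_limit u (nonpositive_set (mxact A s)))%:E) (cst 1%E).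
- by move=> n; exact: measurable_grade_section.
- exact: measurable_sign_pattern.
- apply: filterS (ae_coord_neq0 A1 sU) => s s0 _.
  apply: cvg_EFin; first by apply: nearW => n; exact: finf.
  have F_lt nu (x y : R) : 0 < nu -> x < y -> student_cdf nu x < student_cdf nu y.
    by move=> nu0; exact: student_cdf_lt.
  have F_N nu (x : R) : 0 < nu -> student_cdf nu (- x) = 1 - student_cdf nu x.
    by move=> nu0; exact: student_cdfN.
  have F_gt0 nu (x : R) : 0 < nu -> 0 < student_cdf nu x.
    by move=> nu0; exact: student_cdf_gt0.
  have := @joint_limit _ _ _ F_lt F_N F_gt0 (@student_tail_limit R) rho0
    (fun L => fisher_radius_tail_limit d2 rho0 rhoF) _ _ (tnth u) s0.
  move/cvg_at_rightP => /(_ v (conj v0 v_cvg)).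
  rewrite (_ : Num.max _ _ = pattern_limit u (nonpositive_set (mxact A s))); last first.
    rewrite /pattern_limit /min_out /min_in; congr (Num.max 0 (clamp (2 * _ - 1) - clamp (1 - 2 * _))).
      by apply: eq_bigl => i; rewrite in_nonpositive_set negbK.
    by apply: eq_bigl => i; rewrite in_nonpositive_set.
  by apply: cvg_trans; apply: near_eq_cvg; apply: nearW => n /=; rewrite /f t_grade_joint.
- exact: finite_measure_integrable_cst.
- by apply: nearW => s n _; rewrite gee0_abs// probability_le1//; exact: measurable_grade_event.
rewrite integral_sign_pattern; last by move=> J; rewrite /pattern_limit le_max lexx.
rewrite (sum_sign_weightM d0 A1 sU).
rewrite (eq_bigr (fun k => extremal_weight A sigma k * extremal_copula k u)); last first.
  by move=> k _; rewrite pattern_limit_extremal.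
move=> /fine_cvgP[_].
by apply: cvg_trans; apply: near_eq_cvg; apply: nearW => n /=; rewrite CE.
Qed.

End limit.

(** * Signature and limit *)

(** Although the representation of the copula depends on nu, its signature is computed
from any fixed matrix A with A A^T = P. *)
Lemma t_copula_signature (R : realType) (d : nat) (nu : R) (P A : 'M[R]_d)
    (sigma : probability (d.-tuple R) R) (C : d.-tuple R -> R) (I : {set 'I_d}) :
  (0 < d)%N -> (forall i, P i i = 1) -> A *m A^T = P -> sphere_uniform sigma ->
  0 < nu -> is_t_copula nu P C -> (2 <= #|I|)%N ->
  kappa C I =
  (\sum_k extremal_weight A sigma k * (monochromatic (digit_set d k) I)%:R)%:E.
Proof.
move=> d0 P1 AP sU nu0 hC I2.
have [A' [sigma' [rho [A'P sU' _ rhoF CE]]]] := t_copula_data nu0 hC.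
rewrite (kappa_t_copula nu0 sU' (fisher_law_point d0 rhoF) CE I2).
rewrite -half_space_cone_weight//; last by rewrite AP.
have mB : measurable (half_space_cone 1%:M I : set (d.-tuple R)).
  exact: measurable_half_space_cone.
have coneE (B : 'M[R]_d) : half_space_cone B I = mxact B @^-1` half_space_cone 1%:M I.
  by apply/seteqP; split => s; rewrite /half_space_cone /= mxact1.
by rewrite (coneE A') (coneE A); apply: sphere_uniform_gram => //; rewrite A'P.
Qed.

Theorem theorem4 (R : realType) (d : nat) (hd : (2 <= d)%N) (P : 'M[R]_d)
  (hP : correlation_mx P) (Ct : R -> d.-tuple R -> R)
  (hCt : forall nu : R, 0 < nu -> is_t_copula nu P (Ct nu)) :
  exists Cstar : d.-tuple R -> R,
    (forall nu : R, 0 < nu ->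
      [/\ extremal_mixture_copula Cstar,
          same_signature Cstar (Ct nu) &
          forall C : d.-tuple R -> R,
            extremal_mixture_copula C -> same_signature C (Ct nu) ->
            same_on_cube C Cstar]) /\
    (forall u : d.-tuple R, cube u -> Ct nu u @[nu --> 0^'+] --> Cstar u).
Proof.
have d0 : (0 < d)%N by exact: ltnW.
have [_ _ P1] := hP.
have [A [sigma [rho1 [AP sU _ _ _]]]] := t_copula_data ltr01 (hCt 1 ltr01).
have A1 i : (A *m A^T) i i = 1 by rewrite AP.
pose w := extremal_weight A sigma.
have w0 k : 0 <= w k by exact: extremal_weight_ge0.
have w1 : \sum_k w k = 1 by exact: sum_extremal_weight.
exists (extremal_mixture w); split=> [nu nu0|u cu].
  split; first exact: extremal_mixture_copula_exists.
  - move=> I; have [I2|I2] := leqP 2 #|I|; last by rewrite /kappa leqNgt I2.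
    rewrite (t_copula_signature d0 P1 AP sU nu0 (hCt _ nu0) I2).
    exact: kappa_extremal_mixture.
  - move=> C [_ [v [v0 v1 Cv]]] CCt.
    have vw : v =1 w.
      apply: (monochromatic_weights_inj d0); first by rewrite w1.
      move=> I I2; have := CCt I.
      rewrite (t_copula_signature d0 P1 AP sU nu0 (hCt _ nu0) I2).
      by rewrite (kappa_extremal_mixture v0 v1 Cv I2) => -[].
    by move=> u cu; rewrite Cv//; apply: eq_bigr => k _; rewrite vw.
(* All radial laws are averaged over the direction law obtained for nu = 1. *)
have /choice[rho rhoP] : forall nu, exists rho : probability R R, 0 < nu ->
    [/\ rho `]-oo, 0%R]%classic = 0%E,
      fisher_law d%:R nu (fun B : set R => rho [set r | B (r ^+ 2 / d%:R)]) &
      forall u, cube u ->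
        (\int[sigma]_s rho [set r | orthant u (t_grade nu A (s, r))] = (Ct nu u)%:E)%E].
  move=> nu; have [nu0|nu0] := ltP 0 nu; last by exists rho1.
  have [A' [sigma' [rho [A'P sU' rho0 rhoF CE]]]] := t_copula_data nu0 (hCt _ nu0).
  exists rho => _; split => // v cv; rewrite -CE// product_section.
  pose g c := rho [set r | orthant v (t_grade nu 1%:M (c, r))].
  have sectionE B s : rho [set r | orthant v (t_grade nu B (s, r))] = g (mxact B s).
    by congr (rho _); apply/seteqP; split => r /=; rewrite (t_grade_mxact _ B).
  under eq_integral do rewrite sectionE.
  under [RHS]eq_integral do rewrite sectionE.
  apply: sphere_uniform_gram_integral => //; first by rewrite A'P.
  exact: measurable_grade_section.
apply: (t_copula_limit hd A1 sU (rho := rho)) => //.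
- by move=> nu /rhoP[].
- by move=> nu /rhoP[].
- by move=> nu /rhoP[_ _]; exact.
Qed.
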